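(* Let $T$ be a fixed nonempty trie, with $k=|T|_{\mathsf e}$ leaves, and let $p_T:=\mathbb P(\mathcal T_k=T)$. Let $\mathcal T_n^*$ be a uniformly random fringe subtree of $\mathcal T_n$, let $\Phi_T(\mathcal T_n)$ be the number of fringe trees of $\mathcal T_n$ equal to $T$, and let $\psi_{\mathsf E,T}$, $\psi_{\mathsf E,\mathsf i}$, $H$, $d_{\mathbf p}$ be as in the context. Then, as $n\to\infty$, $$\mathbb P\bigl(\mathcal T_n^*=T\mid\mathcal T_n\bigr)=\frac{\Phi_T(\mathcal T_n)}{|\mathcal T_n|}=\frac{\psi_{\mathsf E,T}(\log n)}{\psi_{\mathsf E,\mathsf i}(\log n)+H}+o_p(1).$$ In particular, if $d_{\mathbf p}=0$, then the distribution converges in probability: $$\mathbb P\bigl(\mathcal T_n^*=T\mid\mathcal T_n\bigr)\overset{p}{\longrightarrow}\begin{cases}\dfrac{p_T}{(1+H)k(k-1)},&|T|\ge2,\\[2mm]\dfrac{H}{1+H},&T=\bullet.\end{cases}$$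
   Context: Strings. $\mathcal A$ is a fixed finite alphabet with $|\mathcal A|\ge2$; $\mathbf p=(p_\alpha)_{\alpha\in\mathcal A}$ is a probability distribution with all $p_\alpha>0$. $\mathcal A^*=\bigcup_{m\ge0}\mathcal A^m$ is the set of finite strings, with empty string $\epsilon$. $\Xi^{(1)},\Xi^{(2)},\dots$ are i.i.d. random infinite strings, each with i.i.d. letters having distribution $\mathbf p$. Tries. Given a set of $n$ distinct infinite strings, let $\nu_{\boldsymbol\alpha}$ be the number of them having prefix $\boldsymbol\alpha\in\mathcal A^*$. The trie they generate is the empty tree $\emptyset$ if $n=0$; otherwise it is the finite rooted tree (root $\epsilon$, the children of $\boldsymbol\alpha$ being the nodes $\boldsymbol\alpha\gamma$, $\gamma\in\mathcal A$) whose nodes are all $\boldsymbol\alpha\in\mathcal A^*$ with either $\nu_{\boldsymbol\alpha}\ge2$ (internal nodes), or $\nu_{\boldsymbol\alpha}=1$ and $\boldsymbol\alpha=\epsilon$ or the parent of $\boldsymbol\alpha$ is an internal node (external nodes = leaves). A trie is any tree arising in this way; tries are identified with their node sets, and equality is equality of node sets. $|T|$ and $|T|_{\mathsf e}$ are the numbers of nodes and of leaves of $T$; $\bullet$ is the trie with only one node. For a node $v\in T$, the fringe tree is $T^v:=\{\boldsymbol\beta\in\mathcal A^*:v\boldsymbol\beta\in T\}$. $\mathcal T_n$ is the random trie generated by $\Xi^{(1)},\dots,\Xi^{(n)}$. Given $\mathcal T_n$ ($n\ge1$), $\mathcal T_n^*:=\mathcal T_n^v$ where $v$ is a uniformly random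 node (internal or external) of $\mathcal T_n$. Constants. $\log$ is the natural logarithm. $H=-\sum_{\alpha}p_\alpha\log p_\alpha$. $d_{\mathbf p}$ is the largest $d>0$ such that $\log p_\alpha\in d\mathbb Z$ for all $\alpha\in\mathcal A$ if such a $d$ exists, and $d_{\mathbf p}=0$ otherwise. Mellin transform: $f^*(s)=\int_0^\infty f(x)x^{s-1}\,dx$. With $N_\lambda\sim\mathrm{Po}(\lambda)$ independent of the strings and $\widetilde{\mathcal T}_\lambda$ the trie generated by $\Xi^{(1)},\dots,\Xi^{(N_\lambda)}$, put $f_{\mathsf E,T}(\lambda):=\mathbb P(\widetilde{\mathcal T}_\lambda=T)$ for $|T|_{\mathsf e}\ge2$, and $f_{\mathsf E,\mathsf i}(\lambda):=\mathbb P(N_\lambda\ge2)=1-(1+\lambda)e^{-\lambda}$. For $f=f_{\mathsf E,T}$ (with $|T|_{\mathsf e}\ge2$) or $f=f_{\mathsf E,\mathsf i}$, the corresponding $\psi=\psi_{\mathsf E,T}$ or $\psi_{\mathsf E,\mathsf i}$ is defined by: if $d_{\mathbf p}=0$, $\psi(t):=f^*(-1)$ for all $t$; if $d=d_{\mathbf p}>0$, $\psi(t):=d\sum_{j=-\infty}^\infty e^{jd-t}f(e^{t-jd})$, a continuous $d$-periodic function with Fourier series $\sum_{m\in\mathbb Z}f^*(-1-\frac{2\pi m}{d}\mathrm i)e^{2\pi\mathrm imt/d}$. For $T=\bullet$ one uses the special definition $\psi_{\mathsf E,\bullet}(t):=H$. $o_p(1)$ denotes a quantity tending to $0$ in probability.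 *)

(* Defs.v *)
From mathcomp Require Export all_boot all_order all_algebra finmap.
From mathcomp Require Export all_classical all_reals all_analysis.

#[export] Set Implicit Arguments.
#[export] Unset Strict Implicit.
#[export] Unset Printing Implicit Defensive.

Import Order.TTheory GRing.Theory Num.Theory.
Import numFieldNormedType.Exports.

Local Open Scope classical_set_scope.
Local Open Scope ring_scope.

Section Tries.
Variable A : finType.

(* [x] is a family of [n] infinite strings; position [j] of a string is its
   letter number [j + 1]. *)
Definition prefix_count (n : nat) (x : 'I_n -> nat -> A) (s : seq A) : nat :=
  #|[set i : 'I_n | mkseq (x i) (size s) == s]|.

Definition internal (n : nat) (x : 'I_n -> nat -> A) (s : seq A) : Prop :=
  (2 <= prefix_count x s)%N.

Definition external (n : nat) (x : 'I_n -> nat -> A) (s : seq A) : Prop :=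
  prefix_count x s = 1%N /\
  (s = [::] \/ exists v a, s = rcons v a /\ internal x v).

(* For [n = 0] this is [set0]. If the strings are not distinct it is an
   infinite set, hence not a trie in the sense of [is_trie]; for i.i.d. random
   strings this happens with probability zero. *)
Definition trie (n : nat) (x : 'I_n -> nat -> A) : set (seq A) :=
  [set s | internal x s \/ external x s].

Definition is_trie (T : set (seq A)) : Prop :=
  exists (n : nat) (x : 'I_n -> nat -> A), injective x /\ T = trie x.

(* [fset_set S] is empty when [S] is infinite. *)
Definition num_nodes (T : set (seq A)) : nat := #|` fset_set T|%fset.

Definition num_leaves (T : set (seq A)) : nat :=
  num_nodes [set v | T v /\ forall a, ~ T (rcons v a)].

Definition bullet : set (seq A) := [set [::]].

Definition fringe (T : set (seq A)) (v : seq A) : set (seq A) :=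
  [set b | T (v ++ b)].

Definition fringe_count (T S : set (seq A)) : nat :=
  num_nodes [set v | S v /\ fringe S v = T].

End Tries.

Section Constants.
Variables (R : realType) (A : finType) (p : A -> R).

Definition entropy : R := - \sum_(a : A) p a * ln (p a).

Definition is_span (d : R) : Prop :=
  0 < d /\ forall a, exists m : int, ln (p a) = m%:~R * d.

(* The largest span if there is one, and 0 otherwise. *)
Definition max_span : R :=
  xget 0 [set d | is_span d /\ forall d', is_span d' -> d' <= d].

(* The Mellin transform is only needed at real arguments. *)
Definition mellin (f : R -> R) (s : R) : R :=
  \int[lebesgue_measure]_(x in `]0, +oo[) (f x * x `^ (s - 1)).

(* [esum] is the unordered sum of a nonnegative family; [psi] is only applied
   to functions with values in [0, 1]. *)
Definition psi (f : R -> R) (t : R) : R :=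
  if max_span == 0 then mellin f (-1)
  else max_span * fine (\esum_(j in [set: int])
         (expR (j%:~R * max_span - t) * f (expR (t - j%:~R * max_span)))%:E).

End Constants.

Section RandomTries.
Variables (R : realType) (A : finType) (p : A -> R).
Variables (d : measure_display) (Omega : measurableType d).
Variable P : probability Omega R.

(* [Xi i j] is letter [j + 1] of the random string number [i + 1]: all letters
   of all strings are mutually independent with distribution [p]. *)
Definition iid_strings (Xi : nat -> nat -> Omega -> A) : Prop :=
  [/\ forall i j a, measurable (Xi i j @^-1` [set a]),
      forall i j a, P (Xi i j @^-1` [set a]) = (p a)%:E
    & forall (J : {fset nat * nat}) (B : nat * nat -> set A),
        P (\bigcap_(q in [set` J]) (Xi q.1 q.2 @^-1` B q)) =
        (\prod_(q <- J) P (Xi q.1 q.2 @^-1` B q))%E].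

Definition random_trie (Xi : nat -> nat -> Omega -> A) (n : nat) (w : Omega) :
    set (seq A) :=
  trie (fun (i : 'I_n) (j : nat) => Xi i j w).

(* Given the random node set [S], [V] is a uniformly distributed node of [S]. *)
Definition uniform_node (S : Omega -> set (seq A)) (V : Omega -> seq A) :
    Prop :=
  (forall v, measurable (V @^-1` [set v])) /\
  forall (t : set (seq A)) (v : seq A), finite_set t -> t v ->
    P (S @^-1` [set t] `&` V @^-1` [set v]) =
    (P (S @^-1` [set t]) * ((num_nodes t)%:R^-1)%:E)%E.

(* The conditional probability of [E] given [X], as a random variable. It is
   the elementary quotient, so [X] has to be almost surely in a countable set,
   as the random tries are. *)
Definition cond_prob (U : Type) (E : set Omega) (X : Omega -> U) (w : Omega) :
    R :=
  fine (P (E `&` X @^-1` [set X w])) / fine (P (X @^-1` [set X w])).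

(* [X n - c n] tends to 0 in probability. *)
Definition cvg_in_prob (X : nat -> Omega -> R) (c : nat -> R) : Prop :=
  forall eps : R, 0 < eps ->
    P [set w | eps <= `|X n w - c n|] @[n --> \oo] --> 0%E.

Definition trie_prob (Xi : nat -> nat -> Omega -> A) (T : set (seq A)) : R :=
  fine (P [set w | random_trie Xi (num_leaves T) w = T]).

(* The product measure makes the Poisson variable independent of the strings.
   The value of [poisson_prob] does not depend on its second argument. *)
Definition f_ET (Xi : nat -> nat -> Omega -> A) (T : set (seq A)) (lambda : R) :
    R :=
  fine ((poisson_prob lambda 0 \x P)%E
          [set z : nat * Omega | random_trie Xi z.1 z.2 = T]).

Definition f_Ei (lambda : R) : R :=
  fine (poisson_prob lambda 0 [set n | (2 <= n)%N]).

Definition psi_ET (Xi : nat -> nat -> Omega -> A) (T : set (seq A)) (t : R) :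
    R :=
  if `[< T = @bullet A >] then entropy p else psi p (f_ET Xi T) t.

Definition psi_Ei (t : R) : R := psi p f_Ei t.

End RandomTries.

(* Main.v *)
(* Write [p_v] for the probability of the word [v]. The number of nodes [v] of
   the trie with a given property (being internal, having fringe tree [T]) has
   expectation close to the sum over all words [v] of [f (n p_v)], where [f] is
   the Poisson version of the probability of the property at the root. With
   [x = exp t], [Z t = exp (-t) * \sum_v f (x p_v)] is a bounded Lipschitz solution
   of the renewal equation [Z t = exp (-t) f (exp t) + \sum_a p_a Z (t + ln p_a)].
   A limit superior argument shows that [Z t - Z (t - h)] tends to [0] for every
   [h] that is approximated by lengths [- ln p_v] of words, and a conservation law
   then identifies the asymptotic value of [H * Z t] as [psi t].

   Events at words that are not prefixes of each other are nearly uncorrelated,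
   so the counts are concentrated by Chebyshev's inequality. Two of the [n]
   strings agree on their first [3 n] letters with probability tending to [0];
   otherwise the trie has [n] leaves, and a leafwise description of [T] turns
   both [Phi_T] and the number of nodes into sums of such counts. *)
Require Import Defs.
From mathcomp Require Import ring lra zify.
Import Order.TTheory GRing.Theory Num.Theory.
Import numFieldNormedType.Exports.
Local Open Scope classical_set_scope.
Local Open Scope ring_scope.

(** * Sums over words *)

(** The counts are never Poissonized as random variables: word by word, a binomial probability is
    compared with its Poisson value, with an error relative to [(n p_v)^2]. Such errors can be added
    over all words because [bump x = x^2 / (1 + x)^2], comparable to [min (1, x^2)], has sum [O(x)]
    over the words. The square near 0 reflects that two strings have to pass through the word; it
    also makes the sum over long words geometric with ratio [rho = \sum_a p_a^2 < 1]. As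
    [n^2 rho^(3 n)] tends to 0, cutting all words at length [3 n] costs nothing and leaves finite
    sums and finite product spaces.

    Counts at different words come from one sample, so they are not independent. For internal nodes,
    incomparable words are negatively correlated. For fringe trees the joint probability exceeds the
    product by a factor that is close to 1 only if both words are light; this is why short words are
    treated separately in the variance. *)

Section Words.
Variable A : finType.

(** The recursion is on the first letter, so that [big_words] is the first-step decomposition behind
    the renewal equation. *)
Fixpoint words (L : nat) : seq (seq A) :=
  if L is L'.+1 then [::] :: [seq a :: v | a <- enum A, v <- words L']
  else [::].

Lemma mem_words L v : (v \in words L) = (size v < L)%N.
Proof.
elim: L v => [|L IH] v //=; rewrite in_cons; case: v => [|a v] //=.
rewrite ltnS -IH; apply/allpairsP/idP => [[[b u] /= [_ h [_ ->]]] //|h].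
by exists (a, v); rewrite mem_enum.
Qed.

Lemma words_uniq L : uniq (words L).
Proof.
elim: L => [|L IH] //=; apply/andP; split.
  by apply/negP => /allpairsP[[b u] /= []].
by rewrite allpairs_uniq ?enum_uniq// => -[a u] [b v] _ _ /= [-> ->].
Qed.

Lemma big_words (R : nmodType) L (F : seq A -> R) :
  \sum_(v <- words L.+1) F v =
  F [::] + \sum_a \sum_(v <- words L) F (a :: v).
Proof.
rewrite /= big_cons; congr (_ + _).
by rewrite big_allpairs_dep big_enum.
Qed.

End Words.

Section WordSums.
Variables (R : realType) (A : finType) (p : A -> R).
Hypothesis hA : (2 <= #|A|)%N.
Hypothesis hp : forall a, 0 < p a.
Hypothesis hp1 : \sum_(a : A) p a = 1.

Definition wt (v : seq A) : R := \prod_(a <- v) p a.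

Lemma wt_nil : wt [::] = 1. Proof. exact: big_nil. Qed.
Lemma wt_cons a v : wt (a :: v) = p a * wt v. Proof. exact: big_cons. Qed.
Lemma wt_cat u v : wt (u ++ v) = wt u * wt v. Proof. exact: big_cat. Qed.
Lemma wt_gt0 v : 0 < wt v.
Proof. by apply: prodr_gt0 => a _. Qed.

Lemma p_lt1 a : p a < 1.
Proof.
have [b ba] : exists b, b != a.
  apply/existsP; apply: contraTT hA; rewrite negb_exists => /forallP h.
  rewrite -ltnNge ltnS -(card1 a) subset_leq_card//.
  by apply/fintype.subsetP => b _; move: (h b); rewrite negbK => /eqP ->; rewrite inE.
rewrite -hp1 (bigD1 a)//= (bigD1 b)//= ltrDl ltr_wpDr// sumr_ge0// => i _.
exact: ltW.
Qed.

Lemma wt_le1 v : wt v <= 1.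
Proof.
by elim: v => [|a v IH]; rewrite ?wt_nil// wt_cons mulr_ile1// ltW// ?wt_gt0// p_lt1.
Qed.

(** The probability that two independent letters agree; its [i]-th power is the sum of the squared
    weights of the words of length [i]. *)
Definition coincidence : R := \sum_a p a ^+ 2.
Local Notation rho := coincidence.

Lemma coincidence_ge0 : 0 <= rho.
Proof. by apply: sumr_ge0 => a _; rewrite sqr_ge0. Qed.

Lemma coincidence_lt1 : rho < 1.
Proof.
have /card_gt0P[a _] : (0 < #|A|)%N by exact: ltnW.
rewrite -hp1 /coincidence (bigD1 a)//= [ltRHS](bigD1 a)//=.
have pp b : p b ^+ 2 < p b by rewrite expr2 gtr_pMl// p_lt1.
by rewrite ltr_leD ?pp// ler_sum// => b _; exact/ltW/pp.
Qed.

Definition wsum (L : nat) (f : R -> R) (x : R) : R :=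
  \sum_(v <- words A L) f (x * wt v).

Lemma wsum0 f x : wsum 0 f x = 0. Proof. exact: big_nil. Qed.

Lemma wsumS L f x : wsum L.+1 f x = f x + \sum_a wsum L f (p a * x).
Proof.
rewrite /wsum big_words wt_nil mulr1; congr (_ + _).
by apply: eq_bigr => a _; apply: eq_bigr => v _; rewrite wt_cons mulrA (mulrC x).
Qed.

Lemma ler_wsum L f g x : (forall y, 0 < y -> f y <= g y) -> 0 < x ->
  wsum L f x <= wsum L g x.
Proof. by move=> h x0; apply: ler_sum => v _; apply: h; rewrite mulr_gt0// wt_gt0. Qed.

Lemma wsum_norm L f x : `|wsum L f x| <= wsum L (fun y => `|f y|) x.
Proof. exact: ler_norm_sum. Qed.

Lemma wsumZ L c f x : wsum L (fun y => c * f y) x = c * wsum L f x.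
Proof. by rewrite /wsum mulr_sumr. Qed.

Lemma wsumB L f g x : wsum L (fun y => f y - g y) x = wsum L f x - wsum L g x.
Proof. by rewrite /wsum sumrB. Qed.

(** The comparison function for all sources: quadratic at 0, which makes sums over words converge,
    and bounded at infinity, which keeps these sums of order [x]. *)
Definition bump (x : R) : R := x ^+ 2 / (1 + x) ^+ 2.

Lemma bump_ge0 x : 0 <= bump x.
Proof. by rewrite /bump divr_ge0 ?sqr_ge0. Qed.

Lemma bump_gt0 x : 0 < x -> 0 < bump x.
Proof. by move=> x0; rewrite divr_gt0 ?exprn_gt0// addr_gt0. Qed.

Lemma bump_le_sqr x : 0 < x -> bump x <= x ^+ 2.
Proof.
move=> x0; rewrite /bump ler_piMr ?sqr_ge0// invf_le1 ?exprn_gt0 ?addr_gt0//.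
by rewrite expr_ge1//; lra.
Qed.

Lemma bump_ge x K : 0 <= x <= K -> x ^+ 2 <= (1 + K) ^+ 2 * bump x.
Proof.
move=> /andP[x0 xK]; rewrite /bump mulrA ler_pdivlMr ?exprn_gt0 ?ltr_wpDr//.
by rewrite mulrC ler_wpM2r ?sqr_ge0// lerXn2r ?nnegrE ?lerD2l//; lra.
Qed.

Lemma bump_ge4 x : 1 <= x -> 1 <= 4 * bump x.
Proof.
move=> x1; have h : 0 < (1 + x) ^+ 2 by rewrite exprn_gt0//; lra.
by rewrite /bump mulrA ler_pdivlMr// mul1r; nra.
Qed.

(** This equals [1 - coincidence]; the present form is the one produced by the supersolution
    computation. *)
Definition spread : R := \sum_a p a * (1 - p a).

Lemma spread_gt0 : 0 < spread.
Proof.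
have /card_gt0P[a _] : (0 < #|A|)%N by exact: ltnW.
have pp b : 0 < p b * (1 - p b) by rewrite mulr_gt0// subr_gt0 p_lt1.
rewrite /spread (bigD1 a)//= ltr_wpDr ?pp// sumr_ge0// => b _.
exact/ltW/pp.
Qed.

(* [x^2/(1+x)] is a supersolution of the renewal equation with source [bump]. *)
Lemma wsum_bump L x : 0 < x -> wsum L bump x <= x ^+ 2 / (1 + x) / spread.
Proof.
have h0 := spread_gt0; elim: L x => [|L IH] x x0.
  by rewrite wsum0 !divr_ge0 ?sqr_ge0// ?ltW//; lra.
rewrite wsumS.
apply: (@le_trans _ _ (bump x + \sum_a (p a * x) ^+ 2 / (1 + p a * x) / spread)).
  by rewrite lerD2l ler_sum// => a _; apply: IH; rewrite mulr_gt0.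
rewrite -mulr_suml ler_pdivlMr// mulrDl divfK ?gt_eqF//.
rewrite /spread mulr_sumr -big_split/=.
have -> : x ^+ 2 / (1 + x) = \sum_a p a * (x ^+ 2 / (1 + x)).
  by rewrite -mulr_suml hp1 mul1r.
apply: ler_sum => a _; rewrite /bump.
have pa := hp a; have pa1 := p_lt1 a.
have px : 0 < p a * x by rewrite mulr_gt0.
rewrite -subr_ge0.
have -> : p a * (x ^+ 2 / (1 + x)) - (x ^+ 2 / (1 + x) ^+ 2 * (p a * (1 - p a)) +
   (p a * x) ^+ 2 / (1 + p a * x)) =
   p a * (1 - p a) * x ^+ 2 * (x * (1 - p a)) / ((1 + x) ^+ 2 * (1 + p a * x)).
  by field; rewrite !lt0r_neq0//; lra.
rewrite divr_ge0 ?mulr_ge0 ?sqr_ge0// ?ltW//; nra.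
Qed.

Lemma wsum_bump_le L x : 0 < x -> wsum L bump x <= x / spread.
Proof.
move=> x0; apply: (le_trans (wsum_bump L x0)).
rewrite ler_pM2r ?invr_gt0 ?spread_gt0// ler_pdivrMr; nra.
Qed.

(** A Markov bound: each counted word contributes at least 1/4 to the sum of [bump] at [x / K]. *)
Lemma count_heavy L x K : 0 < x -> 0 < K ->
  \sum_(v <- words A L | K <= x * wt v) (1 : R) <= 4 * x / (K * spread).
Proof.
move=> x0 K0; apply: (@le_trans _ _ (4 * wsum L bump (x / K))).
  rewrite /wsum mulr_sumr big_mkcond/=; apply: ler_sum => v _.
  case: ifPn => h; last by rewrite mulr_ge0// bump_ge0.
  by apply: bump_ge4; rewrite mulrAC ler_pdivlMr// mul1r.
rewrite -mulrA ler_pM2l// (le_trans (wsum_bump_le _ _)) ?divr_gt0//.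
by rewrite invfM mulrA.
Qed.

Lemma sum_wt2 L x : wsum L (fun y => y ^+ 2) x = x ^+ 2 * \sum_(i < L) rho ^+ i.
Proof.
elim: L x => [|L IH] x; first by rewrite wsum0 big_ord0 mulr0.
rewrite wsumS big_ord_recl expr0 mulrDr mulr1; congr (_ + _).
under eq_bigr do rewrite IH exprMn -mulrA.
rewrite -mulr_suml -/rho mulrCA; congr (_ * _).
by rewrite mulr_sumr; apply: eq_bigr => i _; rewrite exprS.
Qed.

Lemma wsum_widen L M f x : wsum (L + M) f x =
  wsum L f x + \sum_(v <- words A (L + M) | (L <= size v)%N) f (x * wt v).
Proof.
rewrite /wsum (bigID (fun v => (size v < L)%N))/=; congr (_ + _); last first.
  by apply: eq_bigl => v; rewrite -leqNgt.
rewrite -big_filter; apply: perm_big; apply: uniq_perm; rewrite ?filter_uniq ?words_uniq//.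
move=> v; rewrite mem_filter !mem_words.
by apply/idP/idP => [/andP[]//|h]; rewrite h /= (leq_trans h) ?leq_addr.
Qed.

Lemma sum_geo L M : \sum_(v <- words A (L + M) | (L <= size v)%N) wt v ^+ 2 <=
  rho ^+ L / (1 - rho).
Proof.
have := wsum_widen L M (fun y => y ^+ 2) 1.
rewrite !sum_wt2 expr1n !mul1r => /eqP; rewrite addrC -subr_eq => /eqP.
under [X in _ = X -> _]eq_bigr do rewrite mul1r.
move=> <-; have r1 := coincidence_lt1; have r0 := coincidence_ge0.
have geo n : \sum_(i < n) rho ^+ i = (1 - rho ^+ n) / (1 - rho).
  apply/eqP; rewrite eq_sym -subr_eq0 -[X in _ / X]opprB invrN mulrN.
  rewrite -mulNr opprB subrX1 mulrAC divff ?mul1r ?subrr// subr_eq0.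
  by rewrite lt_eqF.
rewrite !geo -mulrBl ler_pM2r ?invr_gt0 ?subr_gt0//.
by have := exprn_ge0 (L + M) r0; lra.
Qed.

End WordSums.

Section WordLimits.
Variables (R : realType) (A : finType) (p : A -> R).
Hypothesis hA : (2 <= #|A|)%N.
Hypothesis hp : forall a, 0 < p a.
Hypothesis hp1 : \sum_(a : A) p a = 1.
Local Notation wt := (wt p).
Local Notation wsum := (wsum p).
Local Notation rho := (coincidence p).

(** Weaker than a bound by [bump], but enough for convergence of the sum over all words. It also
    covers [x * G x] with [G] a primitive, which is unbounded at infinity in general. *)
Definition quadratic (C : R) (f : R -> R) := forall y, 0 < y -> `|f y| <= C * y ^+ 2.

Definition wlim (f : R -> R) (x : R) : R := limn (fun L => wsum L f x).

Lemma quadratic_cst_ge0 C f : quadratic C f -> 0 <= C.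
Proof.
by move=> /(_ 1 ltr01); rewrite expr1n mulr1; apply: le_trans.
Qed.

Lemma wsum_diff C f L M x : quadratic C f -> 0 < x ->
  `|wsum (L + M) f x - wsum L f x| <= C * x ^+ 2 * (rho ^+ L / (1 - rho)).
Proof.
move=> h x0; rewrite wsum_widen addrAC subrr add0r.
apply: (le_trans (ler_norm_sum _ _ _)).
apply: (@le_trans _ _ (\sum_(v <- words A (L + M) | (L <= size v)%N)
    C * x ^+ 2 * wt v ^+ 2)).
  apply: ler_sum => v _; rewrite -mulrA -exprMn; apply: h.
  by rewrite mulr_gt0// wt_gt0.
rewrite -mulr_sumr ler_wpM2l//; last exact: sum_geo.
by rewrite mulr_ge0 ?sqr_ge0//; exact: quadratic_cst_ge0 h.
Qed.

Lemma is_cvg_wsum C f x : quadratic C f -> 0 < x ->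
  cvgn (fun L => wsum L f x).
Proof.
move=> h x0; have C0 := quadratic_cst_ge0 h.
(* Nonnegative terms give monotone partial sums; [f] is then written as the difference of
   [f y + C * y ^+ 2] and [C * y ^+ 2]. *)
have key g : (forall y, 0 < y -> 0 <= g y <= 2 * C * y ^+ 2) ->
    cvgn (fun L => wsum L g x).
  move=> hg; apply: nondecreasing_is_cvgn.
    apply/nondecreasing_seqP => L; rewrite -addn1 wsum_widen lerDl.
    by apply: sumr_ge0 => v _; have /andP[] := hg (x * wt v) (mulr_gt0 x0 (wt_gt0 hp v)).
  exists (2 * C * x ^+ 2 * (rho ^+ 0 / (1 - rho))) => _ [L _ <-].
  have := @wsum_diff (2 * C) g 0 L x _ x0.
  rewrite wsum0 subr0 add0n => hh; apply: (le_trans (ler_norm _)); apply: hh.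
  by move=> y y0; have /andP[g0 g1] := hg y y0; rewrite ger0_norm.
have -> : (fun L => wsum L f x) = (fun L => wsum L (fun y => f y + C * y ^+ 2) x)
     - (fun L => wsum L (fun y => C * y ^+ 2) x).
  by apply/funext => L; rewrite /= !fctE -wsumB; congr (wsum L _ x);
    apply/funext => y; rewrite addrK.
apply: is_cvgB; apply: key => y y0.
  have := h y y0; rewrite ler_norml => /andP[h1 h2].
  by apply/andP; split; lra.
have h0 : 0 <= C * y ^+ 2 by rewrite mulr_ge0 ?sqr_ge0.
by apply/andP; split; lra.
Qed.

Lemma wlim_near C f L x : quadratic C f -> 0 < x ->
  `|wlim f x - wsum L f x| <= C * x ^+ 2 * (rho ^+ L / (1 - rho)).
Proof.
move=> h x0; have hc := is_cvg_wsum h x0.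
have hc' : (fun M => `|wsum (L + M) f x - wsum L f x|) @ \oo -->
    `|wlim f x - wsum L f x|.
  apply: cvg_norm; apply: cvgB; last exact: cvg_cst.
  have := hc; rewrite -(@cvg_shiftn L _ (fun L => wsum L f x)).
  by under eq_fun do rewrite addnC.
rewrite -(cvg_lim (@Rhausdorff R) hc'); apply: limr_le.
  by apply/cvg_ex; eexists; exact: hc'.
by apply: nearW => M; exact: wsum_diff.
Qed.

Lemma wlim_renewal C f x : quadratic C f -> 0 < x ->
  wlim f x = f x + \sum_a wlim f (p a * x).
Proof.
move=> h x0.
have hc := is_cvg_wsum h x0.
apply: (cvg_lim (@Rhausdorff R)); rewrite -(@cvg_shiftS _ (fun L => wsum L f x)).
under eq_fun do rewrite wsumS.
apply: cvgD; first exact: cvg_cst.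
by apply: cvg_big => [|a _]; [exact: add_continuous|]; apply: (is_cvg_wsum h); rewrite mulr_gt0.
Qed.

Lemma wlim_le_cst C f x M : quadratic C f -> 0 < x ->
  (forall L, `|wsum L f x| <= M) -> `|wlim f x| <= M.
Proof.
move=> h x0 hM; have hc : (fun L => `|wsum L f x|) @ \oo --> `|wlim f x|.
  by apply: cvg_norm; exact: is_cvg_wsum h x0.
rewrite -(cvg_lim (@Rhausdorff R) hc); apply: limr_le.
  by apply/cvg_ex; eexists; exact: hc.
exact: nearW.
Qed.

Lemma bump_quadratic C f : (forall y, 0 < y -> `|f y| <= C * bump y) ->
  quadratic C f.
Proof.
move=> h y y0; apply: (le_trans (h y y0)); rewrite ler_wpM2l ?bump_le_sqr//.
have := le_trans (normr_ge0 _) (h y y0); by rewrite pmulr_lge0// bump_gt0.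
Qed.

Lemma wsum_bound C f L x : 0 < x -> (forall y, 0 < y -> `|f y| <= C * bump y) ->
  `|wsum L f x| <= C / spread p * x.
Proof.
move=> x0 h; apply: (le_trans (wsum_norm _ _ _ _)).
apply: (@le_trans _ _ (wsum L (fun y => C * bump y) x)).
  exact: ler_wsum.
rewrite wsumZ -mulrA ler_wpM2l// ?(quadratic_cst_ge0 (bump_quadratic h))//.
by rewrite mulrC; exact: wsum_bump_le.
Qed.

Lemma wlim_bound C f x : 0 < x -> (forall y, 0 < y -> `|f y| <= C * bump y) ->
  `|wlim f x| <= C / spread p * x.
Proof.
move=> x0 h; apply: (wlim_le_cst (bump_quadratic h) x0) => L.
exact: wsum_bound.
Qed.

Lemma wlimB C f g x : quadratic C f -> quadratic C g -> 0 < x ->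
  wlim (fun y => f y - g y) x = wlim f x - wlim g x.
Proof.
move=> hf hg x0; apply: (cvg_lim (@Rhausdorff R)).
under eq_fun do rewrite wsumB.
by apply: cvgB; [exact: is_cvg_wsum hf x0|exact: is_cvg_wsum hg x0].
Qed.

Lemma wlimZ C f c x : quadratic C f -> 0 < x ->
  wlim (fun y => c * f y) x = c * wlim f x.
Proof.
move=> hf x0; apply: (cvg_lim (@Rhausdorff R)).
under eq_fun do rewrite wsumZ.
by apply: cvgMr; exact: is_cvg_wsum hf x0.
Qed.

Lemma wlim_dilate f c x : wlim (fun y => f (c * y)) x = wlim f (c * x).
Proof.
rewrite /wlim; congr (limn _); apply/funext => L.
by apply: eq_bigr => v _; rewrite mulrA.
Qed.

End WordLimits.

(** * Renewal theory *)

Section Semigroup.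
Variables (R : realType) (A : finType) (s : A -> R).
Hypothesis s0 : forall a, 0 < s a.

Definition len (v : seq A) : R := \sum_(a <- v) s a.

Lemma len_nil : len [::] = 0. Proof. exact: big_nil. Qed.
Lemma len_cons a v : len (a :: v) = s a + len v. Proof. exact: big_cons. Qed.
Lemma len_cat u v : len (u ++ v) = len u + len v. Proof. exact: big_cat. Qed.
Lemma len_ge0 v : 0 <= len v.
Proof. by apply: sumr_ge0 => a _; exact: ltW. Qed.

Lemma len_rep i u : len (flatten (nseq i u)) = i%:R * len u.
Proof.
by elim: i => [|i IH]; rewrite ?len_nil ?mul0r//= len_cat IH -natr1 mulrDl mul1r addrC.
Qed.

Lemma truncn_bounds (x y : R) : 0 <= x -> 0 < y ->
  (Num.truncn (x / y))%:R * y <= x < ((Num.truncn (x / y))%:R + 1) * y.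
Proof.
move=> x0 y0; rewrite -ler_pdivlMr// -ltr_pdivrMr// natr1.
by apply: truncn_itv; rewrite divr_ge0// ltW.
Qed.

(** With [e = len u - len v], the word made of [i] copies of [u] and [m - i] copies of [v] has
    length [m * len v + i * e]. Once [m * e] exceeds [len v], the ranges for successive [m] overlap
    and leave no gap longer than [e]. *)
Lemma cover_cofinal u v : 0 < len u - len v ->
  exists Y, forall y, Y <= y -> exists w, 0 <= y - len w < len u - len v.
Proof.
move=> duv.
(* An empty [v] has length 0; putting the same letter in front of both words keeps the
   difference. *)
wlog v0 : u v duv / 0 < len v.
  move=> H; have [v0|] := ltrP 0 (len v); first exact: H.
  case: u duv => [|a u]; first by have := len_ge0 v; rewrite len_nil; lra.
  move=> duv _; have := H (a :: a :: u) (a :: v).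
  rewrite !len_cons opprD addrACA subrr add0r; apply; first by rewrite -len_cons.
  by rewrite ltr_wpDr ?len_ge0.
set e := len u - len v in duv *.
have /andP[_ hm] := truncn_bounds (len_ge0 v) duv.
rewrite natr1 in hm; set m0 := (Num.truncn _).+1 in hm.
exists (m0%:R * len v) => y hy.
have y0 : 0 <= y by apply: le_trans hy; rewrite mulr_ge0// ltW.
have /andP[h1 h2] := truncn_bounds y0 v0.
set m := Num.truncn _ in h1 h2.
have mm : (m0 <= m)%N.
  rewrite -ltnS -(ltr_nat R) -natr1 -(ltr_pM2r v0); lra.
have z0 : 0 <= y - m%:R * len v by lra.
have /andP[h3 h4] := truncn_bounds z0 duv.
set i := Num.truncn _ in h3 h4.
have im : (i <= m)%N.
  apply: leq_trans mm; rewrite -ltnS -(ltr_nat R) -(ltr_pM2r duv) -natr1.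
  by rewrite mulrDl; lra.
exists (flatten (nseq i u) ++ flatten (nseq (m - i) v)).
rewrite len_cat !len_rep natrB// /e in h3 h4 *.
by apply/andP; split; lra.
Qed.

Definition common_span (d : R) := 0 < d /\ forall a, exists m : int, s a = m%:~R * d.

Lemma span_len d w : common_span d -> exists m : int, len w = m%:~R * d.
Proof.
move=> [_ hd]; elim: w => [|a w [m IH]]; first by exists 0; rewrite len_nil mul0r.
by have [k hk] := hd a; exists (k + m); rewrite len_cons IH hk intrD mulrDl.
Qed.

Lemma span_dvd_pos (d : R) (m : int) : 0 < d -> 0 < m%:~R * d -> d <= m%:~R * d.
Proof.
move=> d0; rewrite pmulr_lgt0// ltr0z => m0.
by apply: ler_peMl; [exact: ltW|rewrite ler1z -gtz0_ge1].
Qed.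

(** Euclid's algorithm in the limit: either differences of lengths get below [eta], or their
    positive infimum is attained. In the second case it divides every step, and it is a multiple of
    every common span, hence the largest one. *)
Lemma small_or_span (a0 : A) (eta : R) : 0 < eta ->
  (exists u v, 0 < len u - len v < eta) \/
  (exists u v, common_span (len u - len v) /\
     forall d, common_span d -> d <= len u - len v).
Proof.
move=> eta0.
have [|nosmall] := pselect (exists u v, 0 < len u - len v < eta); [by left|right].
pose G := [set x : R | 0 < x /\ exists u v, x = len u - len v].
have hG : has_inf G.
  split; last by exists 0 => x [x0 _]; exact: ltW.
  exists (s a0); split => //; exists [:: a0], [::].
  by rewrite len_cons len_nil addr0 subr0.
have lowG x : G x -> inf G <= x by move=> Gx; apply: ge_inf => //; exact: hG.2.
(* Were the infimum not attained, two elements of [G] close to it would differ by a positive element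
   of [G] below [eta]. *)
have Gd : G (inf G).
  have [g1 G1 g1l] := inf_adherent eta0 hG.
  have := lowG _ G1; rewrite le_eqVlt => /orP[/eqP->//|lt1].
  have d0 : 0 < g1 - inf G by rewrite subr_gt0.
  have [g2 G2 g2l] := inf_adherent d0 hG.
  have := lowG _ G2 => le2.
  case: nosmall; move: G1 G2 => [_ [u1 [v1 e1]]] [_ [u2 [v2 e2]]].
  exists (u1 ++ v2), (v1 ++ u2); rewrite !len_cat.
  by apply/andP; split; lra.
have [d0 [u [v duv]]] := Gd.
exists u, v; rewrite -duv; split; last first.
  move=> d hd; have [m hm] := span_len u hd; have [k hk] := span_len v hd.
  have [dd _] := hd.
  have e : inf G = (m - k)%:~R * d by rewrite duv hm hk intrD intrN mulrDl mulNr.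
  by rewrite e; apply: span_dvd_pos => //; rewrite -e.
split => // a.
have /andP[h1 h2] := truncn_bounds (ltW (s0 a)) d0.
set m := Num.truncn _ in h1 h2; exists m.
(* A nonzero remainder of [s a] modulo [inf G] would be an element of [G] below its infimum. *)
apply/eqP; rewrite eq_le h1 andbT leNgt; apply/negP => lt.
suff : inf G <= s a - m%:R * inf G by move: h2; rewrite mulrDl mul1r; lra.
apply: lowG; split; first by rewrite subr_gt0.
exists (a :: flatten (nseq m v)), (flatten (nseq m u)).
by rewrite len_cons !len_rep duv; ring.
Qed.

(** The only arithmetic information on the steps that the renewal argument uses. It treats the
    lattice case, with [h] the span, and the nonlattice case, with any [h > 0], alike. *)
Definition asymp_hit (h : R) := forall eta : R, 0 < eta ->
  exists J : nat, forall j, (J <= j)%N -> exists w, `|len w - j%:R * h| <= eta.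

Lemma hit_nonlattice (a0 : A) h : 0 < h ->
  ~ (exists d, common_span d /\ forall d', common_span d' -> d' <= d) ->
  asymp_hit h.
Proof.
move=> h0 hno eta eta0.
have [[u [v /andP[d0 deta]]]|[u [v huv]]] := small_or_span a0 eta0; last first.
  by exfalso; apply: hno; exists (len u - len v).
have [Y hY] := cover_cofinal d0.
exists (Num.truncn (`|Y| / h)).+1 => j hj.
have /andP[_ h1] := truncn_bounds (normr_ge0 Y) h0.
have : Y <= j%:R * h.
  apply: (le_trans (ler_norm Y)); apply: (le_trans (ltW h1)).
  by rewrite natr1 ler_pM2r// ler_nat.
move=> /hY[w /andP[w1 w2]]; exists w.
by rewrite distrC ger0_norm//; lra.
Qed.

Lemma hit_lattice (a0 : A) d : common_span d ->
  (forall d', common_span d' -> d' <= d) -> asymp_hit d.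
Proof.
move=> hd hmax eta eta0; have [d0 _] := hd.
have h2 : 0 < d / 2 by lra.
(* Both numbers are multiples of [d], so a gap smaller than [d] is no gap. *)
have int_small w (j : nat) : 0 <= j%:R * d - len w < d -> j%:R * d = len w.
  have [m ->] := span_len w hd.
  have -> : j%:R * d - m%:~R * d = (j%:Z - m)%:~R * d by rewrite intrD intrN mulrDl mulNr.
  rewrite le_eqVlt => /andP[/orP[/eqP|]].
    by move=> /esym/eqP; rewrite mulf_eq0 (gt_eqF d0) orbF intr_eq0 subr_eq0 => /eqP <-.
  by move=> /(span_dvd_pos d0); case: leP.
have [[u [v /andP[e0 e1]]]|[u [v [huv _]]]] := small_or_span a0 h2.
  have [m hm] := span_len u hd; have [k hk] := span_len v hd.
  have e : len u - len v = (m - k)%:~R * d by rewrite hm hk intrD intrN mulrDl mulNr.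
  by move: (e0); rewrite {1}e => /(span_dvd_pos d0); rewrite -e; lra.
have le1 := hmax _ huv.
have [Y hY] := cover_cofinal huv.1.
exists (Num.truncn (`|Y| / d)).+1 => j hj.
have /andP[_ h1] := truncn_bounds (normr_ge0 Y) d0.
have : Y <= j%:R * d.
  apply: (le_trans (ler_norm Y)); apply: (le_trans (ltW h1)).
  by rewrite natr1 ler_pM2r// ler_nat.
move=> /hY[w /andP[w1 w2]]; exists w.
have -> : j%:R * d = len w by apply: int_small; apply/andP; split; lra.
by rewrite subrr normr0 ltW.
Qed.

End Semigroup.

Section Renewal.
Variables (R : realType) (A : finType) (p s : A -> R).
Hypothesis hp : forall a, 0 < p a.
Hypothesis hp1 : \sum_(a : A) p a = 1.
Hypothesis s0 : forall a, 0 < s a.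

Lemma renewal_increment_le (Z : R -> R) (M lip h : R) :
  (forall t, `|Z t| <= M) ->
  (forall t t', `|t - t'| <= 1 -> `|Z t - Z t'| <= lip * `|t - t'|) ->
  (forall e, 0 < e -> exists T, forall t, T <= t ->
     `|Z t - \sum_a p a * Z (t - s a)| <= e) ->
  asymp_hit s h ->
  forall e, 0 < e -> exists T, forall t, T <= t -> Z t - Z (t - h) <= e.
Proof.
(* [b] is the upper limit of [D]. As [b] is asymptotically an upper bound, the
   renewal equation forces [D] to be close to [b] at all translates of a point
   where it is close to [b]; summing [D] along an arithmetic progression of
   step [h] then contradicts the boundedness of [Z]. *)
move=> hM hlip hren hhit e0 e00; apply: contrapT => hno.
pose D t := Z t - Z (t - h).
have often T : exists t, T <= t /\ e0 < D t.
  apply: contrapT => hT; apply: hno; exists T => t Tt.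
  by rewrite leNgt; apply/negP => hlt; apply: hT; exists t.
have DM t : D t <= 2 * M.
  by have := hM t; have := hM (t - h); rewrite !ler_norml /D => /andP[? ?] /andP[? ?]; lra.
pose E := [set y : R | exists T, forall t, T <= t -> D t <= y].
have hE : has_inf E.
  split; first by exists (2 * M), 0 => t _.
  by exists e0 => y [T hT]; have [t [/hT h1 h2]] := often T; lra.
set b := inf E.
have b0 : e0 <= b.
  apply: lb_le_inf; first by case: hE.
  by move=> y [T hT]; have [t [/hT h1 h2]] := often T; lra.
have upper eps : 0 < eps -> exists T, forall t, T <= t -> D t <= b + eps.
  move=> eps0; have [y [T hT] yl] := inf_adherent eps0 hE.
  by exists T => t /hT; rewrite -/b in yl; lra.
have approach eps T : 0 < eps -> exists t, T <= t /\ b - eps <= D t.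
  move=> eps0; apply: contrapT => hT.
  have : b <= b - eps; last by lra.
  apply: ge_inf; first by case: hE.
  exists T => t Tt; rewrite leNgt; apply/negP => hlt.
  by apply: hT; exists t; split => //; exact: ltW.
have hrenD eps : 0 < eps -> exists T, forall t, T <= t ->
    D t <= \sum_a p a * D (t - s a) + eps.
  move=> eps0; have eps2 : 0 < eps / 2 by lra.
  have [T1 hT1] := hren _ eps2.
  exists (T1 + `|h|) => t hT.
  have h1 : T1 <= t by have := normr_ge0 h; lra.
  have h2 : T1 <= t - h by have := ler_norm h; lra.
  have := hT1 _ h1; have := hT1 _ h2.
  have -> : \sum_a p a * D (t - s a) =
     \sum_a p a * Z (t - s a) - \sum_a p a * Z (t - h - s a).
    rewrite -sumrB; apply: eq_bigr => a _; rewrite -mulrBr; congr (_ * (_ - Z _)).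
    by ring.
  by rewrite !ler_norml /D => /andP[? ?] /andP[? ?]; lra.
have back w eps : 0 < eps -> exists d T, 0 < d /\
    forall t, T <= t -> b - d <= D t -> b - eps <= D (t - len s w).
  elim: w eps => [|a w IH] eps eps0.
    by exists eps, 0; split => // t _; rewrite len_nil subr0.
  have [d1 [T1 [d10 hT1]]] := IH _ eps0.
  have pa := hp a.
  (* Three errors of size at most [d] occur: in [D t], in the renewal inequality, and in the upper
     bound for the other letters. Divided by [p a] they add up to [d1]. *)
  have d0 : 0 < p a * d1 / 3 by rewrite divr_gt0// mulr_gt0.
  set d := p a * d1 / 3 in d0.
  have [T2 hT2] := upper _ d0.
  have [T3 hT3] := hrenD _ d0.
  pose m := `|T1| + `|T2| + `|T3| + \sum_a s a.
  have sm c : s c <= \sum_a s a.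
    by rewrite (bigD1 c)//= lerDl sumr_ge0// => i _; exact: ltW.
  exists d, m; split => // t mt hD.
  have [n1 [n2 n3]] : T1 <= `|T1| /\ T2 <= `|T2| /\ T3 <= `|T3|.
    by rewrite !ler_norm.
  have [m1 [m2 m3]] : 0 <= `|T1| /\ 0 <= `|T2| /\ 0 <= `|T3|.
    by rewrite !normr_ge0.
  have mE : m = `|T1| + `|T2| + `|T3| + \sum_a s a by [].
  rewrite len_cons opprD addrA; apply: hT1.
    by have := sm a; have := s0 a; lra.
  have h3 : T3 <= t by have := sm a; have := s0 a; lra.
  have := hT3 _ h3; rewrite (bigD1 a)//=.
  have : \sum_(c | c != a) p c * D (t - s c) <= (1 - p a) * (b + d).
    have -> : 1 - p a = \sum_(c | c != a) p c.
      by rewrite -hp1 (bigD1 a)//= addrAC subrr add0r.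
    rewrite mulr_suml; apply: ler_sum => c _; rewrite ler_pM2l//; apply: hT2.
    by have := sm c; lra.
  move=> k1 k2.
  rewrite -(ler_pM2l pa).
  have dE : p a * d1 = 3 * d by rewrite /d; field.
  have bd : b * p a + d * p a >= b * p a by rewrite lerDl mulr_ge0// ltW.
  rewrite mulrBr dE.
  have e1 : (1 - p a) * (b + d) = b + d - (b * p a + d * p a) by ring.
  lra.
have back_all (ws : seq (seq A)) eps : 0 < eps -> exists d T, 0 < d /\
    forall t, T <= t -> b - d <= D t -> forall w, w \in ws -> b - eps <= D (t - len s w).
  move=> eps0; elim: ws => [|w ws [d1 [T1 [d10 h1]]]].
    by exists 1, 0.
  have [d2 [T2 [d20 h2]]] := back w _ eps0.
  exists (Num.min d1 d2), (Num.max T1 T2); split; first by rewrite lt_min d10.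
  move=> t; rewrite ge_max => /andP[t1 t2] hD w'.
  have [m1 m2] : Num.min d1 d2 <= d1 /\ Num.min d1 d2 <= d2 by rewrite !ge_min !lexx orbT.
  by rewrite inE => /orP[/eqP->|]; [apply: h2|apply: h1] => //; lra.
have lip0 : 0 <= lip.
  have := hlip 1 0; rewrite subr0 normr1 => /(_ (lexx _)).
  by rewrite mulr1; apply: le_trans.
(* Replacing a word length by a multiple of [h] changes each of the two values of [Z] in [D] by at
   most [b / 8]; together with the loss [b / 4] from [back_all] this leaves [b / 2]. *)
pose eta := Num.min 1 (b / (8 * (lip + 1))).
have bb : 0 < b by lra.
have eta0 : 0 < eta by rewrite lt_min ltr01 divr_gt0//; lra.
have eta1 : eta <= 1 by rewrite ge_min lexx.
have etal : lip * eta <= b / 8.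
  have : eta <= b / (8 * (lip + 1)) by rewrite ge_min lexx orbT.
  rewrite ler_pdivlMr; last lra.
  have : 0 <= eta by exact: ltW.
  nra.
have [J hJ] := hhit _ eta0.
(* [N] increments of size [b / 2] exceed [4 * M], whereas [Z] oscillates by at most [2 * M]. *)
pose N := (Num.truncn (4 * M / (b / 2))).+1.
have M0 : 0 <= M by apply: le_trans (hM 0).
have b2 : 0 < b / 2 by lra.
have hN : 4 * M < N%:R * (b / 2).
  have M4 : 0 <= 4 * M by lra.
  by have /andP[_] := truncn_bounds M4 b2; rewrite natr1.
pose wj j := xget [::] [set w | `|len s w - (J + j)%:R * h| <= eta].
have wjP j : `|len s (wj j) - (J + j)%:R * h| <= eta.
  by rewrite /wj; case: xgetP => // hn; have [w hw] := hJ (J + j)%N (leq_addr _ _); have := hn w.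
have b4 : 0 < b / 4 by lra.
have [d [T [d0 hT]]] := back_all [seq wj j | j <- iota 0 N] _ b4.
have [t [Tt hD]] := approach _ T d0.
have low j : (j < N)%N -> b / 2 <= D (t - (J + j)%:R * h).
  move=> jN; have := hT _ Tt hD (wj j).
  rewrite map_f ?mem_iota// => /(_ isT).
  have := wjP j; set l := len s _; set x := _ * h => hl.
  have k1 := @hlip (t - l) (t - x); have k2 := @hlip (t - l - h) (t - x - h).
  have e1 : t - l - (t - x) = x - l by ring.
  have e2 : t - l - h - (t - x - h) = x - l by ring.
  rewrite e1 in k1; rewrite e2 in k2; rewrite distrC in hl.
  have k3 : lip * `|x - l| <= b / 8 by apply: le_trans etal; rewrite ler_wpM2l.
  have {k1} := k1 (le_trans hl eta1); have {k2} := k2 (le_trans hl eta1).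
  have ea : t - l - h = t - h - l by ring.
  rewrite /D !ler_norml => /andP[? ?] /andP[? ?]; lra.
have tele n : (n <= N)%N -> n%:R * (b / 2) <= Z (t - J%:R * h) - Z (t - (J + n)%:R * h).
  elim: n => [|n IH] nN; first by rewrite addn0 subrr mul0r.
  have := IH (ltnW nN); have := low n nN.
  rewrite /D addnS -[(J + n).+1%:R]natr1 -[n.+1%:R]natr1 !mulrDl !mul1r opprD addrA.
  by lra.
have := tele N (leqnn _).
have := hM (t - J%:R * h); have := hM (t - (J + N)%:R * h).
by rewrite !ler_norml => /andP[? ?] /andP[? ?]; lra.
Qed.

Lemma renewal_increment (Z : R -> R) (M lip h : R) :
  (forall t, `|Z t| <= M) ->
  (forall t t', `|t - t'| <= 1 -> `|Z t - Z t'| <= lip * `|t - t'|) ->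
  (forall e, 0 < e -> exists T, forall t, T <= t ->
     `|Z t - \sum_a p a * Z (t - s a)| <= e) ->
  asymp_hit s h ->
  forall e, 0 < e -> exists T, forall t, T <= t -> `|Z t - Z (t - h)| <= e.
Proof.
move=> hM hlip hren hhit e e0.
have [T1 h1] := renewal_increment_le hM hlip hren hhit e0.
have [|||T2 h2] := @renewal_increment_le (fun t => - Z t) M lip h _ _ _ hhit e e0.
- by move=> t; rewrite normrN.
- by move=> t t' /hlip; rewrite -opprD normrN.
- move=> e' /hren[T hT]; exists T => t /hT.
  under [X in _ -> `|_ - X| <= _]eq_bigr do rewrite mulrN.
  by rewrite sumrN -opprD normrN.
exists (Num.max T1 T2) => t; rewrite ge_max => /andP[/h1 k1 /h2 k2].
by rewrite ler_norml; apply/andP; split; lra.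
Qed.

End Renewal.

(** * Regularity of functions dominated by [bump] *)

Section Bump.
Variable R : realType.
Implicit Types (f F G df dF : R -> R) (C K : R).

Lemma mvt_closed F dF (a b : R) : a <= b ->
  (forall x : R, a <= x <= b -> is_derive x 1 F (dF x)) ->
  exists2 c, a <= c <= b & F b - F a = dF c * (b - a).
Proof.
move=> ab h; have [x|z|c cab e] := @MVT_segment R F dF a b ab.
- by rewrite in_itv/= => /andP[x1 x2]; apply: h; rewrite !ltW.
- move: z; apply: derivable_within_continuous => z; rewrite in_itv/= => zab.
  by have [] := h z zab.
- by exists c.
Qed.

Lemma expR_near1 (t : R) : `|t| <= 1 -> 0 < expR t <= 4.
Proof.
rewrite ler_norml => /andP[_ t1]; rewrite expR_gt0/=.
have : expR t <= expR 1 by rewrite ler_expR.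
have h : expR (2^-1 : R) <= 2.
  rewrite -[leLHS]invrK -expRN invf_ple ?posrE ?expR_gt0//.
  by have := @expR_ge1Dx R (- 2^-1); lra.
have -> : expR 1 = expR (2^-1 : R) ^+ 2.
  by rewrite -expRM_natl; congr expR; field.
have := expR_gt0 (2^-1 : R); nra.
Qed.

Lemma bump_dilate (c y : R) : 0 < c <= 4 -> 0 < y -> bump (c * y) <= 16 * bump y.
Proof.
move=> /andP[c0 c4] y0; rewrite /bump mulrA.
have h1 : 0 < 1 + c * y by rewrite addr_gt0// mulr_gt0.
have cy : 0 < c * y by rewrite mulr_gt0.
rewrite ler_pdivrMr ?exprn_gt0// mulrAC ler_pdivlMr ?exprn_gt0//; last lra.
rewrite -exprMn.
have -> : 16 * y ^+ 2 * (1 + c * y) ^+ 2 = (4 * y * (1 + c * y)) ^+ 2 by ring.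
rewrite lerXn2r ?nnegrE ?mulr_ge0//; nra.
Qed.

(** A shift of [t] in [exp (-t) * \sum_v f (exp t * p_v)] replaces [f] by the dilated function in
    this bound, so that summing it over words gives a Lipschitz estimate. *)
Definition bump_lip (K : R) f := forall y t, 0 < y -> `|t| <= 1 ->
  `|f y - expR (- t) * f (expR t * y)| <= K * `|t| * bump y.

(** The mean value theorem for [expR (- r) * f (expR r * y)]. The constant 128 is the bound 4 for
    [expR (- r)] times twice the factor 16 of [bump_dilate]. *)
Lemma bump_lip_deriv C f df :
  (forall x : R, 0 < x -> is_derive x 1 f (df x)) ->
  (forall x, 0 < x -> `|f x| <= C * bump x) ->
  (forall x, 0 < x -> `|x * df x| <= C * bump x) ->
  bump_lip (128 * C) f.
Proof.
move=> hd hf hdf y t y0 t1.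
have C0 : 0 <= C.
  by have := le_trans (normr_ge0 _) (hf 1 ltr01); rewrite pmulr_lge0// bump_gt0.
pose u := fun r : R => expR (- r) * f (expR r * y).
pose du := fun r : R => expR (- r) * (expR r * y * df (expR r * y) - f (expR r * y)).
have ey r : 0 < expR r * y by rewrite mulr_gt0// expR_gt0.
have hu (r : R) : is_derive r 1 u (du r).
  have d1 : is_derive r 1 (fun r : R => expR r * y) (expR r * y).
    have -> : (fun r : R => expR r * y) = y \*: expR.
      by apply/funext => z; rewrite /= /GRing.scale/= mulrC.
    by apply: is_derive_eq; rewrite /GRing.scale/= mulrC.
  have d2 : is_derive r 1 (f \o (fun r : R => expR r * y)) (df (expR r * y) * (expR r * y)).
    by apply: is_derive1_comp; apply: hd.
  have d3 : is_derive r 1 (expR \o -%R) (expR (- r) * -1).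
    exact: is_derive1_comp.
  apply: is_derive_eq; rewrite /du /GRing.scale/=; ring.
have bd r : `|r| <= 1 -> `|du r| <= 128 * C * bump y.
  move=> r1; rewrite /du normrM.
  have /andP[e1 e2] : 0 < expR (- r) <= 4 by apply: expR_near1; rewrite normrN.
  have er := expR_near1 r1; rewrite (ger0_norm (ltW e1)).
  have h2 : `|expR r * y * df (expR r * y) - f (expR r * y)| <= 32 * C * bump y.
    apply: (le_trans (ler_normB _ _)).
    have := hf _ (ey r); have := hdf _ (ey r); have := bump_dilate er y0.
    set x := expR r * y => k1 k2 k3.
    by have : C * bump x <= C * (16 * bump y) by [rewrite ler_wpM2l]; lra.
  have -> : 128 * C * bump y = 4 * (32 * C * bump y) by ring.
  by apply: ler_pM => //; exact: ltW.
have e0 : u 0 = f y by rewrite /u oppr0 expR0 !mul1r.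
rewrite -e0 -[X in _ - X]/(u t); rewrite ler_norml in t1.
have [tn|tp] := lerP t 0.
  have [c /andP[c1 c2] ->] := mvt_closed tn (fun r _ => hu r).
  rewrite normrM sub0r normrN mulrAC ler_wpM2r//; apply: bd.
  by rewrite ler_norml; apply/andP; split; lra.
have [c /andP[c1 c2] e] := mvt_closed (ltW tp) (fun r _ => hu r).
rewrite distrC e normrM subr0 mulrAC ler_wpM2r//; apply: bd.
by rewrite ler_norml; apply/andP; split; lra.
Qed.

(** In the variable [ln x] the function [G] has derivative [f x / x], so its increment over [h] is
    [h * (f y / y)] up to second order in [h]. *)
Lemma primitive_increment K f G : bump_lip K f ->
  (forall x : R, 0 < x -> is_derive x 1 G (f x / x ^+ 2)) ->
  forall y h, 0 < y -> 0 <= h <= 1 ->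
    `|y * (G y - G (expR (- h) * y)) - h * f y| <= K * h * h * bump y.
Proof.
move=> hK hG y h y0 /andP[h0 h1].
have nh : - h <= 0 by rewrite oppr_le0.
have ey r : 0 < expR r * y by rewrite mulr_gt0// expR_gt0.
have [|c /andP[c1 c2]] := @mvt_closed (fun r => G (expR r * y))
   (fun r => f (expR r * y) / (expR r * y)) (- h) 0 nh.
  move=> r _.
  have d1 : is_derive r 1 (fun r : R => expR r * y) (expR r * y).
    have -> : (fun r : R => expR r * y) = y \*: expR.
      by apply/funext => z; rewrite /= /GRing.scale/= mulrC.
    by apply: is_derive_eq; rewrite /GRing.scale/= mulrC.
  have d2 := hG _ (ey r).
  have := @is_derive1_comp R G (fun r : R => expR r * y) r _ _ d2 d1.
  by move=> d3; apply: is_derive_eq; field; rewrite !gt_eqF ?expR_gt0.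
rewrite expR0 mul1r sub0r opprK => ->.
have -> : y * (f (expR c * y) / (expR c * y) * h) - h * f y =
   - (h * (f y - expR (- c) * f (expR c * y))).
  rewrite expRN; field; rewrite !gt_eqF// expR_gt0//.
rewrite normrN normrM (ger0_norm h0).
have c3 : `|c| <= h by rewrite ler_norml; apply/andP; split; lra.
have -> : K * h * h * bump y = h * (K * h * bump y) by ring.
rewrite ler_wpM2l//; apply: (le_trans (hK y c y0 (le_trans c3 h1))).
rewrite ler_wpM2r ?bump_ge0// ler_wpM2l//.
have := hK y 1 y0; rewrite normr1 => /(_ (lexx _))/(le_trans (normr_ge0 _)).
by rewrite mulr1 pmulr_lge0// bump_gt0.
Qed.

End Bump.

(** * The limit of the solution of the renewal equation *)

Section RenewalLimit.
Variables (R : realType) (A : finType) (p : A -> R).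
Hypothesis hA : (2 <= #|A|)%N.
Hypothesis hp : forall a, 0 < p a.
Hypothesis hp1 : \sum_(a : A) p a = 1.
Local Notation wlim := (wlim p).
Local Notation c0 := (spread p).

Definition step (a : A) : R := - ln (p a).
Local Notation s := step.

Lemma step_gt0 a : 0 < s a.
Proof. by rewrite oppr_gt0 ln_lt0// hp/= (p_lt1 hA hp hp1). Qed.

Lemma expR_step a : expR (- s a) = p a.
Proof. by rewrite opprK lnK// posrE. Qed.

Lemma entropyE : entropy p = \sum_a p a * s a.
Proof. by rewrite /entropy -sumrN; apply: eq_bigr => a _; rewrite mulrN. Qed.

(** The solution [Z] of the renewal equation with source [f], summed over words of all lengths. *)
Definition wavg (f : R -> R) (t : R) : R := expR (- t) * wlim f (expR t).

Lemma wavg_bound C f t : (forall y, 0 < y -> `|f y| <= C * bump y) ->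
  `|wavg f t| <= C / c0.
Proof.
move=> h; rewrite /wavg normrM ger0_norm ?expR_ge0//.
rewrite mulrC expRN ler_pdivrMr ?expR_gt0//.
exact: (wlim_bound hA hp hp1 (expR_gt0 t) h).
Qed.

Lemma wavg_renewal C f t : quadratic C f ->
  wavg f t = expR (- t) * f (expR t) + \sum_a p a * wavg f (t - s a).
Proof.
move=> h; rewrite /wavg (wlim_renewal hA hp hp1 h) ?expR_gt0// mulrDr mulr_sumr.
congr (_ + _); apply: eq_bigr => a _.
have e : expR (t - s a) = p a * expR t by rewrite expRD expR_step mulrC.
by rewrite [expR (- (t - s a))]expRN e invfM -expRN mulrA mulrA mulfV ?mul1r ?gt_eqF.
Qed.

Lemma wavgZ C f c t : quadratic C f -> wavg (fun y => c * f y) t = c * wavg f t.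
Proof. by move=> h; rewrite /wavg (wlimZ hA hp hp1 _ h) ?expR_gt0// mulrCA. Qed.

Lemma wavgB C f g t : quadratic C f -> quadratic C g ->
  wavg (fun y => f y - g y) t = wavg f t - wavg g t.
Proof. by move=> hf hg; rewrite /wavg (wlimB hA hp hp1 hf hg) ?expR_gt0// mulrBr. Qed.

Lemma wavg_shift C f t h : quadratic C f ->
  wavg f (t + h) = wavg (fun y => expR (- h) * f (expR h * y)) t.
Proof.
move=> hf; rewrite /wavg (@wlimZ _ _ _ hA hp hp1 (C * expR h ^+ 2) (fun y => f (expR h * y))).
- by rewrite wlim_dilate opprD !expRD mulrA (mulrC (expR h)).
- move=> y y0; rewrite -mulrA -exprMn; apply: hf.
  by rewrite mulr_gt0// expR_gt0.
- exact: expR_gt0.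
Qed.

Lemma quadratic_dilate (C : R) (f : R -> R) (h : R) : quadratic C f ->
  quadratic (C * expR h) (fun y => expR (- h) * f (expR h * y)).
Proof.
move=> hf y y0; rewrite normrM ger0_norm ?expR_ge0// mulrC expRN.
rewrite ler_pdivrMr ?expR_gt0//.
have := hf (expR h * y); rewrite mulr_gt0 ?expR_gt0// => /(_ isT).
by rewrite exprMn; lra.
Qed.

Lemma quadratic_le (C C' : R) (f : R -> R) : C <= C' -> quadratic C f -> quadratic C' f.
Proof. by move=> CC h y y0; apply: (le_trans (h y y0)); rewrite ler_wpM2r// sqr_ge0. Qed.

(** An increment of [wavg f] is the value of [wavg] at another source, so [wavg_bound] also
    estimates increments. *)
Lemma wavg_diff_shift C f t h : quadratic C f ->
  wavg f t - wavg f (t + h) =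
  wavg (fun y => f y - expR (- h) * f (expR h * y)) t.
Proof.
move=> hf; rewrite (wavg_shift _ _ hf).
rewrite (@wavgB (Num.max C (C * expR h)))//.
  by apply: quadratic_le hf; rewrite le_max lexx.
by apply: quadratic_le (quadratic_dilate _ hf); rewrite le_max lexx orbT.
Qed.

Lemma wavg_lip C K f : (forall y, 0 < y -> `|f y| <= C * bump y) ->
  bump_lip K f -> forall t t', `|t - t'| <= 1 ->
  `|wavg f t - wavg f t'| <= K / c0 * `|t - t'|.
Proof.
move=> hf hK t t' tt.
have -> : t' = t + (t' - t) by ring.
rewrite (wavg_diff_shift _ _ (bump_quadratic hf)).
have -> : t - (t + (t' - t)) = t - t' by ring.
rewrite mulrAC; apply: wavg_bound => y y0; rewrite (distrC t); apply: hK => //.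
by rewrite distrC.
Qed.

(* [W = wavg (x G)] solves the renewal equation with source [G (expR t)], so
   [\sum_a p a * (W t - W (t - s a)) = G (expR t)], whereas [W t - W (t - s a)]
   is asymptotically [s a * wavg f t]. In the nonlattice case [G] is the
   primitive of [f x / x ^+ 2], in the lattice case it is a sum along the
   lattice and [s a / N] is the span. *)
Theorem renewal_limit C K f G :
  (forall y, 0 < y -> `|f y| <= C * bump y) -> bump_lip K f ->
  quadratic C (fun x => x * G x) ->
  (forall a e, 0 < e -> exists N : nat, [/\ (0 < N)%N, asymp_hit s (s a / N%:R) &
      forall y, 0 < y ->
      `|y * (G y - G (expR (- (s a / N%:R)) * y)) - s a / N%:R * f y| <=
        e * (s a / N%:R) * bump y]) ->
  forall e, 0 < e -> exists T, forall t, T <= t ->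
    `|entropy p * wavg f t - G (expR t)| <= e.
Proof.
move=> hf hK hG hstep.
have fq := bump_quadratic hf.
pose W := wavg (fun x => x * G x).
have ren : forall e, 0 < e -> exists T, forall t, T <= t ->
     `|wavg f t - \sum_a p a * wavg f (t - s a)| <= e.
  move=> e e0; exists (C / e) => t ht.
  rewrite (wavg_renewal _ fq) addrK normrM ger0_norm ?expR_ge0//.
  rewrite mulrC expRN ler_pdivrMr ?expR_gt0//.
  have C0 := quadratic_cst_ge0 fq.
  apply: (le_trans (hf _ (expR_gt0 t))).
  apply: (@le_trans _ _ C).
    rewrite ler_piMr// /bump ler_pdivrMr ?exprn_gt0 ?addr_gt0 ?expR_gt0//.
    by rewrite mul1r lerXn2r ?nnegrE ?addr_ge0 ?expR_ge0//; lra.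
  rewrite mulrC -ler_pdivrMr//; apply: (le_trans ht).
  by have := expR_ge1Dx t; lra.
have incr a e : 0 < e -> exists T, forall t, T <= t ->
    `|W t - W (t - s a) - s a * wavg f t| <= e * s a.
  move=> e0; have sa := step_gt0 a.
  have c00 := spread_gt0 hA hp hp1.
  (* The factor [c0] cancels the division by [c0] in [wavg_bound]. *)
  have e1 : 0 < e * c0 / 2 by rewrite divr_gt0// mulr_gt0.
  have [N [N0 hit hN]] := hstep a _ e1.
  set h := s a / N%:R in hit hN.
  have NR : 0 < N%:R :> R by rewrite ltr0n.
  have h0 : 0 < h by rewrite divr_gt0.
  have hNh : N%:R * h = s a by rewrite /h; field; rewrite gt_eqF.
  have loc t : `|W t - W (t - h) - h * wavg f t| <= e / 2 * h.
    have -> : W t - W (t - h) - h * wavg f t =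
      wavg (fun y => y * (G y - G (expR (- h) * y)) - h * f y) t.
      rewrite /W (wavg_diff_shift _ _ hG).
      rewrite -(wavgZ _ _ fq).
      have CC : 0 <= C by exact: quadratic_cst_ge0 fq.
      pose C1 := C + C * expR (- h).
      have q1 : quadratic (2 * C1 + h * C)
         (fun y => y * G y - expR (- - h) * (expR (- h) * y * G (expR (- h) * y))).
        move=> y y0; apply: (le_trans (ler_normB _ _)).
        have := hG y y0; have := @quadratic_dilate C _ (- h) hG y y0.
        have y2 : 0 <= y ^+ 2 by exact: sqr_ge0.
        have : 0 <= h * C * y ^+ 2 by rewrite !mulr_ge0// ltW.
        have : 0 <= C1 * y ^+ 2 by rewrite mulr_ge0// addr_ge0// mulr_ge0// expR_ge0.
        by rewrite /C1; lra.
      have q2 : quadratic (2 * C1 + h * C) (fun y => h * f y).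
        move=> y y0; rewrite normrM (ger0_norm (ltW h0)).
        have : h * `|f y| <= h * (C * y ^+ 2) by rewrite ler_wpM2l ?(ltW h0)//; apply: fq.
        have : 0 <= C1 * y ^+ 2 by rewrite mulr_ge0 ?sqr_ge0// addr_ge0// mulr_ge0// expR_ge0.
        lra.
      rewrite -(wavgB _ q1 q2).
      congr (wavg _ t); apply/funext => y; rewrite opprK expRN; field.
      by rewrite gt_eqF ?expR_gt0.
    apply: (@le_trans _ _ (e * c0 / 2 * h / c0)); first exact: wavg_bound.
    by rewrite le_eqVlt; apply/orP; left; apply/eqP; field; rewrite gt_eqF.
  (* The path from [t] to [t - s a] consists of [N] pieces of length [h]; with this precision
     [wavg f] varies by at most [e / 2] along it. *)
  have e4 : 0 < e / (2 * N%:R) by rewrite divr_gt0// mulr_gt0.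
  have [T hT] := renewal_increment hp hp1 step_gt0 (fun t => wavg_bound t hf)
     (wavg_lip hf hK) ren hit e4.
  exists (T + s a) => t ht.
  have zi i : (i <= N)%N -> `|wavg f t - wavg f (t - i%:R * h)| <= i%:R * (e / (2 * N%:R)).
    elim: i => [|i IH] iN; first by rewrite !mul0r subr0 subrr normr0.
    have := IH (ltnW iN).
    have k2 : T <= t - i%:R * h.
      have : i%:R * h <= N%:R * h by rewrite ler_pM2r// ler_nat ltnW.
      by rewrite hNh; lra.
    have := hT _ k2.
    have -> : t - i%:R * h - h = t - i.+1%:R * h by rewrite -natr1; ring.
    rewrite -natr1 => k3 k4.
    have -> : wavg f t - wavg f (t - (i%:R + 1) * h) =
       (wavg f t - wavg f (t - i%:R * h)) + (wavg f (t - i%:R * h) - wavg f (t - (i%:R + 1) * h)) by ring.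
    by apply: (le_trans (ler_normD _ _)); rewrite natr1 mulrSr mulrDl mul1r in k3 *; lra.
  have wi i : (i <= N)%N -> `|W t - W (t - i%:R * h) - i%:R * h * wavg f t| <= i%:R * (e * h).
    elim: i => [|i IH] iN; first by rewrite !mul0r !subr0 subrr normr0.
    have := IH (ltnW iN); have := loc (t - i%:R * h).
    have := zi i (ltnW iN).
    have -> : t - i%:R * h - h = t - i.+1%:R * h by rewrite -natr1; ring.
    rewrite -[i.+1%:R]natr1 => k1 k2 k3.
    have k4 : i%:R * (e / (2 * N%:R)) <= e / 2.
      have -> : i%:R * (e / (2 * N%:R)) = e / 2 * (i%:R / N%:R) by field; rewrite gt_eqF.
      rewrite ler_piMr//; first by lra.
      by rewrite ler_pdivrMr// mul1r ler_nat ltnW.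
    have k5 : h * `|wavg f t - wavg f (t - i%:R * h)| <= h * (e / 2).
      by rewrite ler_wpM2l ?(ltW h0)//; apply: le_trans k4.
    have -> : W t - W (t - (i%:R + 1) * h) - (i%:R + 1) * h * wavg f t =
      (W t - W (t - i%:R * h) - i%:R * h * wavg f t) +
      (W (t - i%:R * h) - W (t - (i%:R + 1) * h) - h * wavg f (t - i%:R * h)) -
      h * (wavg f t - wavg f (t - i%:R * h)) by ring.
    apply: (le_trans (ler_normB _ _)); rewrite [X in _ + X]normrM (ger0_norm (ltW h0)).
    apply: (@le_trans _ _ (i%:R * (e * h) + e / 2 * h + h * (e / 2))).
      by apply: lerD => //; apply: (le_trans (ler_normD _ _)); exact: lerD.
    by rewrite le_eqVlt; apply/orP; left; apply/eqP; field.
  have := wi N (leqnn _); rewrite hNh.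
  by have -> : N%:R * (e * h) = e * s a by rewrite mulrCA hNh.
move=> e e0.
have H0 : 0 < entropy p.
  have /card_gt0P[a _] : (0 < #|A|)%N by exact: ltnW.
  rewrite entropyE (bigD1 a)//= ltr_wpDr//; last by rewrite mulr_gt0 ?step_gt0.
  by apply: sumr_ge0 => b _; rewrite mulr_ge0// ltW// step_gt0.
have eH : 0 < e / entropy p by rewrite divr_gt0.
have [T hT] : exists T, forall t, T <= t -> forall a,
    `|W t - W (t - s a) - s a * wavg f t| <= e / entropy p * s a.
  have : exists T, forall t, T <= t -> forall a, a \in enum A ->
      `|W t - W (t - s a) - s a * wavg f t| <= e / entropy p * s a.
    elim: (enum A) => [|a l [T hT]]; first by exists 0.
    have [T' hT'] := incr a _ eH.
    exists (Num.max T T') => t; rewrite ge_max => /andP[t1 t2] b.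
    by rewrite inE => /orP[/eqP->|bl]; [exact: hT'|exact: hT].
  by move=> [T hT]; exists T => t ht a; apply: hT => //; rewrite mem_enum.
exists T => t ht.
have -> : G (expR t) = \sum_a p a * (W t - W (t - s a)).
  under eq_bigr do rewrite mulrBr.
  rewrite sumrB -mulr_suml hp1 mul1r {1}/W (wavg_renewal _ hG) addrK.
  by rewrite mulrA -expRD addNr expR0 mul1r.
rewrite entropyE mulr_suml -sumrB.
apply: (le_trans (ler_norm_sum _ _ _)).
apply: (@le_trans _ _ (\sum_a e / entropy p * (p a * s a))).
  apply: ler_sum => a _; rewrite -mulrA -mulrBr normrM (ger0_norm (ltW (hp a))).
  by rewrite [leRHS]mulrCA ler_pM2l// distrC; exact: hT.
by rewrite -mulr_sumr -entropyE divfK// gt_eqF.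
Qed.

End RenewalLimit.

(** * Mellin transforms and the functions psi *)

Section Admissible.
Import measurable_realfun.
Variable R : realType.
Implicit Types (f G df : R -> R) (C l : R).

(** Since [G x] is [O(x)] at 0 and tends to [l] at infinity, [l] is the integral of [f x / x ^+ 2],
    that is, the Mellin transform of [f] at [-1]. *)
Definition admissible f G l := exists C df,
  [/\ forall x : R, 0 < x -> is_derive x 1 f (df x),
      forall x : R, 0 < x -> 0 <= f x <= C * bump x,
      forall x : R, 0 < x -> `|x * df x| <= C * bump x,
      forall x : R, 0 < x -> is_derive x 1 G (f x / x ^+ 2)
    & (forall x : R, 0 < x -> 0 <= G x <= C * x) /\
      G x @[x --> +oo] --> l].

Lemma derive_continuous f (l x : R) : is_derive x 1 f l -> {for x, continuous f}.
Proof. by move=> [d _]; apply: differentiable_continuous; exact/derivable1_diffP. Qed.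

Lemma powR_Nm2 (x : R) : 0 < x -> x `^ (-1 - 1) = (x ^+ 2)^-1.
Proof.
by move=> x0; rewrite -opprD powRN -powR_mulrn // ltW.
Qed.

(** The hypotheses concern positive arguments only, so the fundamental theorem is applied on the
    half-lines from [1 / (n + 1)], followed by monotone convergence. *)
Lemma admissible_mellin f G l : admissible f G l -> mellin f (-1) = l.
Proof.
move=> [C [df [hd hf hdf hG [hGb hGl]]]].
pose F n := `[n.+1%:R^-1, +oo[%classic : set R.
have UF : \bigcup_n F n = `]0, +oo[%classic.
  apply/seteqP; split => x /=.
    move=> [n _]; rewrite /F /= !in_itv/= !andbT; apply: lt_le_trans.
    by rewrite invr_gt0.
  rewrite in_itv/= andbT => x0; exists (Num.truncn x^-1) => //.
  rewrite /F/= in_itv/= andbT invf_ple ?posrE//.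
  exact/ltW/truncnS_gt.
have Fpos n x : F n x -> 0 < x.
  by rewrite /F /= in_itv/= andbT; apply: lt_le_trans; rewrite invr_gt0.
pose g (x : R) := f x / x ^+ 2.
have g0 x : 0 < x -> 0 <= g x.
  by move=> x0; rewrite divr_ge0 ?sqr_ge0//; have /andP[] := hf x x0.
have gc x : 0 < x -> {for x, continuous g}.
  move=> x0; apply: cvgM; first exact: derive_continuous (hd x x0).
  apply: cvgV; first by rewrite expf_neq0// gt_eqF.
  exact: exprn_continuous.
pose h (x : R) : \bar R := (g x)%:E.
have mg0 : measurable_fun (`]0, +oo[%classic : set R) g.
  apply: open_continuous_measurable_fun => //.
  by move=> x; rewrite inE /= in_itv/= andbT; exact: gc.
have mg n : measurable_fun (F n) h.
  apply/measurable_EFinP; apply: measurable_funS mg0 => //.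
  by move=> x /Fpos; rewrite /= in_itv/= andbT.
have IF n : (\int[lebesgue_measure]_(x in F n) h x = (l - G (n.+1%:R^-1))%:E)%E.
  have n0 : 0 < n.+1%:R^-1 :> R by rewrite invr_gt0.
  rewrite EFinB /=; apply: (@ge0_continuous_FTC2y _ g G) => //.
  - by move=> x hx; apply: g0; apply: lt_le_trans hx.
  - apply/continuous_within_itvcyP; split.
      by move=> x; rewrite in_itv/= andbT => hx; apply: gc; exact: lt_trans hx.
    by apply: cvg_at_right_filter; exact: gc.
  - by move=> x hx; have [] := hG x (lt_trans n0 hx).
  - by apply: cvg_at_right_filter; exact: derive_continuous (hG _ n0).
  - move=> x; rewrite in_itv/= andbT => hx; rewrite derive1E.
    by have [_] := hG x (lt_trans n0 hx).
have ndF : nondecreasing_seq F.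
  move=> m n mn; rewrite subsetEset => x; rewrite /F/= !in_itv/= !andbT.
  by apply: le_trans; rewrite lef_pV2 ?posrE// ler_nat.
have mF n : measurable (F n) by exact: measurable_itv.
have pF n x : F n x -> (0 <= h x)%E by move=> /Fpos /g0; rewrite lee_fin.
have cv : (\int[lebesgue_measure]_(x in F n) h x)%E @[n --> \oo] -->
    (\int[lebesgue_measure]_(x in \bigcup_n F n) h x)%E.
  exact: ge0_nondecreasing_set_cvg_integral.
move: cv; under eq_fun do rewrite IF.
rewrite UF => cv.
have cv' : (l - G (n.+1%:R^-1))%:E @[n --> \oo] --> l%:E.
  apply: cvg_EFin; first exact: nearW.
  rewrite -[X in _ --> X]subr0; apply: cvgB; first exact: cvg_cst.
  apply: (@squeeze_cvgr _ _ _ _ (cst 0) (fun n => C * n.+1%:R^-1)).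
  - by apply: nearW => n; apply: hGb; rewrite invr_gt0.
  - exact: cvg_cst.
  - rewrite -[X in _ --> X](mulr0 C); apply: cvgMr.
    exact: cvg_harmonic.
rewrite /mellin /Rintegral.
transitivity (fine (\int[lebesgue_measure]_(x in `]0%R, +oo[) h x)%E); last first.
  by rewrite (cvg_unique _ cv cv').
congr fine; apply: eq_integral => x; rewrite inE/= in_itv/= andbT => x0.
by rewrite /h powR_Nm2.
Qed.

Lemma admissible_scale c f G l : 0 <= c -> admissible f G l ->
  admissible (fun x => c * f x) (fun x => c * G x) (c * l).
Proof.
move=> c0 [C [df [hd hf hdf hG [hGb hGl]]]].
exists (c * C), (fun x => c * df x); split => [x x0|x x0|x x0|x x0|].
- exact: (@is_deriveZ _ _ _ f c x 1 _ (hd x x0)).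
- by have /andP[h1 h2] := hf x x0; rewrite mulr_ge0//= -mulrA ler_wpM2l.
- by rewrite mulrCA normrM ger0_norm// -mulrA ler_wpM2l// hdf.
- by rewrite -mulrA; exact: (@is_deriveZ _ _ _ G c x 1 _ (hG x x0)).
- split; last by apply: cvgMr.
  by move=> x x0; have /andP[h1 h2] := hGb x x0; rewrite mulr_ge0//= -mulrA ler_wpM2l.
Qed.

Lemma exp_bound n (x : R) : 0 < x -> x ^+ n <= n`!%:R * expR x.
Proof.
move=> x0; case: n => [|n].
  by rewrite expr0 mul1r -expR0 ler_expR ltW.
rewrite mulrC -ler_pdivrMr ?ltr0n ?fact_gt0//.
apply: le_trans (expR_ge1Dxn n (ltW x0)); lra.
Qed.

(** Up to the factor [k!], the probability that a Poisson variable of mean [x] equals [k]. *)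
Definition gam (k : nat) (x : R) : R := x ^+ k * expR (- x).

Lemma is_derive_expN (x : R) : is_derive x 1 (fun y : R => expR (- y)) (- expR (- x)).
Proof.
have := @is_derive1_comp R expR -%R x _ _ (is_derive_expR (- x)) (is_deriveNid x 1).
by rewrite mulrN1.
Qed.

Lemma is_derive_gam k (x : R) : is_derive x 1 (gam k)
  (k%:R * x ^+ k.-1 * expR (- x) - gam k x).
Proof.
have h1 : is_derive x 1 (fun y : R => y ^+ k) (k%:R * x ^+ k.-1).
  have := @is_deriveX R R (@id R) k x 1 1 (@is_derive_id _ _ x 1).
  by rewrite exprfctE /GRing.scale/= mulr1.
have h2 := is_derive_expN x.
have h := is_deriveM h1 h2.
have e : gam k = (fun y : R => y ^+ k) * (fun y : R => expR (- y)) by apply/funext.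
rewrite {1}e; apply: (is_derive_eq h).
rewrite /gam /GRing.scale/=; ring.
Qed.

Lemma gam_bump k (x : R) : 0 < x ->
  0 <= gam k.+2 x <= (k`!%:R + 2 * k.+1`!%:R + k.+2`!%:R) * bump x.
Proof.
move=> x0; rewrite /gam /bump mulr_ge0 ?exprn_ge0 ?expR_ge0 ?(ltW x0)//=.
have h1 : 0 < (1 + x) ^+ 2 by rewrite exprn_gt0// addr_gt0.
rewrite [leRHS]mulrA ler_pdivlMr// expRN mulrAC ler_pdivrMr ?expR_gt0//.
have e0 := exp_bound k x0; have e1 := exp_bound k.+1 x0.
have e2 := exp_bound k.+2 x0.
have -> : x ^+ k.+2 * (1 + x) ^+ 2 = x ^+ 2 * (x ^+ k + 2 * x ^+ k.+1 + x ^+ k.+2).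
  by rewrite !exprS; ring.
have -> : forall c, c * x ^+ 2 * expR x = x ^+ 2 * (c * expR x) by move=> c; ring.
rewrite ler_pM2l ?exprn_gt0//; lra.
Qed.

(** The lower incomplete gamma function at [m + 1]; the recursion is integration by parts. *)
Fixpoint gam_prim (m : nat) (x : R) : R :=
  if m is m'.+1 then m'.+1%:R * gam_prim m' x - gam m'.+1 x else 1 - expR (- x).

Lemma is_derive_gam_prim m (x : R) : is_derive x 1 (gam_prim m) (gam m x).
Proof.
elim: m => [|m IH].
  have h := is_deriveB (@is_derive_cst _ _ _ (1 : R) x 1) (is_derive_expN x).
  have e : gam_prim 0 = cst 1 - (fun y : R => expR (- y)) by apply/funext.
  by rewrite e; apply: (is_derive_eq h); rewrite /gam sub0r opprK expr0 mul1r.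
have h1 := @is_deriveZ _ _ _ (gam_prim m) m.+1%:R x 1 _ IH.
have h := is_deriveB h1 (is_derive_gam m.+1 x).
have e : gam_prim m.+1 = m.+1%:R \*: gam_prim m - gam m.+1 by apply/funext.
rewrite e; apply: (is_derive_eq h).
rewrite /gam /GRing.scale/=; ring.
Qed.

Lemma gam_prim0 m : gam_prim m 0 = 0.
Proof.
elim: m => [|m IH] /=; first by rewrite oppr0 expR0 subrr.
by rewrite IH mulr0 /gam exprS mul0r mul0r subrr.
Qed.

Lemma gam_prim_bound m (x : R) : 0 < x -> 0 <= gam_prim m x <= m`!%:R * x.
Proof.
move=> x0.
have [c /andP[c0 cx]] := mvt_closed (ltW x0) (fun y _ => is_derive_gam_prim m y).
rewrite gam_prim0 !subr0 => ->.
rewrite mulr_ge0 ?(ltW x0) ?mulr_ge0 ?exprn_ge0 ?expR_ge0//= ler_wpM2r ?(ltW x0)//.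
rewrite /gam expRN ler_pdivrMr ?expR_gt0//.
move: c0; rewrite le_eqVlt => /orP[/eqP<-|]; last exact: exp_bound.
by rewrite expR0 mulr1; case: m => [|m]; rewrite ?expr0// exprS mul0r.
Qed.

Lemma gam_cvg0 k : gam k x @[x --> +oo] --> 0.
Proof.
apply: (@squeeze_cvgr _ _ _ _ (cst 0) (fun x : R => k.+1`!%:R * x^-1)).
- near=> x; have x0 : 0 < x by near: x; exact: nbhs_pinfty_gt.
  rewrite /gam mulr_ge0 ?exprn_ge0 ?expR_ge0 ?(ltW x0)//= expRN.
  rewrite ler_pdivrMr ?expR_gt0// mulrAC ler_pdivlMr// -exprSr.
  exact: exp_bound.
- exact: cvg_cst.
- rewrite -[X in _ --> X](mulr0 k.+1`!%:R); apply: cvgMr.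
  apply/cvgrPdist_le => e e0; near=> x.
  have x0 : 0 < x by near: x; exact: nbhs_pinfty_gt.
  by rewrite sub0r normrN ger0_norm ?invr_ge0 ?(ltW x0)// invf_ple ?posrE//.
Unshelve. all: end_near. Qed.

Lemma gam_prim_cvg m : gam_prim m x @[x --> +oo] --> (m`!%:R : R).
Proof.
elim: m => [|m IH] /=.
  rewrite -[X in _ --> X]subr0; apply: cvgB; first exact: cvg_cst.
  have -> : (fun x : R => expR (- x)) = gam 0 by apply/funext => x; rewrite /gam mul1r.
  exact: gam_cvg0.
rewrite -[X in _ --> X]subr0; apply: cvgB; last exact: gam_cvg0.
by rewrite factS natrM; apply: cvgMr.
Qed.

(** Division by [x ^+ 2] lowers the exponent by two, whence [k!] instead of [(k + 2)!]. The quotient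
    of these is the factor [k (k - 1)] of the theorem, for [k] leaves. *)
Lemma admissible_gam k : admissible (gam k.+2) (gam_prim k) k`!%:R.
Proof.
pose C1 : R := k`!%:R + 2 * k.+1`!%:R + k.+2`!%:R.
pose C2 : R := k.+1`!%:R + 2 * k.+2`!%:R + k.+3`!%:R.
have C1k : k`!%:R <= C1 by rewrite /C1 -addrA lerDl.
have C20 : 0 <= C2 by rewrite !addr_ge0.
have C10 : 0 <= C1 by rewrite !addr_ge0.
have kC1 : C1 <= k.+2%:R * C1 by rewrite ler_peMl// ler1n.
exists (k.+2%:R * C1 + C2), (fun x => k.+2%:R * x ^+ k.+1 * expR (- x) - gam k.+2 x).
have le1 x : 0 < x -> gam k.+2 x <= (k.+2%:R * C1 + C2) * bump x.
  move=> x0; have /andP[_ h] := gam_bump k x0; apply: (le_trans h).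
  by rewrite ler_wpM2r ?bump_ge0// -/C1; lra.
split => [x x0|x x0|x x0|x x0|].
- exact: is_derive_gam.
- by rewrite le1//; have /andP[-> _] := gam_bump k x0.
- have -> : x * (k.+2%:R * x ^+ k.+1 * expR (- x) - gam k.+2 x) =
     k.+2%:R * gam k.+2 x - gam k.+3 x by rewrite /gam !exprS; ring.
  have /andP[a1 a2] := gam_bump k x0; have /andP[b1 b2] := gam_bump k.+1 x0.
  rewrite -/C1 in a2; rewrite -/C2 in b2.
  apply: (le_trans (ler_normB _ _)); rewrite [X in _ + X]ger0_norm//.
  have k0 : 0 <= k.+2%:R * gam k.+2 x by apply: mulr_ge0.
  rewrite (ger0_norm k0).
  by rewrite [leRHS]mulrDl; apply: lerD; rewrite // -mulrA ler_wpM2l.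
- apply: (is_derive_eq (is_derive_gam_prim k x)).
  by rewrite /gam -addn2 exprD; field; rewrite gt_eqF.
- split; last exact: gam_prim_cvg.
  move=> x x0; have /andP[-> h] := gam_prim_bound k x0; apply: (le_trans h).
  by rewrite ler_wpM2r ?(ltW x0)//; lra.
Qed.

(** The probability that a Poisson variable of mean [x] is at least 2. *)
Definition many (x : R) : R := 1 - (1 + x) * expR (- x).

Lemma many_bump (x : R) : 0 < x -> 0 <= many x <= 4 * bump x.
Proof.
move=> x0; have ex := expR_gt0 (- x); rewrite /many.
have h1 : (1 + x) * expR (- x) <= 1.
  by rewrite expRN ler_pdivrMr ?expR_gt0// mul1r expR_ge1Dx.
rewrite subr_ge0 h1/=; have [x1|x1] := lerP x 1.
  have h2 : x ^+ 2 <= 4 * bump x.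
    have /bump_ge : 0 <= x <= 1 by rewrite ltW.
    lra.
  apply: le_trans h2; have := expR_ge1Dx (- x); nra.
have := bump_ge4 (ltW x1); nra.
Qed.

Definition many_prim (x : R) : R := 1 - (1 - expR (- x)) / x.

(** The limit 1 at infinity is the summand 1 of [1 + H] in the nonlattice case. *)
Lemma admissible_many : admissible many many_prim 1.
Proof.
exists 5, (gam 1); split => [x x0|x x0|x x0|x x0|].
- have h1 := is_deriveD (@is_derive_cst _ _ _ (1 : R) x 1) (@is_derive_id _ _ x 1).
  have h2 := is_deriveM h1 (is_derive_expN x).
  have h3 := is_deriveB (@is_derive_cst _ _ _ (1 : R) x 1) h2.
  have e : many = cst 1 - (cst 1 + id) * (fun y : R => expR (- y)) by apply/funext.
  rewrite e; apply: (is_derive_eq h3).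
  rewrite /gam /GRing.scale/=; rewrite /cst /= !fctE; ring.
- have /andP[-> h] := many_bump x0; have := bump_ge0 x; lra.
- have /andP[a1 a2] := gam_bump 0 x0.
  have -> : x * gam 1 x = gam 2 x by rewrite /gam; ring.
  rewrite ger0_norm//; apply: (le_trans a2); rewrite ler_wpM2r ?bump_ge0//.
  by rewrite !factS fact0; lra.
- have h1 := is_deriveB (@is_derive_cst _ _ _ (1 : R) x 1) (is_derive_expN x).
  have x0' : (@id R) x != 0 by rewrite gt_eqF.
  have h2 := is_deriveV x0' (@is_derive_id _ _ x 1).
  have h3 := is_deriveM h1 h2.
  have h4 := is_deriveB (@is_derive_cst _ _ _ (1 : R) x 1) h3.
  have e : many_prim = cst 1 - (cst 1 - (fun y : R => expR (- y))) * (fun y => (id y)^-1).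
    by apply/funext.
  rewrite e; apply: (is_derive_eq h4).
  rewrite /many /GRing.scale/= /cst /= !fctE /=; field; rewrite gt_eqF//.
- split.
    move=> x x0; rewrite /many_prim.
    have -> : 1 - (1 - expR (- x)) / x = (x - 1 + expR (- x)) / x by field; rewrite gt_eqF.
    apply/andP; split.
      by rewrite divr_ge0 ?(ltW x0)//; have := expR_ge1Dx (- x); lra.
    rewrite ler_pdivrMr//.
    (* This follows from [expR x >= 1 + x] and [(1 + x) * (1 - x + x ^+ 2) = 1 + x ^+ 3 >= 1]. *)
    have h : expR (- x) <= 1 - x + x ^+ 2.
      have pos : 0 < 1 - x + x ^+ 2 by nra.
      rewrite expRN -[leRHS]invrK lef_pV2 ?posrE ?expR_gt0 ?invr_gt0//.
      apply: le_trans (expR_ge1Dx x).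
      rewrite -[leLHS]mul1r ler_pdivrMr//.
      have -> : (1 + x) * (1 - x + x ^+ 2) = 1 + x ^+ 3 by ring.
      by rewrite lerDl exprn_ge0 ?(ltW x0).
    nra.
  rewrite -[X in _ --> X]subr0; apply: cvgB; first exact: cvg_cst.
  apply: (@squeeze_cvgr _ _ _ _ (cst 0) (fun x : R => x^-1)).
  - near=> x; have x0 : 0 < x by near: x; exact: nbhs_pinfty_gt.
    have h : expR (- x) <= 1 by rewrite -expR0 ler_expR oppr_le0 ltW.
    rewrite divr_ge0 ?subr_ge0 ?(ltW x0)//=.
    by rewrite ler_piMl ?invr_ge0 ?(ltW x0)// gerBl expR_ge0.
  - exact: cvg_cst.
  - apply/cvgrPdist_le => e e0; near=> x.
    have x0 : 0 < x by near: x; exact: nbhs_pinfty_gt.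
    by rewrite sub0r normrN ger0_norm ?invr_ge0 ?(ltW x0)// invf_ple ?posrE//.
Unshelve. all: end_near. Qed.

End Admissible.

(** * Unordered sums over naturals and integers *)

Section NatSums.
Variable R : realType.

Lemma is_cvg_series_bounded (u : nat -> R) M : (forall i, 0 <= u i) ->
  (forall n, \sum_(i < n) u i <= M) -> cvgn (series u).
Proof.
move=> u0 uM; apply: nondecreasing_is_cvgn.
  by apply: nondecreasing_series => i _ _.
by exists M => _ [n _ <-]; rewrite /series/= big_mkord.
Qed.

Lemma lim_series_bounded (u : nat -> R) M : (forall i, 0 <= u i) ->
  (forall n, \sum_(i < n) u i <= M) -> 0 <= limn (series u) <= M.
Proof.
move=> u0 uM; have hc := is_cvg_series_bounded u0 uM; apply/andP; split.
  by apply: limr_ge => //; apply: nearW => n; rewrite /series/= sumr_ge0.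
by apply: limr_le => //; apply: nearW => n; rewrite /series/= big_mkord.
Qed.

Lemma esum_nat (u : nat -> R) M : (forall i, 0 <= u i) ->
  (forall n, \sum_(i < n) u i <= M) ->
  (\esum_(i in [set: nat]) (u i)%:E = (limn (series u))%:E)%E.
Proof.
move=> u0 uM; rewrite -nneseries_esumT; last by move=> i; rewrite lee_fin.
rewrite -EFin_lim; last exact: is_cvg_series_bounded uM.
congr (limn _); apply/funext => n; rewrite /series/= sumEFin.
by [].
Qed.

Lemma esum_int (a : int -> \bar R) : (forall j, (0 <= a j)%E) ->
  (\esum_(j in [set: int]) a j = \esum_(i in [set: nat]) a (Posz i) +
     \esum_(i in [set: nat]) a (Negz i))%E.
Proof.
move=> a0; rewrite (esumID [set j : int | 0 <= j]); last by move=> j _.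
rewrite !setTI; congr (_ + _)%E.
- apply: reindex_esum; split; first by move=> i _.
    by move=> i j _ _ /= [].
  by move=> [i|i] //= _; exists i.
- apply: reindex_esum; split; first by move=> i _.
    by move=> i j _ _ /= [].
  by move=> [i|i] //= h; exists i.
Qed.

Lemma sum_geometric (q : R) n : 0 <= q < 1 -> \sum_(i < n) q ^+ i <= (1 - q)^-1.
Proof.
move=> /andP[q0 q1]; have h : 0 < 1 - q by rewrite subr_gt0.
rewrite -[leRHS]mul1r ler_pdivlMr// mulrC.
have -> : (1 - q) * \sum_(i < n) q ^+ i = 1 - q ^+ n.
  by rewrite -[LHS]opprK -mulNr opprB -subrX1 opprB.
by rewrite gerBl exprn_ge0.
Qed.

End NatSums.

(** * Identification of the renewal limit with [psi] *)

Section PsiLimit.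
Variables (R : realType) (A : finType) (p : A -> R).
Hypothesis hA : (2 <= #|A|)%N.
Hypothesis hp : forall a, 0 < p a.
Hypothesis hp1 : \sum_(a : A) p a = 1.
Local Notation c0 := (spread p).
Local Notation s := (step p).

Lemma is_spanP d : is_span p d <-> common_span s d.
Proof.
by split=> -[d0 h]; split => // a; have [m e] := h a; exists (- m);
  rewrite intrN mulNr -e // /step opprK.
Qed.

Definition largest_span (d : R) :=
  common_span s d /\ forall d', common_span s d' -> d' <= d.

(** Spans are positive, so the default value 0 of [xget] signals exactly that there is no largest
    span. *)
Lemma max_spanP : if max_span p == 0 then ~ exists d, largest_span d
  else largest_span (max_span p).
Proof.
rewrite /max_span; set S := [set d | _].
have eS d : S d <-> largest_span d.
  split=> -[/is_spanP h1 h2]; split => // d' /is_spanP hd'; exact: h2.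
case: (@xgetP _ 0 S) => [y -> Sy|hn].
  by rewrite gt_eqF; [exact/eS|case: Sy => -[]].
by rewrite eqxx => -[d /eS]; exact: hn.
Qed.

(** This permits replacing [f_ET] and [f_Ei] by closed formulas that are established for positive
    intensity only. *)
Lemma psi_ext f g t : (forall x, 0 < x -> f x = g x) -> psi p f t = psi p g t.
Proof.
move=> fg; rewrite /psi; case: ifPn => _.
  rewrite /mellin; apply: eq_Rintegral => x; rewrite inE/= in_itv/= andbT => x0.
  by rewrite fg.
by congr (_ * fine _); apply: eq_esum => j _; rewrite fg// expR_gt0.
Qed.

Lemma psi_limit_nonlattice f G l : admissible f G l -> max_span p = 0 ->
  forall e, 0 < e -> exists T, forall t, T <= t ->
    `|entropy p * wavg p f t - psi p f t| <= e.
Proof.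
move=> hadm h0 e e0; have := max_spanP; rewrite h0 eqxx => hno.
have -> : psi p f = fun=> l.
  by apply/funext => t; rewrite /psi h0 eqxx (admissible_mellin hadm).
have [C [df [hd hf hdf hG [hGb hGl]]]] := hadm.
have /card_gt0P[a0 _] : (0 < #|A|)%N by exact: ltnW.
have fC y : 0 < y -> `|f y| <= C * bump y.
  by move=> y0; have /andP[h1 h2] := hf y y0; rewrite ger0_norm.
have hK := bump_lip_deriv hd fC hdf.
set K := 128 * C in hK.
have C0 : 0 <= C by exact: quadratic_cst_ge0 (bump_quadratic fC).
have hq : quadratic C (fun x => x * G x).
  move=> x x0; have /andP[g1 g2] := hGb x x0.
  by rewrite normrM !ger0_norm ?(ltW x0)// expr2 mulrCA ler_wpM2l ?(ltW x0).
have e2 : 0 < e / 2 by lra.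
have [|T hT] := renewal_limit hA hp hp1 fC hK hq _ e2.
  move=> a e' e'0; have sa := step_gt0 hA hp hp1 a.
  (* Chosen so that the step [h = s a / N] satisfies both [h <= 1] and [K * h <= e'], as the
     second-order error [K * h * h] requires. *)
  pose N := (Num.truncn (s a * (1 + K / e'))).+1; exists N.
  have K0 : 0 <= K by rewrite /K mulr_ge0.
  have Ke : 0 <= K / e' by rewrite divr_ge0// ltW.
  have hN : s a * (1 + K / e') < N%:R by exact: truncnS_gt.
  have N0 : 0 < N%:R :> R by rewrite ltr0n.
  have h0' : 0 < s a / N%:R by rewrite divr_gt0.
  have h1 : s a / N%:R <= 1.
    rewrite ler_pdivrMr// mul1r; apply: le_trans (ltW hN).
    by rewrite ler_peMr ?(ltW sa)// lerDl.
  have h2 : K * (s a / N%:R) <= e'.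
    rewrite mulrA ler_pdivrMr// mulrC -ler_pdivrMl//.
    apply: le_trans (ltW hN).
    have -> : e'^-1 * (s a * K) = s a * (K / e') by ring.
    by rewrite ler_pM2l// lerDr.
  split => //; first exact: (hit_nonlattice (step_gt0 hA hp hp1) a0).
  move=> y y0; set h := s a / N%:R in h0' h1 h2 *.
  have hh : 0 <= h <= 1 by rewrite ltW.
  apply: (le_trans (primitive_increment hK hG y0 hh)).
  by rewrite ler_wpM2r ?bump_ge0// ler_wpM2r// ltW.
have [X [Xr hX]] : \forall x \near +oo, `|l - G x| <= e / 2.
  by move/cvgrPdist_le : hGl; apply.
exists (Num.max T `|X|) => t; rewrite ge_max => /andP[t1 t2].
have -> : entropy p * wavg p f t - l =
  (entropy p * wavg p f t - G (expR t)) - (l - G (expR t)) by ring.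
apply: (le_trans (ler_normB _ _)).
have := hT t t1; have := hX (expR t).
have tX : X < expR t.
  have := ler_norm X; have := expR_ge1Dx t; lra.
by move=> /(_ tX); lra.
Qed.

(** For [q = exp (-d)] and [x = exp t], the term with index [j >= 0] of the series defining
    [psi]. *)
Definition lattice_term (f : R -> R) (q x : R) (j : nat) : R :=
  f (q ^+ j * x) / (q ^+ j * x).

Lemma lattice_term_bound C f q x n :
  (forall y, 0 < y -> 0 <= f y <= C * bump y) -> 0 < q < 1 -> 0 < x ->
  (forall j, 0 <= lattice_term f q x j) /\
  \sum_(j < n) lattice_term f q x j <= C / (1 - q) * x.
Proof.
move=> hf /andP[q0 q1] x0.
have y0 j : 0 < q ^+ j * x by rewrite mulr_gt0// exprn_gt0.
split=> [j|].
  by rewrite /lattice_term divr_ge0 ?(ltW (y0 j))//; have /andP[] := hf _ (y0 j).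
have C0 : 0 <= C.
  have /andP[h1 h2] := hf 1 ltr01; have := le_trans h1 h2.
  by rewrite pmulr_lge0// bump_gt0.
apply: (@le_trans _ _ (\sum_(j < n) C * x * q ^+ j)).
  apply: ler_sum => j _; rewrite /lattice_term ler_pdivrMr//.
  have /andP[_ h2] := hf _ (y0 j); apply: (le_trans h2).
  have -> : C * x * q ^+ j * (q ^+ j * x) = C * (q ^+ j * x) ^+ 2 by ring.
  by rewrite ler_wpM2l// bump_le_sqr.
rewrite -mulr_sumr [leRHS]mulrAC ler_wpM2l ?mulr_ge0 ?(ltW x0)//.
by apply: sum_geometric; rewrite (ltW q0).
Qed.

(** The function [L], the series of [psi] restricted to [j >= 0], takes the place of the primitive:
    over one span its increment is exactly [d * (f y / y)]. The full series is periodic in [ln y],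
    hence in general not [O(y)] at 0 as [quadratic] requires. *)
Lemma psi_limit_lattice f G l : admissible f G l -> max_span p != 0 ->
  forall e, 0 < e -> exists T, forall t, T <= t ->
    `|entropy p * wavg p f t - psi p f t| <= e.
Proof.
move=> hadm h0 e e0; have := max_spanP; rewrite (negbTE h0).
set d := max_span p in h0 *; move=> [hd hmax]; have [d0 hda] := hd.
have [C [df [hder hf hdf _ _]]] := hadm.
have /card_gt0P[a0 _] : (0 < #|A|)%N by exact: ltnW.
have fC y : 0 < y -> `|f y| <= C * bump y.
  by move=> y0; have /andP[h1 h2] := hf y y0; rewrite ger0_norm.
have C0 : 0 <= C by exact: quadratic_cst_ge0 (bump_quadratic fC).
have hK := bump_lip_deriv hder fC hdf.
set K := 128 * C in hK.
pose q := expR (- d).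
have q01 : 0 < q < 1 by rewrite expR_gt0 expR_lt1 oppr_lt0.
have /andP[q0 q1] := q01.
pose u x := lattice_term f q x.
have u0 x : 0 < x -> forall j, 0 <= u x j.
  by move=> x0; have [] := lattice_term_bound 0 hf q01 x0.
have uM x : 0 < x -> forall n, \sum_(j < n) u x j <= C / (1 - q) * x.
  by move=> x0 n; have [] := lattice_term_bound n hf q01 x0.
pose L x := d * limn (series (u x)).
have Lb x : 0 < x -> 0 <= L x <= d * (C / (1 - q)) * x.
  move=> x0; have /andP[h1 h2] := lim_series_bounded (u0 x x0) (uM x x0).
  by rewrite /L mulr_ge0 ?(ltW d0)//= -[leRHS]mulrA ler_pM2l.
have Lrec y : 0 < y -> L y - L (expR (- d) * y) = d * (f y / y).
  move=> y0; rewrite -/q /L -mulrBr; congr (d * _).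
  have qy : 0 < q * y by rewrite mulr_gt0.
  have c1 := is_cvg_series_bounded (u0 _ y0) (uM _ y0).
  have c2 := is_cvg_series_bounded (u0 _ qy) (uM _ qy).
  apply/eqP; rewrite subr_eq; apply/eqP.
  apply: (cvg_lim (@Rhausdorff R)); rewrite -(@cvg_shiftS _ (series (u y))).
  have -> : (fun n => series (u y) n.+1) = cst (f y / y) + series (u (q * y)).
    apply/funext => n; rewrite /series/= fctE big_nat_recl//; congr (_ + _).
      by rewrite /u /lattice_term expr0 mul1r.
    by apply: eq_bigr => i _; rewrite /u /lattice_term exprSr mulrA.
  by apply: cvgD; [exact: cvg_cst|].
pose C' := C + d * (C / (1 - q)).
have dC : 0 <= d * (C / (1 - q)).
  by rewrite mulr_ge0 ?(ltW d0)// divr_ge0// subr_ge0 ltW.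
have fC' y : 0 < y -> `|f y| <= C' * bump y.
  by move=> y0; apply: (le_trans (fC y y0)); rewrite ler_wpM2r ?bump_ge0// lerDl.
have hq : quadratic C' (fun x => x * L x).
  move=> x x0; have /andP[g1 g2] := Lb x x0.
  rewrite normrM !ger0_norm ?(ltW x0)// expr2 [leRHS]mulrCA ler_wpM2l ?(ltW x0)//.
  by apply: (le_trans g2); rewrite ler_wpM2r ?(ltW x0)// lerDr.
have e2 : 0 < e / 2 by lra.
have [|T hT] := renewal_limit hA hp hp1 fC' hK hq _ e2.
  move=> a e' e'0; have sa := step_gt0 hA hp hp1 a.
  have [m em] := hda a.
  have m0 : 0 < m by have := sa; rewrite em pmulr_lgt0// ltr0z.
  (* The step [s a] consists of [m] spans, so cutting it into that many pieces gives the span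
     itself. *)
  exists `|m|%N; have eN : (`|m|%N)%:R = m%:~R :> R by rewrite natr_absz gtr0_norm.
  have ed : s a / (`|m|%N)%:R = d.
    by rewrite eN em mulrAC divff ?mul1r// intr_eq0 gt_eqF.
  rewrite ed; split; first by rewrite absz_gt0 gt_eqF.
    exact: (hit_lattice (step_gt0 hA hp hp1) a0).
  move=> y y0; rewrite Lrec//.
  have -> : y * (d * (f y / y)) - d * f y = 0 by field; rewrite gt_eqF.
  by rewrite normr0; apply: mulr_ge0; [apply: mulr_ge0; exact: ltW|exact: bump_ge0].
(* The omitted terms evaluate [f] beyond [exp t], where [f <= C] suffices; they form a geometric
   series of order [exp (-t)]. *)
have psiE t : `|psi p f t - L (expR t)| <= d * C / (1 - q) * expR (- t).
  rewrite /psi -/d (negbTE h0).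
  pose a (j : int) : R := expR (j%:~R * d - t) * f (expR (t - j%:~R * d)).
  have a0' j : 0 <= a j.
    rewrite /a mulr_ge0 ?expR_ge0//.
    by have /andP[] := hf _ (expR_gt0 (t - j%:~R * d)).
  rewrite (_ : \esum_(j in _) _ = \esum_(j in [set: int]) (a j)%:E)%E//.
  rewrite esum_int; last by move=> j; rewrite lee_fin.
  have pow n : expR (n%:R * - d) = q ^+ n by rewrite expRM_natl.
  have ap n : a (Posz n) = u (expR t) n.
    rewrite /a /u /lattice_term -pow.
    have -> : expR (n%:R * - d) * expR t = expR (t - n%:R * d).
      by rewrite -expRD; congr expR; ring.
    by rewrite mulrC -expRN; congr (_ * expR _); rewrite opprB.
  have an n : a (Negz n) <= C * expR (- t) * q ^+ n.
    rewrite /a NegzE intrN mulNr opprK.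
    set y := t + _; have -> : - (n.+1%:~R * d) - t = - y by rewrite /y; ring.
    have /andP[_ h2] := hf _ (expR_gt0 y).
    apply: (@le_trans _ _ (expR (- y) * (C * 1))).
      rewrite ler_wpM2l ?expR_ge0//; apply: (le_trans h2); rewrite ler_wpM2l//.
      rewrite /bump ler_pdivrMr ?exprn_gt0 ?addr_gt0 ?expR_gt0// mul1r.
      by rewrite lerXn2r ?nnegrE ?addr_ge0 ?expR_ge0//; lra.
    rewrite mulr1 mulrC -mulrA ler_wpM2l// -pow -expRD ler_expR /y.
    rewrite -pmulrn -natr1 mulrDl mul1r; lra.
  under [X in (X + _)%E]eq_esum do rewrite ap.
  rewrite (esum_nat (u0 _ (expR_gt0 t)) (uM _ (expR_gt0 t))).
  have anM n : \sum_(j < n) a (Negz j) <= C * expR (- t) / (1 - q).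
    apply: (@le_trans _ _ (\sum_(j < n) C * expR (- t) * q ^+ j)).
      by apply: ler_sum => j _.
    rewrite -mulr_sumr ler_wpM2l ?mulr_ge0 ?expR_ge0// sum_geometric//.
    by rewrite (ltW q0).
  rewrite (esum_nat (fun n => a0' (Negz n)) anM) -EFinD /=.
  have /andP[l1 l2] := lim_series_bounded (fun n => a0' (Negz n)) anM.
  rewrite /L mulrDr addrAC subrr add0r ger0_norm ?mulr_ge0 ?(ltW d0)//.
  have -> : d * C / (1 - q) * expR (- t) = d * (C * expR (- t) / (1 - q)) by ring.
  by rewrite ler_pM2l.
set B := d * C / (1 - q) in psiE.
have B0 : 0 <= B by rewrite /B -mulrA.
exists (Num.max T (2 * B / e)) => t; rewrite ge_max => /andP[t1 t2].
have -> : entropy p * wavg p f t - psi p f t =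
  (entropy p * wavg p f t - L (expR t)) - (psi p f t - L (expR t)) by ring.
apply: (le_trans (ler_normB _ _)).
have h1 := hT t t1; have h2 := psiE t.
have h3 : B * expR (- t) <= e / 2.
  rewrite expRN ler_pdivrMr ?expR_gt0//.
  move: t2; rewrite ler_pdivrMr// => t2.
  have := expR_ge1Dx t; nra.
lra.
Qed.

Theorem psi_limit f G l : admissible f G l ->
  forall e, 0 < e -> exists T, forall t, T <= t ->
    `|entropy p * wavg p f t - psi p f t| <= e.
Proof.
move=> h; have [h0|h0] := eqVneq (max_span p) 0.
  exact: psi_limit_nonlattice h h0.
exact: psi_limit_lattice h h0.
Qed.

End PsiLimit.

(** * De-Poissonization *)

Section BinomialPoisson.
Variable R : realType.
Implicit Types q x K e : R.

Lemma exprB_le (a b : R) m : 0 <= a <= 1 -> 0 <= b <= 1 ->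
  `|a ^+ m - b ^+ m| <= m%:R * `|a - b|.
Proof.
move=> /andP[a0 a1] /andP[b0 b1]; elim: m => [|m IH].
  by rewrite !expr0 subrr normr0 mul0r.
have -> : a ^+ m.+1 - b ^+ m.+1 = a * (a ^+ m - b ^+ m) + (a - b) * b ^+ m.
  by rewrite !exprS; ring.
apply: (le_trans (ler_normD _ _)); rewrite !normrM -natr1 mulrDl mul1r.
rewrite (ger0_norm a0) (ger0_norm (exprn_ge0 m b0)); apply: lerD.
  by apply: le_trans IH; rewrite ler_piMl.
by rewrite ler_piMr// exprn_ile1.
Qed.

(** The upper bound rests on [(1 + q) * (1 - q + q ^+ 2) = 1 + q ^+ 3]. *)
Lemma expN_quad q : 0 <= q -> 1 - q <= expR (- q) <= 1 - q + q ^+ 2.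
Proof.
move=> q0; have pos : 0 < 1 - q + q ^+ 2 by nra.
apply/andP; split; first exact: expR_ge1Dx.
rewrite expRN -[leRHS]invrK lef_pV2 ?posrE ?expR_gt0 ?invr_gt0//.
apply: le_trans (expR_ge1Dx q); rewrite -[leLHS]mul1r ler_pdivrMr//.
have -> : (1 + q) * (1 - q + q ^+ 2) = 1 + q ^+ 3 by ring.
by rewrite lerDl exprn_ge0.
Qed.

Lemma expN_range q : 0 <= q -> 0 <= expR (- q) <= 1.
Proof. by move=> q0; rewrite expR_ge0 -expR0 ler_expR oppr_le0. Qed.

Lemma pow_exp_le q m : 0 < q <= 1 ->
  `|(1 - q) ^+ m - expR (- (m%:R * q))| <= m%:R * q ^+ 2.
Proof.
move=> /andP[q0 q1]; rewrite -mulrN expRM_natl.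
have /andP[h1 h2] := expN_quad (ltW q0).
apply: (@le_trans _ _ (m%:R * `|1 - q - expR (- q)|)).
  by apply: exprB_le; [lra|exact: expN_range (ltW q0)].
by rewrite ler_wpM2l// distrC ger0_norm; lra.
Qed.

Lemma pow_exp_shift q n k : (k <= n)%N -> 0 < q <= 1 ->
  `|(1 - q) ^+ (n - k) - expR (- (n%:R * q))| <= n%:R * q ^+ 2 + k%:R * q.
Proof.
move=> kn q01; have /andP[q0 q1] := q01.
have h1 := pow_exp_le (n - k) q01.
have h2 : `|expR (- ((n - k)%:R * q)) - expR (- (n%:R * q))| <= k%:R * q.
  have -> : n%:R * q = (n - k)%:R * q + k%:R * q by rewrite natrB//; ring.
  set y := _ * q; set z := _ * q.
  have y0 : 0 <= y by rewrite mulr_ge0// ltW.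
  have z0 : 0 <= z by rewrite mulr_ge0// ltW.
  have -> : expR (- y) - expR (- (y + z)) = expR (- y) * (1 - expR (- z)).
    by rewrite opprD expRD; ring.
  have /andP[a b] := expN_range y0; have /andP[c d] := expN_range z0.
  rewrite ger0_norm; last by rewrite mulr_ge0// subr_ge0.
  have := expR_ge1Dx (- z); nra.
have -> : (1 - q) ^+ (n - k) - expR (- (n%:R * q)) =
  ((1 - q) ^+ (n - k) - expR (- ((n - k)%:R * q))) +
  (expR (- ((n - k)%:R * q)) - expR (- (n%:R * q))) by ring.
apply: (le_trans (ler_normD _ _)); apply: lerD => //.
apply: (le_trans h1); rewrite ler_wpM2r ?sqr_ge0// ler_nat; exact: leq_subr.
Qed.

(** The probability that a binomial variable is at least 2; at [n = 0] the factor [n] makes the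
    truncated exponent harmless. *)
Definition bin_many (n : nat) q : R := 1 - (1 - q) ^+ n - n%:R * q * (1 - q) ^+ n.-1.

(** The error is relative to [(n q)^2], which for [n q <= K] is comparable to [bump (n q)] and can
    therefore be summed over words. The difference itself is at most [n q^2 (2 + n q)], which
    explains the threshold [(K + 2) / e]. *)
Lemma bin_many_poisson K e : 0 < K -> 0 < e -> exists N, forall n q, (N <= n)%N ->
  0 < q <= 1 -> n%:R * q <= K ->
  `|bin_many n q - many (n%:R * q)| <= e * (n%:R * q) ^+ 2.
Proof.
move=> K0 e0; exists (Num.truncn ((K + 2) / e)).+1 => n q hN q01 nq.
have n0 : (0 < n)%N by exact: leq_trans hN.
have n0' : 0 < n%:R :> R by rewrite ltr0n.
have hn : (K + 2) / e <= n%:R.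
  by apply: (le_trans (ltW (truncnS_gt _))); rewrite ler_nat.
have /andP[q0 q1] := q01.
have h1 := pow_exp_le n q01; have h2 := pow_exp_shift n0 q01.
rewrite subn1 mul1r in h2.
set x := n%:R * q in nq h1 h2 *.
have x0 : 0 < x by rewrite mulr_gt0.
have -> : bin_many n q - many x =
  - ((1 - q) ^+ n - expR (- x)) - x * ((1 - q) ^+ n.-1 - expR (- x)).
  by rewrite /bin_many /many -/x; ring.
apply: (le_trans (ler_normB _ _)); rewrite normrN normrM (ger0_norm (ltW x0)).
apply: (@le_trans _ _ (n%:R * q ^+ 2 + x * (n%:R * q ^+ 2 + q))).
  by apply: lerD => //; rewrite ler_wpM2l// ltW.
have -> : n%:R * q ^+ 2 + x * (n%:R * q ^+ 2 + q) = (n%:R * q ^+ 2) * (2 + x).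
  by rewrite /x; ring.
apply: (@le_trans _ _ (n%:R * q ^+ 2 * (n%:R * e))).
  have nq2 : 0 <= n%:R * q ^+ 2 by apply: mulr_ge0; rewrite ?sqr_ge0.
  by rewrite ler_wpM2l//; move: hn; rewrite ler_pdivrMr//; lra.
by rewrite le_eqVlt; apply/orP; left; apply/eqP; rewrite /x; ring.
Qed.

Lemma ffact_ratio n k : (0 < n)%N ->
  1 - k%:R ^+ 2 / n%:R <= (n ^_ k)%:R / n%:R ^+ k :> R /\
  (n ^_ k)%:R / n%:R ^+ k <= 1 :> R.
Proof.
move=> n0; have n0' : 0 < n%:R :> R by rewrite ltr0n.
elim: k => [|k [IH1 IH2]].
  by rewrite ffactn0 expr0 divr1 mulr0n expr0n/= mul0r subr0; split.
have -> : (n ^_ k.+1)%:R / n%:R ^+ k.+1 =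
    ((n ^_ k)%:R / n%:R ^+ k) * ((n - k)%:R / n%:R) :> R.
  by rewrite ffactnSr natrM exprSr; field; rewrite expf_neq0 ?gt_eqF.
set r := (n ^_ k)%:R / _ in IH1 IH2 *.
have r0 : 0 <= r by rewrite divr_ge0// exprn_ge0.
have s1 : (n - k)%:R / n%:R <= (1 : R) by rewrite ler_pdivrMr// mul1r ler_nat leq_subr.
have s0 : 1 - k%:R / n%:R <= (n - k)%:R / n%:R :> R.
  rewrite -[X in X - _](@divff _ n%:R) ?gt_eqF// -mulrBl ler_pM2r ?invr_gt0//.
  by rewrite lerBlDr -natrD ler_nat; lia.
split; last by rewrite mulr_ile1// divr_ge0.
set t := (n - k)%:R / n%:R in s0 s1 *.
have k2 : (k.+1)%:R ^+ 2 / n%:R = k%:R ^+ 2 / n%:R + 2 * (k%:R / n%:R) + n%:R^-1 :> R.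
  by rewrite -natr1; field; rewrite gt_eqF.
have a1 : 0 <= k%:R / n%:R :> R by rewrite divr_ge0.
have a2 : 0 <= n%:R^-1 :> R by rewrite invr_ge0.
have : r * (1 - k%:R / n%:R) <= r * t by rewrite ler_wpM2l.
have : r * (k%:R / n%:R) <= k%:R / n%:R by rewrite ler_piMl.
rewrite k2; lra.
Qed.

(** The probability that exactly [k] of [n] strings pass through a word of weight [q] and continue
    along [k] prescribed incomparable words, one each; [c] is the product of the weights of these
    words. *)
Definition bin_exact (c : R) (k n : nat) q : R :=
  c * (n ^_ k)%:R * q ^+ k * (1 - q) ^+ (n - k).

Lemma bin_exact_poisson c k K e : 0 <= c -> 0 < K -> 0 < e ->
  exists N, forall n q, (N <= n)%N -> 0 < q <= 1 -> n%:R * q <= K ->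
  `|bin_exact c k.+2 n q - c * gam k.+2 (n%:R * q)| <= e * (n%:R * q) ^+ 2.
Proof.
move=> c0 K0 e0; set m := k.+2.
(* The relative error is at most [D / n]: the first summand comes from the falling factorial, the
   other two from [pow_exp_shift]. *)
pose D : R := m%:R ^+ 2 + K ^+ 2 + m%:R * K.
pose B : R := c * K ^+ k * D.
have D0 : 0 <= D by rewrite !addr_ge0 ?sqr_ge0 ?mulr_ge0// ltW.
exists (maxn m (Num.truncn (B / e)).+1) => n q; rewrite geq_max => /andP[mn hN] q01 nq.
have n0 : (0 < n)%N by exact: leq_trans hN.
have n0' : 0 < n%:R :> R by rewrite ltr0n.
have hn : B / e <= n%:R.
  by apply: (le_trans (ltW (truncnS_gt _))); rewrite ler_nat.
have /andP[q0 q1] := q01.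
have h2 := pow_exp_shift mn q01; have [r1 r2] := ffact_ratio m n0.
set r := (n ^_ m)%:R / _ in r1 r2.
set x := n%:R * q in nq h2 *.
have x0 : 0 < x by rewrite mulr_gt0.
have -> : bin_exact c m n q - c * gam m x =
   c * x ^+ m * ((r - 1) * (1 - q) ^+ (n - m) + ((1 - q) ^+ (n - m) - expR (- x))).
  rewrite /bin_exact /gam /r /x exprMn; field; rewrite expf_neq0// gt_eqF//.
have cx : 0 <= c * x ^+ m by rewrite mulr_ge0// exprn_ge0// ltW.
rewrite normrM (ger0_norm cx).
have qx : q <= K / n%:R by rewrite ler_pdivlMr// mulrC.
have b : `|(r - 1) * (1 - q) ^+ (n - m) + ((1 - q) ^+ (n - m) - expR (- x))| <= D / n%:R.
  apply: (le_trans (ler_normD _ _)); rewrite normrM.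
  have p1 : `|(1 - q) ^+ (n - m)| <= 1.
    rewrite ger0_norm ?exprn_ge0 ?subr_ge0//.
    by rewrite exprn_ile1 ?subr_ge0// gerBl ltW.
  have r3 : `|r - 1| <= m%:R ^+ 2 / n%:R by rewrite distrC ger0_norm ?subr_ge0//; lra.
  have h3 : n%:R * q ^+ 2 + m%:R * q <= (K ^+ 2 + m%:R * K) / n%:R.
    have -> : n%:R * q ^+ 2 = x ^+ 2 / n%:R by rewrite /x; field; rewrite gt_eqF.
    rewrite [leRHS]mulrDl; apply: lerD.
      by rewrite ler_pM2r ?invr_gt0// lerXn2r ?nnegrE ?(ltW x0)// ltW.
    by rewrite -mulrA ler_wpM2l.
  have h4 : `|r - 1| * `|(1 - q) ^+ (n - m)| <= m%:R ^+ 2 / n%:R.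
    by apply: le_trans r3; rewrite ler_piMr.
  have -> : D / n%:R = m%:R ^+ 2 / n%:R + (K ^+ 2 + m%:R * K) / n%:R.
    by rewrite /D; ring.
  by apply: lerD => //; exact: le_trans h2 h3.
apply: (le_trans (ler_wpM2l cx b)).
have xm : c * x ^+ m <= c * K ^+ k * x ^+ 2.
  rewrite -mulrA ler_wpM2l// /m -addn2 exprD ler_wpM2r ?sqr_ge0//.
  by rewrite lerXn2r ?nnegrE ?(ltW x0)// ltW.
have Dn : 0 <= D / n%:R by rewrite divr_ge0.
apply: (le_trans (ler_wpM2r Dn xm)).
have -> : c * K ^+ k * x ^+ 2 * (D / n%:R) = B / n%:R * x ^+ 2 by rewrite /B; ring.
rewrite ler_wpM2r ?sqr_ge0// ler_pdivrMr//.
by move: hn; rewrite ler_pdivrMr// mulrC.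
Qed.

Lemma geom_decay (r : R) n : 0 <= r < 1 -> n.+1%:R * r ^+ n <= (1 - r)^-1.
Proof.
move=> r01; apply: le_trans (sum_geometric n.+1 r01).
have /andP[r0 r1] := r01.
have -> : n.+1%:R * r ^+ n = \sum_(i < n.+1) r ^+ n.
  by rewrite sumr_const card_ord mulr_natl.
apply: ler_sum => i _; apply: ler_wiXn2l; rewrite ?r0 ?(ltW r1)//.
by rewrite -ltnS.
Qed.

(** The reason for the length [3 * n]: two of the factors [r ^+ n] absorb [n ^+ 2], and the third
    still yields [1 / n.+1]. *)
Lemma geom_decay3 (r : R) n : 0 <= r < 1 ->
  n%:R ^+ 2 * r ^+ (3 * n) <= (1 - r)^-1 ^+ 3 / n.+1%:R.
Proof.
move=> r01; have /andP[r0 r1] := r01; have h := geom_decay n r01.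
rewrite ler_pdivlMr// mulrC.
have h0 : 0 <= n.+1%:R * r ^+ n by rewrite mulr_ge0// exprn_ge0.
apply: (@le_trans _ _ ((n.+1%:R * r ^+ n) ^+ 3)); last first.
  by rewrite lerXn2r ?nnegrE// invr_ge0 subr_ge0 ltW.
have -> : (n.+1%:R * r ^+ n) ^+ 3 = n.+1%:R * (n.+1%:R ^+ 2 * r ^+ (3 * n)) :> R.
  by rewrite mulnC exprM; ring.
rewrite ler_wpM2l// ler_wpM2r ?exprn_ge0// lerXn2r ?nnegrE// ler_nat//.
Qed.

End BinomialPoisson.

(** * Expected counts *)

Section MeanAsymptotics.
Variables (R : realType) (A : finType) (p : A -> R).
Hypothesis hA : (2 <= #|A|)%N.
Hypothesis hp : forall a, 0 < p a.
Hypothesis hp1 : \sum_(a : A) p a = 1.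
Local Notation c0 := (spread p).
Local Notation rho := (coincidence p).

Definition poissonized (F : nat -> R -> R) (f : R -> R) :=
  forall K e, 0 < K -> 0 < e -> exists N : nat, forall n q, (N <= n)%N ->
  0 < q <= 1 -> n%:R * q <= K -> `|F n q - f (n%:R * q)| <= e * (n%:R * q) ^+ 2.

Lemma coincidence01 : 0 <= rho < 1.
Proof. by rewrite coincidence_ge0 (coincidence_lt1 hA hp hp1). Qed.

(** Words with [n p_v >= K] are too few to matter, each contributing at most 1; for the others the
    termwise error is bounded by a small multiple of [bump], whose sum is [O(n)]. *)
Lemma depoissonize F f : poissonized F f ->
  (forall x, 0 < x -> 0 <= f x <= 1) ->
  (forall n v, v \in words A (3 * n) -> 0 <= F n (wt p v) <= 1) ->
  forall e, 0 < e -> exists N : nat, forall n, (N <= n)%N ->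
  `|\sum_(v <- words A (3 * n)) F n (wt p v) - wsum p (3 * n) f n%:R| <= e * n%:R.
Proof.
move=> hF f1 F1 e e0; have c00 := spread_gt0 hA hp hp1.
(* This makes the bound [4 * n / (K * c0)] of [count_heavy] equal to [e / 2 * n]; similarly [e1]
   makes the light words cost [e / 2 * n]. *)
pose K := 8 / (e * c0).
have K0 : 0 < K by rewrite divr_gt0// mulr_gt0.
pose e1 := e * c0 / (2 * (1 + K) ^+ 2).
have e10 : 0 < e1 by rewrite divr_gt0 ?mulr_gt0 ?exprn_gt0 ?addr_gt0.
have [N hN] := hF K e1 K0 e10; exists (maxn N 1) => n; rewrite geq_max => /andP[Nn n0].
have n0' : 0 < n%:R :> R by rewrite ltr0n.
rewrite /wsum -sumrB; apply: (le_trans (ler_norm_sum _ _ _)).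
rewrite (bigID (fun v => K <= n%:R * wt p v))/=.
have -> : e * n%:R = 4 * n%:R / (K * c0) + e / 2 * n%:R.
  by rewrite /K; field; rewrite !gt_eqF.
apply: lerD.
  apply: le_trans (count_heavy hA hp hp1 (3 * n) n0' K0).
  rewrite big_seq_cond [leRHS]big_seq_cond; apply: ler_sum => v /andP[vw _].
  have /andP[a1 a2] := F1 n v vw.
  have /f1/andP[b1 b2] : 0 < n%:R * wt p v by rewrite mulr_gt0// wt_gt0.
  by rewrite ler_norml; apply/andP; split; lra.
apply: (@le_trans _ _ (\sum_(v <- words A (3 * n) | ~~ (K <= n%:R * wt p v))
    e1 * (1 + K) ^+ 2 * bump (n%:R * wt p v))).
  apply: ler_sum => v; rewrite -ltNge => /ltW hv.
  have w0 := wt_gt0 hp v.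
  apply: (le_trans (hN n (wt p v) Nn _ hv)); first by rewrite w0 (wt_le1 hA hp hp1).
  by rewrite -mulrA ler_pM2l// bump_ge// hv andbT ltW// mulr_gt0.
apply: (@le_trans _ _ (e1 * (1 + K) ^+ 2 * wsum p (3 * n) (@bump R) n%:R)).
  rewrite /wsum mulr_sumr big_mkcond/=; apply: ler_sum => v _; case: ifPn => // _.
  by apply: mulr_ge0; [apply: mulr_ge0; [exact: ltW|exact: sqr_ge0]|exact: bump_ge0].
have -> : e1 * (1 + K) ^+ 2 = e / 2 * c0.
  by rewrite /e1; field; rewrite gt_eqF// addr_gt0.
apply: (@le_trans _ _ (e / 2 * c0 * (n%:R / c0))).
  by rewrite ler_wpM2l ?mulr_ge0 ?divr_ge0 ?(ltW e0) ?(ltW c00)// (wsum_bump_le hA hp hp1).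
by rewrite le_eqVlt; apply/orP; left; apply/eqP; field; rewrite gt_eqF.
Qed.

(** Three passages: from binomial to Poisson terms, from words shorter than [3 * n] to all words,
    and from [wavg] at [ln n] to [psi]. *)
Theorem mean_asymptotics F f G l : admissible f G l -> poissonized F f ->
  (forall x, 0 < x -> 0 <= f x <= 1) ->
  (forall n v, v \in words A (3 * n) -> 0 <= F n (wt p v) <= 1) ->
  forall e, 0 < e -> exists N : nat, forall n, (N <= n)%N ->
  `|entropy p * (\sum_(v <- words A (3 * n)) F n (wt p v)) - psi p f (ln n%:R) * n%:R|
     <= e * n%:R.
Proof.
move=> hadm hF f1 F1 e e0.
have [C [df [_ hf _ _ _]]] := hadm.
have hq : quadratic C f.
  by apply: bump_quadratic => y y0; have /andP[h1 h2] := hf y y0; rewrite ger0_norm.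
pose H := `|entropy p| + 1.
have H0 : 0 < H by rewrite ltr_wpDl.
have Hle : `|entropy p| <= H by rewrite /H lerDl.
have e1 : 0 < e / (4 * H) by rewrite divr_gt0// mulr_gt0.
have e2 : 0 < e / 2 by lra.
have [N1 h1] := depoissonize hF f1 F1 e1.
have [T hT] := psi_limit hA hp hp1 hadm e2.
pose r := (1 - rho)^-1.
have /andP[rho0 rho1] := coincidence01.
have r0 : 0 < r by rewrite invr_gt0 subr_gt0.
have C0 : 0 <= C by exact: quadratic_cst_ge0 hq.
pose B := C * r ^+ 4.
have B0 : 0 <= B by rewrite mulr_ge0// exprn_ge0// ltW.
exists (maxn (maxn N1 1) (maxn (Num.truncn (expR T)).+1 (Num.truncn (B / (e / (4 * H)))).+1)).
move=> n; rewrite !geq_max => /andP[/andP[n1 n2] /andP[n3 n4]].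
have n0 : 0 < n%:R :> R by rewrite ltr0n.
have Tn : T <= ln n%:R.
  rewrite -ler_expR lnK ?posrE//; apply: (le_trans (ltW (truncnS_gt _))).
  by rewrite ler_nat.
have := hT _ Tn; rewrite /wavg expRN lnK ?posrE//.
set S := \sum_(v <- _) _; have := h1 _ n1; rewrite -/S.
set w := wsum _ _ _ _ => k1.
have := wlim_near hA hp hp1 (3 * n) hq n0; rewrite -/w.
set z := wlim _ _ _ => k2 k3.
have k4 : `|z - w| <= e / (4 * H) * n%:R.
  apply: (le_trans k2); rewrite -mulrA -/r.
  have -> : C * (n%:R ^+ 2 * (rho ^+ (3 * n) * r)) = C * r * (n%:R ^+ 2 * rho ^+ (3 * n)).
    by ring.
  have h := geom_decay3 n coincidence01; rewrite -/r in h.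
  apply: (@le_trans _ _ (C * r * (r ^+ 3 / n.+1%:R))).
    by rewrite ler_wpM2l// mulr_ge0// ltW.
  have -> : C * r * (r ^+ 3 / n.+1%:R) = B / n.+1%:R by rewrite /B; ring.
  apply: (@le_trans _ _ B).
    by rewrite ler_piMr// invf_le1 ?ltr0n// ler1n.
  rewrite mulrC -ler_pdivrMr//; apply: (le_trans (ltW (truncnS_gt _))).
  by rewrite ler_nat.
have -> : entropy p * S - psi p f (ln n%:R) * n%:R =
  entropy p * ((S - w) - (z - w)) + (entropy p * (n%:R^-1 * z) - psi p f (ln n%:R)) * n%:R.
  by field; rewrite gt_eqF.
apply: (le_trans (ler_normD _ _)).
have -> : e * n%:R = H * (2 * (e / (4 * H) * n%:R)) + e / 2 * n%:R by field; rewrite gt_eqF.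
apply: lerD; last by rewrite normrM (ger0_norm (ltW n0)) ler_pM2r.
rewrite normrM; apply: ler_pM => //.
by apply: (le_trans (ler_normB _ _)); lra.
Qed.

(** Eventually [psi] is close to the bounded function [entropy p * wavg p f]. The bound is needed to
    control a quotient with numerator [psi]. *)
Lemma psi_bounded f G l : admissible f G l -> exists M (T : R), forall t, T <= t ->
  `|psi p f t| <= M.
Proof.
move=> hadm; have [T hT] := psi_limit hA hp hp1 hadm ltr01.
have [C [df [_ hf _ _ _]]] := hadm.
exists (`|entropy p| * (C / c0) + 1), T => t /hT h.
have -> : psi p f t = entropy p * wavg p f t - (entropy p * wavg p f t - psi p f t) by ring.
apply: (le_trans (ler_normB _ _)); apply: lerD => //.
rewrite normrM ler_wpM2l//; apply: (wavg_bound hA hp hp1) => y y0.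
by have /andP[h1 h2] := hf y y0; rewrite ger0_norm.
Qed.

End MeanAsymptotics.

(** * Concentration in product spaces *)

Section ProductSpace.
Variables (R : realType) (B : finType) (w : B -> R) (n : nat).
Hypothesis w0 : forall b, 0 <= w b.
Hypothesis w1 : \sum_b w b = 1.
Local Notation S := {ffun 'I_n -> B}.

Definition pr (h : pred B) : R := \sum_b w b * (h b)%:R.

Definition Ex (f : S -> R) : R := \sum_(x : S) (\prod_i w (x i)) * f x.

Definition Pr (e : pred S) : R := Ex (fun x => (e x)%:R).

Lemma prodw_ge0 (x : S) : 0 <= \prod_i w (x i).
Proof. exact: prodr_ge0. Qed.

Lemma ler_Ex f g : (forall x, f x <= g x) -> Ex f <= Ex g.
Proof. by move=> h; apply: ler_sum => x _; rewrite ler_wpM2l// prodw_ge0. Qed.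

Lemma Ex_sum (I : Type) (r : seq I) (P : pred I) (F : I -> S -> R) :
  Ex (fun x => \sum_(i <- r | P i) F i x) = \sum_(i <- r | P i) Ex (F i).
Proof.
by rewrite /Ex exchange_big/=; apply: eq_bigr => x _; rewrite mulr_sumr.
Qed.

Lemma ExZ c f : Ex (fun x => c * f x) = c * Ex f.
Proof. by rewrite /Ex mulr_sumr; apply: eq_bigr => x _; rewrite mulrCA. Qed.

Lemma ExD f g : Ex (fun x => f x + g x) = Ex f + Ex g.
Proof. by rewrite /Ex -big_split/=; apply: eq_bigr => x _; rewrite mulrDr. Qed.

Lemma Ex_prod (h : 'I_n -> B -> R) :
  Ex (fun x => \prod_i h i (x i)) = \prod_i \sum_b w b * h i b.
Proof.
by rewrite bigA_distr_bigA; apply: eq_bigr => x _; rewrite big_split.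
Qed.

Lemma Ex_cst c : Ex (fun=> c) = c.
Proof.
have e : Ex (fun=> 1) = 1.
  have := Ex_prod (fun _ _ => 1); rewrite big1_eq => ->.
  by rewrite big1// => i _; under eq_bigr do rewrite mulr1.
have -> : (fun=> c) = (fun x : S => c * 1) by apply/funext => x; rewrite mulr1.
by rewrite ExZ e mulr1.
Qed.

Lemma Pr_le1 e : Pr e <= 1.
Proof. by rewrite -(Ex_cst 1); apply: ler_Ex => x; case: (e x); rewrite ?lexx ?ler01. Qed.

Lemma Pr_ge0 e : 0 <= Pr e.
Proof. by rewrite -(Ex_cst 0); apply: ler_Ex => x. Qed.

Lemma Pr_sub (e f : pred S) : (forall x, e x -> f x) -> Pr e <= Pr f.
Proof.
by move=> h; apply: ler_Ex => x; case: (boolP (e x)) => [/h->|]//.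
Qed.

Lemma eq_Pr (e f : pred S) : e =1 f -> Pr e = Pr f.
Proof. by move=> h; rewrite /Pr; congr Ex; apply/funext => x; rewrite h. Qed.

Lemma Pr_predC e : Pr (predC e) = 1 - Pr e.
Proof.
apply/eqP; rewrite eq_sym subr_eq -ExD -{1}(Ex_cst 1); apply/eqP; congr Ex.
by apply/funext => x /=; case: (e x); rewrite ?addr0 ?add0r.
Qed.

Lemma pr_ge0 h : 0 <= pr h.
Proof. by apply: sumr_ge0 => b _; rewrite mulr_ge0. Qed.

Lemma pr_predC h : pr (predC h) = 1 - pr h.
Proof.
rewrite -w1 /pr -sumrB; apply: eq_bigr => b _ /=.
by case: (h b); rewrite /= ?mulr1 ?mulr0 ?subrr ?subr0.
Qed.

Lemma prU (h h' : pred B) : (forall b, ~~ (h b && h' b)) ->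
  pr (fun b => ~~ h b && ~~ h' b) = 1 - pr h - pr h'.
Proof.
move=> d; rewrite -w1 /pr -!sumrB; apply: eq_bigr => b _; have := d b.
by case: (h b); case: (h' b) => //= _; rewrite ?mulr1 ?mulr0 ?subr0 ?subrr.
Qed.

Section Pattern.
Variables (J : finType) (h : J -> pred B) (av : pred B).

Definition fits (x : S) (s : {ffun J -> 'I_n}) : bool :=
  [forall j, h j (x (s j))] && [forall i, (i \notin codom s) ==> av (x i)].

(** The demands [h j] are met at distinct coordinates and every other coordinate satisfies [av]. Hit
    counts and fringe events are both of this form. *)
Definition occ (x : S) : bool :=
  [exists s : {ffun J -> 'I_n}, injectiveb s && fits x s].

(** For a fixed placement [s] this rewrites [fits] as a conjunction of one condition per coordinate,
    so that its probability factorizes. *)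
Let g (s : {ffun J -> 'I_n}) (i : 'I_n) : pred B :=
  if [pick j | s j == i] is Some j then h j else av.

Lemma g_image (s : {ffun J -> 'I_n}) j : injective s -> g s (s j) = h j.
Proof.
move=> si; rewrite /g; case: pickP => [j' /eqP/si->//|/(_ j)]; by rewrite eqxx.
Qed.

Lemma g_out (s : {ffun J -> 'I_n}) i : i \notin codom s -> g s i = av.
Proof.
move=> hi; rewrite /g; case: pickP => // j /eqP e.
by move: hi; rewrite -e codom_f.
Qed.

Lemma fitsE x (s : {ffun J -> 'I_n}) : injective s ->
  (fits x s)%:R = \prod_i (g s i (x i))%:R :> R.
Proof.
move=> si; have -> : fits x s = [forall i, g s i (x i)].
  apply/andP/forallP => [[/forallP h1 /forallP h2] i|hg]; last first.
    split; apply/forallP; first by move=> j; have := hg (s j); rewrite g_image.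
    by move=> i; apply/implyP => hi; have := hg i; rewrite g_out.
  have [/codomP[j ->]|hi] := boolP (i \in codom s); first by rewrite g_image.
  by rewrite g_out//; have := h2 i; rewrite hi.
case: (boolP [forall i, _]) => [/forallP hg|]; first by rewrite big1// => i _; rewrite hg.
rewrite negb_forall => /existsP[i hi].
by rewrite (bigD1 i)//= (negbTE hi) mul0r.
Qed.

Lemma Ex_fits (s : {ffun J -> 'I_n}) : injective s ->
  Ex (fun x => (fits x s)%:R) = (\prod_j pr (h j)) * pr av ^+ (n - #|J|).
Proof.
move=> si; rewrite (_ : (fun x => _) = fun x : S => \prod_i (g s i (x i))%:R); last first.
  by apply/funext => x; exact: fitsE.
rewrite (Ex_prod (fun i b => (g s i b)%:R)) (bigID (mem (codom s)))/=; congr (_ * _).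
  rewrite (eq_bigl (fun i => i \in s @: J)); last first.
    by move=> i; apply/codomP/imsetP => [[j ->]|[j _ ->]]; exists j.
  rewrite big_imset/=; last by move=> ? ? _ _; exact: si.
  by apply: eq_bigr => j _; rewrite g_image.
rewrite (eq_bigr (fun=> pr av)); last by move=> i hi; rewrite g_out.
rewrite prodr_const; congr (_ ^+ _).
have := cardC (mem (codom s)); rewrite card_ord.
have -> : #|mem (codom s)| = #|J| by rewrite -(card_codom si); apply: eq_card.
move=> e; have -> : #|(fun i => i \notin codom s)| = #|[predC mem (codom s)]|.
  by apply: eq_card.
by apply/eqP; rewrite -(eqn_add2l #|J|) e subnKC// -e leq_addr.
Qed.

Lemma sum_fits :
  \sum_(s : {ffun J -> 'I_n} | injectiveb s) Ex (fun x => (fits x s)%:R) =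
  (n ^_ #|J|)%:R * (\prod_j pr (h j)) * pr av ^+ (n - #|J|).
Proof.
transitivity (\sum_(s in [set s : {ffun J -> 'I_n} | injectiveb s]%SET)
    (\prod_j pr (h j)) * pr av ^+ (n - #|J|)).
  apply: eq_big => [s|s /injectiveP si]; first by rewrite inE.
  exact: Ex_fits.
rewrite sumr_const -[LHS]mulr_natl mulrA; congr (_%:R * _ * _).
by rewrite card_inj_ffuns card_ord.
Qed.

Lemma Pr_occ_le :
  Pr occ <= (n ^_ #|J|)%:R * (\prod_j pr (h j)) * pr av ^+ (n - #|J|).
Proof.
rewrite -sum_fits -Ex_sum; apply: ler_Ex => x.
have [/existsP[s /andP[si hs]]|_] := boolP (occ x); last exact: sumr_ge0.
by rewrite (bigD1 s)//= hs lerDl sumr_ge0.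
Qed.

(** Under these disjointness conditions [x] determines the placement, so the union bound of
    [Pr_occ_le] becomes an equality. *)
Lemma Pr_occ : (forall j b, h j b -> ~~ av b) ->
  (forall j j' b, h j b -> h j' b -> j = j') ->
  Pr occ = (n ^_ #|J|)%:R * (\prod_j pr (h j)) * pr av ^+ (n - #|J|).
Proof.
move=> hav hinj; rewrite -sum_fits -Ex_sum; congr Ex; apply/funext => x.
have [/existsP[s /andP[si hs]]|hn] := boolP (occ x); last first.
  rewrite big1// => s si; case: (boolP (fits x s)) => // hs.
  by case/negP: hn; apply/existsP; exists s; rewrite si.
rewrite (bigD1 s)//= hs big1 ?addr0// => s' /andP[si' ne].
case: (boolP (fits x s')) => // hs'; case/negP: ne.
move: hs hs' => /andP[/forallP h1 /forallP h2] /andP[/forallP h1' /forallP h2'].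
apply/eqP/ffunP => j.
have /codomP[j' e] : s' j \in codom s.
  apply: contraTT (h1' j) => /(implyP (h2 _)) ha.
  by apply/negP => /hav; rewrite ha.
by rewrite e (hinj _ _ _ (h1' j) (_ : h j' _))// e.
Qed.

End Pattern.

(** Two patterns with incompatible demands use different coordinates, hence form one pattern on the
    disjoint sum, to which [Pr_occ_le] applies. *)
Lemma occ_sum (J J' : finType) (h : J -> pred B) (h' : J' -> pred B) av av' x :
  (forall j j' b, ~~ (h j b && h' j' b)) -> occ h av x -> occ h' av' x ->
  occ (fun u : J + J' => match u with inl j => h j | inr j => h' j end)
    (fun b => av b && av' b) x.
Proof.
move=> d /existsP[s /andP[/injectiveP si /andP[/forallP s1 /forallP s2]]].
move=> /existsP[s' /andP[/injectiveP si' /andP[/forallP s1' /forallP s2']]].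
apply/existsP; exists [ffun u => match u with inl j => s j | inr j => s' j end].
apply/andP; split.
  apply/injectiveP => -[j|j] [k|k]; rewrite !ffunE => e.
  - by rewrite (si _ _ e).
  - by have := d j k (x (s j)); rewrite s1 {1}e s1'.
  - by have := d k j (x (s k)); rewrite s1 -e s1'.
  - by rewrite (si' _ _ e).
apply/andP; split; apply/forallP.
  by case=> j; rewrite ffunE.
move=> i; apply/implyP => hi; rewrite (implyP (s2 i)) ?(implyP (s2' i))//.
- apply: contra hi => /codomP[j ->]; apply/codomP; exists (inr j); by rewrite ffunE.
- apply: contra hi => /codomP[j ->]; apply/codomP; exists (inl j); by rewrite ffunE.
Qed.

Definition hits (h : pred B) (x : S) : nat := #|[set i | h (x i)]%SET|.

Lemma hits_occ (h : pred B) k x : (hits h x == k) ->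
  occ (fun _ : 'I_k => h) (predC h) x.
Proof.
move=> /eqP e; apply/existsP.
exists [ffun j => enum_val (cast_ord (esym e) j)]; apply/andP; split.
  by apply/injectiveP => j j'; rewrite !ffunE => /enum_val_inj/cast_ord_inj.
apply/andP; split; apply/forallP.
  by move=> j; rewrite ffunE; have := enum_valP (cast_ord (esym e) j); rewrite inE.
move=> i; apply/implyP => hi /=; apply: contra hi => hi.
have hi' : i \in [set i | h (x i)]%SET by rewrite inE.
apply/codomP; exists (cast_ord e (enum_rank_in hi' i)).
by rewrite ffunE cast_ordK enum_rankK_in.
Qed.

Lemma occ_hits (J : finType) (h : J -> pred B) (g : pred B) x :
  (forall j b, h j b -> g b) -> occ h (predC g) x -> hits g x = #|J|.
Proof.
move=> hg /existsP[s /andP[/injectiveP si /andP[/forallP s1 /forallP s2]]].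
rewrite /hits -(card_codom si); apply: eq_card => i; rewrite inE.
apply/idP/codomP => [hi|[j ->]]; last exact: hg (s1 j).
apply/codomP; apply: contraTT hi => /(implyP (s2 i)); by [].
Qed.

Lemma hits_occE (h : pred B) k x :
  (hits h x == k) = occ (fun _ : 'I_k => h) (predC h) x.
Proof.
apply/idP/idP => [/hits_occ//|/occ_hits ->//].
by rewrite card_ord.
Qed.

Definition many_hits (h : pred B) (x : S) : bool := (2 <= hits h x)%N.

Lemma many_hitsE h x : many_hits h x = ~~ ((hits h x == 0) || (hits h x == 1))%N.
Proof. by rewrite /many_hits; case: (hits h x) => [|[|m]]. Qed.

Lemma Pr_many_hits h : Pr (many_hits h) = bin_many n (pr h).
Proof.
rewrite (eq_Pr (f := predC (fun x => (hits h x == 0) || (hits h x == 1)%N))); last first.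
  by move=> x; rewrite many_hitsE.
rewrite Pr_predC /bin_many -addrA -opprD; congr (1 - _).
transitivity (Pr (fun x => hits h x == 0%N) + Pr (fun x => hits h x == 1%N)).
  rewrite -ExD; congr Ex; apply/funext => x.
  by case: eqP => [->|_]; rewrite ?addr0 ?add0r//.
rewrite (eq_Pr (hits_occE h 0)) (eq_Pr (hits_occE h 1)).
have hav k : forall (j : 'I_k) b, h b -> ~~ predC h b by move=> j b /= ->.
rewrite (Pr_occ (hav 0%N)); last by case.
rewrite (Pr_occ (hav 1%N)); last by move=> j j' b _ _; rewrite !ord1.
rewrite !card_ord ffactn0 ffactn1 pr_predC big_ord0 big_ord1 subn0 subn1.
by rewrite !mul1r.
Qed.

(** Negative correlation of two multinomial counts. It is equivalent to the same inequality for the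
    complements, at most one hit each, and these split into four patterns of explicit
    probability. *)
Lemma Pr_many_hits2 (h h' : pred B) : (forall b, ~~ (h b && h' b)) ->
  Pr (fun x => many_hits h x && many_hits h' x) <=
  Pr (many_hits h) * Pr (many_hits h').
Proof.
move=> d; set a := pr h; set b := pr h'.
have hc : pr (fun b => predC h b && predC h' b) = 1 - a - b by exact: prU.
have c0 : 0 <= 1 - a - b by rewrite -hc; exact: pr_ge0.
have a0 : 0 <= a by exact: pr_ge0.
have b0 : 0 <= b by exact: pr_ge0.
pose le1 h (x : S) := ~~ many_hits h x.
have eqL g : Pr (le1 g) = 1 - Pr (many_hits g) by rewrite -Pr_predC; apply: eq_Pr.
suff key : Pr (fun x => le1 h x && le1 h' x) <= Pr (le1 h) * Pr (le1 h').
  have -> : Pr (fun x => many_hits h x && many_hits h' x) =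
     1 - Pr (le1 h) - Pr (le1 h') + Pr (fun x => le1 h x && le1 h' x).
    apply/eqP; rewrite -subr_eq0; apply/eqP.
    have -> : forall u v y z : R, u - (1 - v - y + z) = u + v + y + (-1) * z - 1.
      by move=> *; ring.
    rewrite -[in Pr _ + _]ExD -ExZ -!ExD -[X in _ - X](Ex_cst 1).
    rewrite -[X in _ - X]mul1r -mulNr -ExZ -ExD -[RHS](Ex_cst 0); congr Ex.
    apply/funext => x; rewrite /le1.
    by case: (many_hits h x); case: (many_hits h' x) => /=; ring.
  by move: key; rewrite !eqL; lra.
have e1 g : Pr (le1 g) = (1 - pr g) ^+ n + n%:R * pr g * (1 - pr g) ^+ n.-1.
  by rewrite eqL Pr_many_hits /bin_many; ring.
rewrite !e1 -/a -/b.
pose ev k k' (x : S) := occ (fun u : 'I_k + 'I_k' => match u with inl _ => h | inr _ => h' end)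
    (fun b => predC h b && predC h' b) x.
have evP k k' : Pr (ev k k') <= (n ^_ (k + k'))%:R * (a ^+ k * b ^+ k') * (1 - a - b) ^+ (n - (k + k')).
  rewrite /ev; apply: (le_trans (Pr_occ_le _ _)); rewrite hc card_sum !card_ord.
  by rewrite big_sumType/= !prodr_const !card_ord.
apply: (@le_trans _ _ (Pr (ev 0 0)%N + Pr (ev 1 0)%N + Pr (ev 0 1)%N + Pr (ev 1 1)%N)).
  rewrite -!ExD; apply: ler_Ex => x.
  case: (boolP (le1 h x && le1 h' x)) => [|_]; last by rewrite !addr_ge0.
  have pos (u v y z : bool) : u || v || y || z -> 1 <= u%:R + v%:R + y%:R + z%:R :> R.
    by case: u; case: v; case: y; case: z => //= _; lra.
  move=> /andP[]; rewrite /le1 !many_hitsE !negbK => /orP[/hits_occ h1|/hits_occ h1] /orP[/hits_occ h2|/hits_occ h2];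
    apply: pos; apply/orP.
  - by left; apply/orP; left; apply/orP; left; apply: occ_sum h1 h2 => j.
  - by left; apply/orP; right; apply: occ_sum h1 h2 => j.
  - by left; apply/orP; left; apply/orP; right; apply: occ_sum h1 h2 => j.
  - by right; apply: occ_sum h1 h2 => j.
apply: (le_trans (lerD (lerD (lerD (evP 0 0) (evP 1 0)) (evP 0 1)) (evP 1 1))%N).
rewrite !addn0 !add0n !expr0 !expr1 ffactn0 ffactn1 !mul1r !mulr1 subn0.
set c := 1 - a - b in c0 *.
have ab : (1 - a) * (1 - b) = c + a * b by rewrite /c; ring.
case: (n) => [|m].
  by rewrite !expr0 /= !mul0r !addr0 mul1r.
have -> : (m.+1 ^_ (1 + 1))%:R = m.+1%:R * m%:R :> R.
  by rewrite add1n ffactnS ffactn1 natrM.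
rewrite subn1 /= (_ : m.+1 - (1 + 1) = m.-1)%N; last by lia.
have -> : ((1 - a) ^+ m.+1 + m.+1%:R * a * (1 - a) ^+ m) *
   ((1 - b) ^+ m.+1 + m.+1%:R * b * (1 - b) ^+ m) =
   (c + a * b) ^+ m * ((1 + m%:R * a) * (1 + m%:R * b)).
  by rewrite -ab exprMn !exprS -!natr1; ring.
have ab0 : 0 <= a * b by exact: mulr_ge0.
have m0 : 0 <= m%:R :> R by [].
(* The first two terms of the binomial expansion suffice. *)
have bin : c ^+ m + m%:R * c ^+ m.-1 * (a * b) <= (c + a * b) ^+ m.
  elim: (m) => [|l IH]; first by rewrite !expr0 mul0r mul0r addr0.
  apply: (@le_trans _ _ ((c + a * b) * (c ^+ l + l%:R * c ^+ l.-1 * (a * b)))).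
    have e : l%:R * c ^+ l = l%:R * c * c ^+ l.-1 by case: (l) => [|l'] /=; rewrite ?mul0r// exprS mulrA.
    have -> : (c + a * b) * (c ^+ l + l%:R * c ^+ l.-1 * (a * b)) =
      c ^+ l.+1 + (l%:R * c * c ^+ l.-1 + c ^+ l) * (a * b) + l%:R * c ^+ l.-1 * (a * b) ^+ 2.
      by rewrite exprS; ring.
    rewrite -e -natr1 /= -[X in X <= _]addr0; apply: lerD; last first.
      by rewrite mulr_ge0 ?sqr_ge0// mulr_ge0// exprn_ge0.
    by rewrite le_eqVlt; apply/orP; left; apply/eqP; rewrite !exprS; ring.
  by rewrite [leRHS]exprS ler_wpM2l// addr_ge0.
set q := c ^+ m.-1.
have q0 : 0 <= q by rewrite exprn_ge0.
have mq : m%:R * c ^+ m = m%:R * (c * q).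
  by rewrite /q; case: (m) => [|m'] /=; rewrite ?mul0r// exprS.
have f0 : 0 <= (1 + m%:R * a) * (1 + m%:R * b).
  by rewrite mulr_ge0// addr_ge0// mulr_ge0.
apply: le_trans (ler_wpM2r f0 bin).
rewrite exprS -subr_ge0 -/q.
(* The difference is sorted into terms that vanish by [mq] or by [c + a + b = 1], and one
   nonnegative term. *)
have -> : (c ^+ m + m%:R * q * (a * b)) * ((1 + m%:R * a) * (1 + m%:R * b)) -
  (c * c ^+ m + m.+1%:R * a * c ^+ m + m.+1%:R * b * c ^+ m + m.+1%:R * m%:R * (a * b) * q)
  = (1 - c - a - b) * c ^+ m + (m%:R * c ^+ m - m%:R * (c * q)) * (m%:R * (a * b))
    + m%:R * q * (a * b) * m%:R * (c + a + b - 1) + m%:R * q * (a * b) * (m%:R * m%:R * (a * b)).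
  by rewrite -natr1; ring.
rewrite mq subrr mul0r addr0.
have -> : 1 - c - a - b = 0 by rewrite /c; ring.
have -> : c + a + b - 1 = 0 by rewrite /c; ring.
by rewrite mul0r mulr0 !add0r; apply: mulr_ge0; [apply: mulr_ge0 => //; exact: mulr_ge0|
  apply: mulr_ge0 => //; exact: mulr_ge0].
Qed.

End ProductSpace.

(** * Prefixes of infinite strings *)

Section InfiniteStrings.
Variable A : finType.
Implicit Types (y : nat -> A) (u v w : seq A).

Definition starts y v : bool := mkseq y (size v) == v.

Lemma starts_nil y : starts y [::].
Proof. by rewrite /starts. Qed.

Lemma startsP a0 y v : reflect (forall i, (i < size v)%N -> y i = nth a0 v i) (starts y v).
Proof.
apply: (iffP eqP) => [e i iv|h]; first by rewrite -[in RHS]e nth_mkseq.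
apply: (@eq_from_nth _ a0); rewrite size_mkseq// => i iv.
by rewrite nth_mkseq// h.
Qed.

Lemma starts_prefix y u v : prefix u v -> starts y v -> starts y u.
Proof.
move=> /prefixP[w ->] /(startsP (y 0)) h; apply/(startsP (y 0)) => i iu.
by rewrite h ?size_cat ?ltn_addr// nth_cat iu.
Qed.

Lemma starts_cat y u v : starts y (u ++ v) -> starts y u.
Proof. by apply: starts_prefix; exact: prefix_prefix. Qed.

Lemma starts_mkseq y m : starts y (mkseq y m).
Proof. by rewrite /starts size_mkseq. Qed.

Lemma prefix_mkseq y v m : starts y v -> (size v <= m)%N -> prefix v (mkseq y m).
Proof.
move=> h vm; rewrite prefixE /mkseq -map_take take_iota (minn_idPl vm).
exact: h.
Qed.

Lemma starts_comparable y u v : starts y u -> starts y v -> prefix u v || prefix v u.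
Proof.
move=> hu hv; have [uv|vu] := leqP (size u) (size v).
  by rewrite -[X in prefix u X](eqP hv) prefix_mkseq.
by apply/orP; right; rewrite -[X in prefix v X](eqP hu) prefix_mkseq// ltnW.
Qed.

Lemma starts_rcons y v a : starts y (rcons v a) = starts y v && (y (size v) == a).
Proof. by rewrite /starts size_rcons mkseqS eqseq_rcons. Qed.

Lemma count_prefix w (s : seq (seq A)) : uniq s ->
  (count (fun v => prefix v w) s <= (size w).+1)%N.
Proof.
move=> us; rewrite -(size_iota 0 (size w).+1) -(size_map (fun i => take i w)).
rewrite -size_filter; apply: uniq_leq_size; first exact: filter_uniq.
move=> v; rewrite mem_filter => /andP[/prefixP[u ->] _].
apply/mapP; exists (size v); first by rewrite mem_iota leq0n add0n size_cat ltnS leq_addr.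
by rewrite take_size_cat.
Qed.

End InfiniteStrings.

(** * Tails of sums of squared weights *)

Section TailSum.
Variables (R : realType) (A : finType) (p : A -> R).
Hypothesis hA : (2 <= #|A|)%N.
Hypothesis hp : forall a, 0 < p a.
Hypothesis hp1 : \sum_(a : A) p a = 1.
Local Notation rho := (coincidence p).

Lemma sum_wt2_ge L m :
  \sum_(v <- words A L | (m <= size v)%N) wt p v ^+ 2 <= rho ^+ m / (1 - rho).
Proof.
have [mL|Lm] := leqP m L.
  by rewrite -(subnKC mL) (sum_geo hA hp hp1).
rewrite big_seq_cond big1.
  have /andP[r0 r1] := coincidence01 hA hp hp1.
  by rewrite divr_ge0 ?exprn_ge0// subr_ge0 ltW.
move=> v /andP[]; rewrite mem_words => h1 h2.
by have := leq_ltn_trans h2 (ltn_trans h1 Lm); rewrite ltnn.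
Qed.

Definition depth_tail (D : nat) : R := (D%:R + (1 - rho)^-1) * rho ^+ D / (1 - rho).

(** The factor [size v + 1] is written as a sum of ones over [i <= size v] and the sums are
    exchanged. The indices [i < D] all give the tail from [D], the others a geometric series. *)
Lemma sum_depth_wt2 L D :
  \sum_(v <- words A L | (D <= size v)%N) (size v).+1%:R * wt p v ^+ 2 <= depth_tail D.
Proof.
have /andP[r0 r1] := coincidence01 hA hp hp1.
apply: (@le_trans _ _ (\sum_(i < D + L) rho ^+ (maxn D i) / (1 - rho))); last first.
  rewrite -mulr_suml /depth_tail ler_pM2r ?invr_gt0 ?subr_gt0//.
  rewrite big_split_ord/= mulrDl; apply: lerD.
    rewrite (eq_bigr (fun=> rho ^+ D)); last first.
      by move=> i _; rewrite (maxn_idPl _)// ltnW.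
    by rewrite sumr_const card_ord mulr_natl.
  rewrite (eq_bigr (fun i : 'I_L => rho ^+ D * rho ^+ i)); last first.
    by move=> i _; rewrite (maxn_idPr _) ?leq_addr// exprD.
  rewrite -mulr_sumr mulrC ler_wpM2r ?exprn_ge0//; apply: sum_geometric.
  by rewrite r0.
apply: (@le_trans _ _ (\sum_(i < D + L) \sum_(v <- words A L | (maxn D i <= size v)%N) wt p v ^+ 2)).
  under [leRHS]eq_bigr do rewrite big_mkcond/=.
  rewrite exchange_big/= big_mkcond/= big_seq [leRHS]big_seq; apply: ler_sum => v.
  rewrite mem_words => vL; case: ifPn => Dv; last first.
    by apply: sumr_ge0 => i _; case: ifP => // _; rewrite sqr_ge0.
  have -> : (size v).+1%:R * wt p v ^+ 2 = \sum_(i < (size v).+1) wt p v ^+ 2.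
    by rewrite sumr_const card_ord mulr_natl.
  have h : ((size v).+1 <= D + L)%N by rewrite (leq_trans vL)// leq_addl.
  rewrite (big_ord_widen _ (fun=> wt p v ^+ 2) h) big_mkcond/=; apply: ler_sum => i _.
  by rewrite geq_max Dv/= ltnS.
by apply: ler_sum => i _; exact: sum_wt2_ge.
Qed.

Lemma depth_tail_small e : 0 < e -> exists D, depth_tail D <= e.
Proof.
move=> e0; have r01 := coincidence01 hA hp hp1; have /andP[r0 r1] := r01.
set c := (1 - rho)^-1; have c0 : 0 < c by rewrite invr_gt0 subr_gt0.
pose B := (3 + c) * c ^+ 4.
have B0 : 0 < B by rewrite mulr_gt0 ?exprn_gt0 ?addr_gt0.
(* A multiple of 3, in order to reuse [geom_decay3]. *)
exists (3 * (Num.truncn (B / e)).+1)%N.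
set m := (Num.truncn _).+1.
have hm : B / e <= m%:R by apply: ltW; exact: truncnS_gt.
have m1 : 1 <= m%:R :> R by rewrite ler1n.
have := geom_decay3 m r01; rewrite -/c => h.
have q0 : 0 <= rho ^+ (3 * m) by rewrite exprn_ge0.
apply: (@le_trans _ _ ((3 + c) * (m%:R ^+ 2 * rho ^+ (3 * m)) * c)).
  rewrite /depth_tail -/c ler_pM2r// natrM [leRHS]mulrA ler_wpM2r//.
  have : 0 <= c * (m%:R ^+ 2 - 1) by rewrite mulr_ge0 ?(ltW c0)//; nra.
  have : m%:R <= m%:R ^+ 2 :> R by nra.
  nra.
apply: (@le_trans _ _ ((3 + c) * (c ^+ 3 / m.+1%:R) * c)).
  by rewrite ler_pM2r// ler_pM2l// addr_gt0.
have -> : (3 + c) * (c ^+ 3 / m.+1%:R) * c = B / m.+1%:R by rewrite /B; ring.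
rewrite ler_pdivrMr// mulrC -ler_pdivrMr//; apply: (le_trans hm).
by rewrite ler_nat.
Qed.

End TailSum.

(** * Variance of sums of indicators over words *)

Section SecondMoment.
Variables (R : realType) (A : finType) (p : A -> R).
Hypothesis hA : (2 <= #|A|)%N.
Hypothesis hp : forall a, 0 < p a.
Hypothesis hp1 : \sum_(a : A) p a = 1.
Variables (B : finType) (w : B -> R) (n : nat).
Hypothesis w0 : forall b, 0 <= w b.
Hypothesis w1 : \sum_b w b = 1.
Local Notation S := {ffun 'I_n -> B}.
Local Notation Pr := (@Pr R B w n).
Local Notation Ex := (@Ex R B w n).
Variables (L : nat) (Y : seq A -> pred S).
Local Notation ws := (words A L).

Definition total (x : S) : R := \sum_(v <- ws) (Y v x)%:R.
Definition mean : R := \sum_(v <- ws) Pr (Y v).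

Lemma chebyshev_finite (f : S -> R) (m t : R) : 0 < t ->
  Pr (fun x => t <= `|f x - m|) * t ^+ 2 <= Ex (fun x => (f x - m) ^+ 2).
Proof.
move=> t0; rewrite mulrC -ExZ; apply: ler_Ex => // x.
have [h|_] := boolP (t <= _); last by rewrite mulr0 sqr_ge0.
by rewrite mulr1 -[leRHS]real_normK ?num_real// lerXn2r ?nnegrE// ltW.
Qed.

(* Only words of length at least [M], neither of which is a prefix of the other,
   are nearly uncorrelated; the two other terms count the remaining pairs. *)
Lemma second_moment kap M : 0 <= kap ->
  (forall u v, u \in ws -> v \in ws -> (M <= size u)%N -> (M <= size v)%N ->
     ~~ prefix u v -> ~~ prefix v u ->
     Pr (fun x => Y u x && Y v x) <= (1 + kap) * (Pr (Y u) * Pr (Y v))) ->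
  Ex (fun x => (total x - mean) ^+ 2) <= kap * mean ^+ 2 +
    2 * (size (words A M))%:R * mean + 2 * \sum_(v <- ws) (size v).+1%:R * Pr (Y v).
Proof.
move=> k0 hpair.
have P0 v : 0 <= Pr (Y v) by exact: Pr_ge0.
have eT : Ex total = mean by rewrite /total Ex_sum.
have eT2 : Ex (fun x => total x ^+ 2) =
    \sum_(u <- ws) \sum_(v <- ws) Pr (fun x => Y u x && Y v x).
  rewrite (_ : (fun x => _) = fun x => \sum_(u <- ws) \sum_(v <- ws) (Y u x && Y v x)%:R).
    by rewrite Ex_sum; apply: eq_bigr => u _; rewrite Ex_sum.
  apply/funext => x; rewrite expr2 /total mulr_suml; apply: eq_bigr => u _.
  by rewrite mulr_sumr; apply: eq_bigr => v _; rewrite -natrM mulnb.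
have -> : Ex (fun x => (total x - mean) ^+ 2) = Ex (fun x => total x ^+ 2) - mean ^+ 2.
  have -> : (fun x => (total x - mean) ^+ 2) =
     fun x => total x ^+ 2 + ((- (2 * mean)) * total x + mean ^+ 2).
    by apply/funext => x; ring.
  by rewrite !ExD ExZ eT (Ex_cst _ w1); ring.
rewrite eT2 lerBlDr.
have pairb u v : u \in ws -> v \in ws -> Pr (fun x => Y u x && Y v x) <=
    (1 + kap) * (Pr (Y u) * Pr (Y v)) + (size u < M)%N%:R * Pr (Y v) +
    (size v < M)%N%:R * Pr (Y u) + (prefix u v)%:R * Pr (Y v) + (prefix v u)%:R * Pr (Y u).
  move=> uw vw.
  have t1 : 0 <= (1 + kap) * (Pr (Y u) * Pr (Y v)).
    by rewrite mulr_ge0 ?addr_ge0// mulr_ge0.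
  have t2 : 0 <= (size u < M)%N%:R * Pr (Y v) by rewrite mulr_ge0.
  have t3 : 0 <= (size v < M)%N%:R * Pr (Y u) by rewrite mulr_ge0.
  have t4 : 0 <= (prefix u v)%:R * Pr (Y v) by rewrite mulr_ge0.
  have t5 : 0 <= (prefix v u)%:R * Pr (Y u) by rewrite mulr_ge0.
  have b1 : Pr (fun x => Y u x && Y v x) <= Pr (Y u) by apply: Pr_sub => // x /andP[].
  have b2 : Pr (fun x => Y u x && Y v x) <= Pr (Y v) by apply: Pr_sub => // x /andP[].
  have [h|h] := ltnP (size u) M; first by rewrite h /= in t2 *; lra.
  have [h'|h'] := ltnP (size v) M; first by rewrite h' /= in t3 *; lra.
  case: (boolP (prefix u v)) t4 => [_|g] t4; first by rewrite /= in t4 *; lra.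
  case: (boolP (prefix v u)) t5 => [_|g'] t5; first by rewrite /= in t5 *; lra.
  by have := hpair u v uw vw h h' g g'; lra.
have sum_count (Q : pred (seq A)) : \sum_(u <- ws) (Q u)%:R = (count Q ws)%:R :> R.
  elim: (words A L) => [|u s IH]; first by rewrite big_nil.
  by rewrite big_cons IH /= natrD.
have cnt : \sum_(u <- ws) (size u < M)%N%:R <= (size (words A M))%:R :> R.
  rewrite sum_count ler_nat -size_filter; apply: uniq_leq_size.
    by rewrite filter_uniq// words_uniq.
  by move=> v; rewrite mem_filter !mem_words => /andP[].
have cntp v : \sum_(u <- ws) (prefix u v)%:R <= (size v).+1%:R :> R.
  by rewrite sum_count ler_nat count_prefix// words_uniq.
have m0 : 0 <= mean by exact: sumr_ge0.
apply: (@le_trans _ _ ((1 + kap) * mean ^+ 2 + (size (words A M))%:R * mean +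
   (size (words A M))%:R * mean + \sum_(v <- ws) (size v).+1%:R * Pr (Y v) +
    \sum_(v <- ws) (size v).+1%:R * Pr (Y v))); last by lra.
apply: (@le_trans _ _ (\sum_(u <- ws) \sum_(v <- ws)
   ((1 + kap) * (Pr (Y u) * Pr (Y v)) + (size u < M)%N%:R * Pr (Y v) +
    (size v < M)%N%:R * Pr (Y u) + (prefix u v)%:R * Pr (Y v) + (prefix v u)%:R * Pr (Y u)))).
  by rewrite big_seq [leRHS]big_seq; apply: ler_sum => u uw;
     rewrite big_seq [leRHS]big_seq; apply: ler_sum => v vw; exact: pairb.
under eq_bigr do rewrite !big_split/=.
rewrite !big_split/=; apply: lerD; [apply: lerD; [apply: lerD; [apply: lerD|]|]|].
- rewrite le_eqVlt; apply/orP; left; apply/eqP.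
  rewrite expr2 {1}/mean mulr_suml mulr_sumr; apply: eq_bigr => u _.
  by rewrite /mean !mulr_sumr.
- under eq_bigr do rewrite -mulr_sumr.
  by rewrite -mulr_suml ler_wpM2r.
- rewrite exchange_big/=; under eq_bigr do rewrite -mulr_sumr.
  by rewrite -mulr_suml ler_wpM2r.
- rewrite exchange_big/=; apply: ler_sum => v _.
  by rewrite -mulr_suml ler_wpM2r.
- apply: ler_sum => u _.
  by rewrite -mulr_suml ler_wpM2r.
Qed.

Hypothesis n0 : (0 < n)%N.
Hypothesis hY : forall v, v \in ws -> Pr (Y v) <= (n%:R * wt p v) ^+ 2.

(** Each probability is at most [min (1, x^2)], hence at most [4 * bump x], for [x = n p_v]. *)
Lemma mean_le : mean <= 4 * n%:R / spread p.
Proof.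
have n0' : 0 < n%:R :> R by rewrite ltr0n.
apply: (@le_trans _ _ (4 * wsum p L (@bump R) n%:R)); last first.
  by rewrite -mulrA ler_wpM2l// (wsum_bump_le hA hp hp1).
rewrite /mean /wsum mulr_sumr big_seq [leRHS]big_seq; apply: ler_sum => v vw.
have x0 : 0 < n%:R * wt p v by rewrite mulr_gt0// wt_gt0.
have [x1|x1] := lerP (n%:R * wt p v) 1.
  apply: (le_trans (hY vw)).
  have /bump_ge : 0 <= n%:R * wt p v <= 1 by rewrite ltW.
  by rewrite (_ : (1 + 1) ^+ 2 = 4)//; ring.
by apply: le_trans (bump_ge4 (ltW x1)); exact: Pr_le1.
Qed.

(** For fixed [D] the first term is [O(n)], while the second is a multiple of [n ^+ 2] that is small
    for large [D]. This is what Chebyshev's inequality at scale [n] asks for. *)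
Lemma sum_depth_le D : \sum_(v <- ws) (size v).+1%:R * Pr (Y v) <=
  D%:R * mean + n%:R ^+ 2 * depth_tail p D.
Proof.
have P0 v : 0 <= Pr (Y v) by exact: Pr_ge0.
rewrite (bigID (fun v => (D <= size v)%N))/= addrC; apply: lerD.
  rewrite /mean mulr_sumr big_mkcond/=; apply: ler_sum => v _.
  case: ifPn => [|_]; last by rewrite mulr_ge0.
  by rewrite -ltnNge => h; rewrite ler_wpM2r// ler_nat.
apply: (@le_trans _ _ (n%:R ^+ 2 *
   \sum_(v <- ws | (D <= size v)%N) (size v).+1%:R * wt p v ^+ 2)); last first.
  by rewrite ler_wpM2l ?sqr_ge0// (sum_depth_wt2 hA hp hp1).
rewrite mulr_sumr big_seq_cond [leRHS]big_seq_cond; apply: ler_sum => v /andP[vw _].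
by rewrite mulrCA ler_wpM2l// -exprMn hY.
Qed.

End SecondMoment.

Section Concentration.
Variables (R : realType) (A : finType) (p : A -> R).
Hypothesis hA : (2 <= #|A|)%N.
Hypothesis hp : forall a, 0 < p a.
Hypothesis hp1 : \sum_(a : A) p a = 1.

(** The order of the quantifiers matters: [kap] depends on [e] and [d] only, then [M] may be chosen
    so that long words have correlation excess [kap], and only then comes [N]. *)
Theorem concentration (e d : R) : 0 < e -> 0 < d ->
  exists2 kap, 0 < kap & forall M, exists N, forall n, (N <= n)%N ->
  forall (B : finType) (w : B -> R), (forall b, 0 <= w b) -> \sum_b w b = 1 ->
  forall L (Y : seq A -> pred {ffun 'I_n -> B}),
  (forall v, v \in words A L -> Pr w (Y v) <= (n%:R * wt p v) ^+ 2) ->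
  (forall u v, u \in words A L -> v \in words A L -> (M <= size u)%N -> (M <= size v)%N ->
     ~~ prefix u v -> ~~ prefix v u ->
     Pr w (fun x => Y u x && Y v x) <= (1 + kap) * (Pr w (Y u) * Pr w (Y v))) ->
  Pr w (fun x => e * n%:R <= `|total R L Y x - mean w L Y|) <= d.
Proof.
move=> e0 d0; have c0 := spread_gt0 hA hp hp1; set c := spread p in c0.
have ed0 : 0 < e ^+ 2 * d by rewrite mulr_gt0// exprn_gt0.
(* With [mean <= 4 n / c], this term uses up a quarter of [d * (e n)^2]; the terms linear in [n] get
   one half, and the deep words the last quarter. *)
pose kap := e ^+ 2 * d / 4 * (c / 4) ^+ 2.
have kap0 : 0 < kap by rewrite mulr_gt0 ?divr_gt0// exprn_gt0// divr_gt0.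
exists kap => // M.
have t0 : 0 < e ^+ 2 * d / 8 by rewrite divr_gt0.
have [D hD] := depth_tail_small hA hp hp1 t0.
pose q := (2 * (size (words A M))%:R + 2 * D%:R) * (4 / c).
have q0 : 0 <= q.
  by apply: mulr_ge0; [rewrite addr_ge0 ?mulr_ge0|rewrite divr_ge0 ?(ltW c0)].
exists (Num.truncn (q / (e ^+ 2 * d / 2))).+1 => n hn B w w0 w1 L Y hY hpair.
have n0 : (0 < n)%N by exact: leq_trans hn.
have n0' : 0 < n%:R :> R by rewrite ltr0n.
have t1 : 0 < e * n%:R by rewrite mulr_gt0.
have t2 : 0 < (e * n%:R) ^+ 2 by rewrite exprn_gt0.
rewrite -(ler_pM2r t2); apply: (le_trans (chebyshev_finite w0 _ _ t1)).
apply: (le_trans (second_moment w0 w1 (ltW kap0) hpair)).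
have hm := mean_le hA hp hp1 w0 w1 n0 hY; rewrite -/c in hm.
have hs := sum_depth_le hA hp hp1 w0 w1 hY D.
set m := mean w L Y in hm hs *; set sd := \sum_(v <- _) _ in hs *.
have m0 : 0 <= m by apply: sumr_ge0 => v _; exact: Pr_ge0 w0 w1 _.
have hq : q <= e ^+ 2 * d / 2 * n%:R.
  rewrite mulrC -ler_pdivrMr ?divr_gt0//; apply: ltW.
  by rewrite (lt_le_trans (truncnS_gt _))// ler_nat.
have h1 : kap * m ^+ 2 <= e ^+ 2 * d / 4 * n%:R ^+ 2.
  have -> : e ^+ 2 * d / 4 * n%:R ^+ 2 = kap * (4 * n%:R / c) ^+ 2.
    by rewrite /kap; field; rewrite gt_eqF.
  rewrite ler_pM2l// lerXn2r ?nnegrE//; apply: le_trans hm; exact: m0.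
have h2 : (2 * (size (words A M))%:R + 2 * D%:R) * m <= e ^+ 2 * d / 2 * n%:R ^+ 2.
  apply: (@le_trans _ _ (q * n%:R)).
    rewrite /q -mulrA ler_wpM2l ?addr_ge0 ?mulr_ge0//.
    by apply: (le_trans hm); rewrite le_eqVlt; apply/orP; left; apply/eqP; ring.
  by rewrite expr2 mulrA ler_pM2r.
have h3 : n%:R ^+ 2 * depth_tail p D <= n%:R ^+ 2 * (e ^+ 2 * d / 8).
  by rewrite ler_wpM2l ?sqr_ge0.
have -> : d * (e * n%:R) ^+ 2 = e ^+ 2 * d / 4 * n%:R ^+ 2 + e ^+ 2 * d / 2 * n%:R ^+ 2
   + 2 * (n%:R ^+ 2 * (e ^+ 2 * d / 8)) by field.
move: h2; rewrite mulrDl; lra.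
Qed.

End Concentration.

Lemma prefix_cat2l (T : eqType) (v s t : seq T) : prefix (v ++ s) (v ++ t) = prefix s t.
Proof. by rewrite prefix_catr// eqxx. Qed.

(** * Nodes and leaves of a trie *)

Section Counting.
Variables (A : finType) (n : nat) (x : 'I_n -> nat -> A).
Implicit Types (s t v b : seq A) (i j : 'I_n).

Local Notation cnt := (prefix_count x).

Lemma prefix_countE s : cnt s = #|[set i | starts (x i) s]%SET|.
Proof.
apply: eq_card => i; rewrite inE; apply/idP/idP => [h|h].
  by move: h; rewrite inE.
by apply: mem_set.
Qed.

Lemma cnt_prefix s t : prefix s t -> (cnt t <= cnt s)%N.
Proof.
move=> st; rewrite !prefix_countE; apply/subset_leq_card/fintype.subsetP => i.
by rewrite !inE; exact: starts_prefix.
Qed.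

Lemma cnt_gt0 s i : starts (x i) s -> (0 < cnt s)%N.
Proof. by move=> h; rewrite prefix_countE; apply/card_gt0P; exists i; rewrite inE. Qed.

Lemma cnt_gt0P s : (0 < cnt s)%N -> exists i, starts (x i) s.
Proof. by rewrite prefix_countE => /card_gt0P[i]; rewrite inE; exists i. Qed.

Lemma cnt_le1_inj s i j : (cnt s <= 1)%N -> starts (x i) s -> starts (x j) s -> i = j.
Proof.
rewrite prefix_countE => /fintype.card_le1_eqP h hi hj.
by apply: h; rewrite inE.
Qed.

Lemma cnt_ge2 s i j : i != j -> starts (x i) s -> starts (x j) s -> (2 <= cnt s)%N.
Proof.
by move=> ij hi hj; rewrite leqNgt; apply/negP => h; move/eqP: ij; apply; exact: cnt_le1_inj hi hj.
Qed.

Lemma cnt_ge2P s i : (2 <= cnt s)%N -> exists2 j, j != i & starts (x j) s.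
Proof.
move=> h; apply/exists_inP; apply: contraLR h; rewrite negb_exists_in -ltnNge ltnS.
move=> /forall_inP h; rewrite prefix_countE -(cards1 i) subset_leq_card//.
apply/fintype.subsetP => j; rewrite !inE; apply: contraTT => /h; by [].
Qed.

Lemma cnt_nil : cnt [::] = n.
Proof.
rewrite prefix_countE -[RHS]card_ord; apply: eq_card => i.
by rewrite !inE starts_nil.
Qed.

Lemma trie_child v i : internal x v -> starts (x i) v -> trie x (rcons v (x i (size v))).
Proof.
move=> hv hi; have h : (0 < cnt (rcons v (x i (size v))))%N.
  by apply: (@cnt_gt0 _ i); rewrite starts_rcons hi eqxx.
have [h2|h2] := leqP 2 (cnt (rcons v (x i (size v)))); [by left|right].
split; first by apply/eqP; rewrite eqn_leq h andbT -ltnS.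
by right; exists v, (x i (size v)).
Qed.

Lemma external_cat v b : (cnt v <= 1)%N -> trie x (v ++ b) -> b = [::].
Proof.
move=> hv; elim/last_ind: b => [//|b a _] [h|[_ [h|]]].
- have := leq_trans (cnt_prefix (prefix_prefix v (rcons b a))) hv.
  by rewrite leqNgt; move: h; rewrite /internal => ->.
- by move: h; rewrite -rcons_cat; case: (v ++ b).
- move=> [u [c []]]; rewrite -rcons_cat => /rcons_inj[<- _] h.
  have := leq_trans (cnt_prefix (prefix_prefix v b)) hv.
  by rewrite leqNgt; move: h; rewrite /internal => ->.
Qed.

Lemma trie_leaf v : trie x v -> (forall a, ~ trie x (rcons v a)) <-> external x v.
Proof.
move=> [hv|hv]; split=> //.
- move=> h; have [i hi] := cnt_gt0P (leq_trans (leqnSn 1) hv).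
  by have := h _ (trie_child hv hi).
- by case=> e; move: hv; rewrite /internal e.
- by move=> _ a; rewrite -cats1 => /external_cat; case: hv => -> _ /(_ (leqnn _)).
Qed.

Lemma trie_cnt v : trie x v -> (0 < cnt v)%N.
Proof. by case=> [h|[-> //]]; exact: leq_trans h. Qed.

(** So [lf i] is the shortest prefix of string [i] that no other string has, that is, the external
    node holding this string. *)
Definition leaves (lf : 'I_n -> seq A) : Prop := forall i,
  [/\ starts (x i) (lf i), (cnt (lf i) <= 1)%N
    & forall l, (l < size (lf i))%N -> (2 <= cnt (mkseq (x i) l))%N].

Lemma separated_leaves D : (forall s, size s = D -> (cnt s <= 1)%N) ->
  exists2 lf, leaves lf & forall i, (size (lf i) <= D)%N.
Proof.
move=> hD.
have ex i : exists l, (cnt (mkseq (x i) l) <= 1)%N.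
  by exists D; apply: hD; rewrite size_mkseq.
exists (fun i => mkseq (x i) (ex_minn (ex i))) => i.
  case: ex_minnP => l h1 h2; split => //; first exact: starts_mkseq.
  rewrite size_mkseq => l' ll; rewrite leqNgt; apply/negP; rewrite ltnS => /h2.
  by rewrite leqNgt ll.
rewrite size_mkseq; case: ex_minnP => l _; apply.
by apply: hD; rewrite size_mkseq.
Qed.

Lemma injective_separated : injective x ->
  exists D, forall s, size s = D -> (cnt s <= 1)%N.
Proof.
move=> xi.
have diff i j : exists l, i != j -> x i l != x j l.
  have [->|ij] := eqVneq i j; first by exists 0%N.
  apply: contrapT => h; move/eqP: ij; apply; apply: xi; apply/funext => l.
  apply/eqP; apply: contrapT => hl; apply: h; exists l => _; exact/negP.
have /choice[f hf] : forall ij : 'I_n * 'I_n,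
    exists l, ij.1 != ij.2 -> x ij.1 l != x ij.2 l by move=> [i j]; exact: diff.
(* There are finitely many pairs; the successor is needed because position [l] is seen by prefixes
   of length [l + 1]. *)
exists (\max_ij f ij).+1 => s es; rewrite leqNgt; apply/negP => h2.
have [i hi] := cnt_gt0P (ltnW h2).
have [j ji hj] := cnt_ge2P i h2.
have := hf (j, i) ji => /=; set l := f _.
have ll : (l < size s)%N by rewrite es ltnS leq_bigmax.
move/(startsP (x i 0)) : hi => /(_ l ll) ->.
by move/(startsP (x i 0)) : hj => /(_ l ll) ->; rewrite eqxx.
Qed.

Section Leaves.
Variable lf : 'I_n -> seq A.
Hypothesis hlf : leaves lf.

Lemma starts_leaf i : starts (x i) (lf i). Proof. by have [] := hlf i. Qed.

Lemma cnt_leaf i : cnt (lf i) = 1%N.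
Proof.
apply/eqP; rewrite eqn_leq; have [h1 -> _] := hlf i.
exact: cnt_gt0 h1.
Qed.

Lemma leaf_antichain i j : prefix (lf i) (lf j) -> i = j.
Proof.
move=> h; apply: (@cnt_le1_inj (lf i)); rewrite ?cnt_leaf ?starts_leaf//.
exact: starts_prefix h (starts_leaf j).
Qed.

Lemma leaf_inj : injective lf.
Proof. by move=> i j e; apply: leaf_antichain; rewrite e prefix_refl. Qed.

(** Counts decrease along a string, so its internal nodes are exactly its prefixes shorter than its
    leaf. *)
Lemma leaf_lt i v : starts (x i) v -> (size v < size (lf i))%N = (2 <= cnt v)%N.
Proof.
move=> hv; apply/idP/idP => [/(let: And3 _ _ h := hlf i in h _)|].
  by rewrite (eqP hv).
apply: contraTT; rewrite -leqNgt => h; rewrite -ltnNge ltnS.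
rewrite -(cnt_leaf i); apply: cnt_prefix.
by rewrite -(eqP hv); apply: prefix_mkseq => //; exact: starts_leaf.
Qed.

Lemma externalP v : external x v <-> exists i, v = lf i.
Proof.
split=> [[h1 h2]|[i ->]].
  have c0 : (0 < cnt v)%N by rewrite h1.
  have [i hi] := cnt_gt0P c0; exists i.
  have le : (size (lf i) <= size v)%N by rewrite leqNgt leaf_lt// h1.
  rewrite -(eqP hi) -[RHS](eqP (starts_leaf i)); congr mkseq.
  apply/eqP; rewrite eqn_leq le andbT leqNgt; apply/negP => lt.
  case: h2 => [e|[u [a [e hu]]]]; first by move: lt; rewrite e.
  move: lt; rewrite e size_rcons ltnS leqNgt leaf_lt ?hu//.
  by move: hi; rewrite e starts_rcons => /andP[].
split; first exact: cnt_leaf.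
case/lastP e : (lf i) => [|u a]; [by left|right]; exists u, a; split => //.
rewrite /internal -(@leaf_lt i) ?e ?size_rcons//.
by have := starts_leaf i; rewrite e starts_rcons => /andP[].
Qed.

Lemma leaf_prefix_node v i : prefix v (lf i) -> trie x v.
Proof.
move=> h; have hv := starts_prefix h (starts_leaf i).
have [h2|h2] := leqP 2 (cnt v); [by left|right].
apply/externalP; exists i; move: h; rewrite prefixE => /eqP <-.
by apply: take_oversize; rewrite leqNgt leaf_lt// -leqNgt.
Qed.

Lemma num_nodes_seq (T : set (seq A)) (s : seq (seq A)) : uniq s ->
  (forall v, T v <-> v \in s) -> num_nodes T = size s.
Proof.
move=> us hT; rewrite /num_nodes.
have -> : T = [set` [fset v in s]%fset].
  by apply/seteqP; split => v /=; rewrite in_fset => /hT.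
by rewrite set_fsetK card_fseq undup_id.
Qed.

Lemma num_leaves_trie : num_leaves (trie x) = n.
Proof.
rewrite /num_leaves (@num_nodes_seq _ [seq lf i | i <- enum 'I_n]).
- by rewrite size_map size_enum_ord.
- by rewrite map_inj_uniq ?enum_uniq//; exact: leaf_inj.
- move=> v; split=> [[h /(trie_leaf h)/externalP[i ->]]|/mapP[i _ ->]].
    by rewrite map_f ?mem_enum.
  have h : external x (lf i) by apply/externalP; exists i.
  by split; [right|apply/trie_leaf => //; right].
Qed.

Section Depth.
Variable D : nat.
Hypothesis hD : forall s, size s = D -> (cnt s <= 1)%N.

Lemma internal_size v : internal x v -> (size v < D)%N.
Proof.
move=> h; rewrite ltnNge; apply/negP => Dv.
have : (cnt (take D v) <= 1)%N by apply: hD; rewrite size_takel.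
rewrite leqNgt (leq_trans h)//; apply: cnt_prefix.
by rewrite -{2}(cat_take_drop D v) prefix_prefix.
Qed.

(** Internal nodes are shorter than [D], whereas leaves may have length [D] and are listed through
    [lf]. *)
Definition node_seq : seq (seq A) :=
  [seq v <- words A D | (2 <= cnt v)%N] ++ [seq lf i | i <- enum 'I_n].

Lemma mem_node_seq v : trie x v <-> v \in node_seq.
Proof.
rewrite mem_cat mem_filter mem_words; split.
  move=> [h|/externalP[i ->]]; last by rewrite map_f ?orbT// mem_enum.
  by rewrite (internal_size h) andbT; apply/orP; left.
move=> /orP[/andP[h _]|/mapP[i _ ->]]; first by left.
by right; apply/externalP; exists i.
Qed.

Lemma node_seq_uniq : uniq node_seq.
Proof.
rewrite cat_uniq filter_uniq ?words_uniq//= map_inj_uniq ?enum_uniq ?andbT; last exact: leaf_inj.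
apply/hasPn => v /mapP[i _ ->]; rewrite mem_filter negb_and.
by rewrite cnt_leaf.
Qed.

Lemma trie_finite : finite_set (trie x).
Proof.
have -> : trie x = [set` node_seq]; last exact: finite_seq.
by apply/seteqP; split => v /= /mem_node_seq.
Qed.

Lemma num_nodes_trie :
  num_nodes (trie x) = (n + \sum_(v <- words A D) (2 <= cnt v)%N)%N.
Proof.
rewrite (num_nodes_seq node_seq_uniq mem_node_seq) size_cat size_map size_enum_ord.
rewrite addnC size_filter; congr (_ + _)%N; rewrite -sum1_count big_mkcond/=.
by apply: eq_bigr => v _; case: ifP.
Qed.

End Depth.

Lemma fringe_bullet v : trie x v -> fringe (trie x) v = @bullet A <-> external x v.
Proof.
move=> h; split=> [e|he].
  apply/(trie_leaf h) => a; rewrite -cats1 => ha.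
  by have : fringe (trie x) v [:: a] by []; rewrite e.
apply/seteqP; split => b /=.
  by move=> /external_cat -> //; case: he => ->.
by move=> ->; rewrite /fringe/= cats0.
Qed.

Lemma fringe_count_bullet : fringe_count (@bullet A) (trie x) = n.
Proof.
rewrite -[RHS]num_leaves_trie /num_leaves; congr num_nodes.
apply/seteqP; split => v /= [h1 h2]; split => //.
  by apply/(trie_leaf h1)/fringe_bullet.
by apply/(fringe_bullet h1)/(trie_leaf h1).
Qed.

End Leaves.

End Counting.

(** * Fringe trees equal to a given trie *)

Section Ramification.
Variables (A : finType) (m : nat) (y : 'I_m -> nat -> A) (lf : 'I_m -> seq A).
Hypothesis hlf : leaves y lf.
Hypothesis m2 : (2 <= m)%N.

(** The leafwise form of the event that the fringe tree at [v] is the given trie. Unlike an equality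
    of node sets it visibly depends on finitely many letters, and it is a pattern in the sense of
    [occ]. *)
Definition ramified (n : nat) (x : 'I_n -> nat -> A) (v : seq A) : bool :=
  [exists s : {ffun 'I_m -> 'I_n}, injectiveb s &&
    ([forall j, starts (x (s j)) (v ++ lf j)] &&
     [forall i, (i \notin codom s) ==> ~~ starts (x i) v])].

Lemma ramifiedP n (x : 'I_n -> nat -> A) v :
  reflect (fringe (trie x) v = trie y) (ramified x v).
Proof.
have lf0 j : lf j != [::].
  apply/eqP => e; have := cnt_leaf hlf j; rewrite e cnt_nil => m1.
  by move: (m2); rewrite {1}m1.
apply: (iffP existsP).
  move=> [s /andP[/injectiveP si /andP[/forallP hs /forallP hout]]].
  have sv i : starts (x i) v -> exists j, i = s j.
    move=> hi; have [/codomP[j ->]|h] := boolP (i \in codom s); first by exists j.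
    by have := implyP (hout i) h; rewrite hi.
  (* Any string through [v] is some [s j'], and distinct leaves are not prefixes of each other. *)
  have cl j : prefix_count x (v ++ lf j) = 1%N.
    apply/eqP; rewrite eqn_leq (cnt_gt0 (hs j)) andbT leqNgt; apply/negP => h.
    have [i ij hi] := cnt_ge2P (s j) h.
    have [j' e] := sv i (starts_cat hi).
    have hi' : starts (x (s j')) (v ++ lf j) by rewrite -e.
    have := starts_comparable (hs j') hi'; rewrite !prefix_cat2l => /orP[] /(leaf_antichain hlf) ej;
      by move: ij; rewrite e ej eqxx.
  have int b : internal y b -> internal x (v ++ b).
    move=> hb; have [j hj] := cnt_gt0P (ltnW hb).
    have [j' jj hj'] := cnt_ge2P j hb.
    have pre k : starts (y k) b -> starts (x (s k)) (v ++ b).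
      move=> hk; apply: starts_prefix (hs k); rewrite prefix_cat2l.
      rewrite -(eqP (starts_leaf hlf k)); apply: prefix_mkseq => //.
      by rewrite ltnW// (leaf_lt hlf hk).
    apply: (@cnt_ge2 _ _ _ _ (s j) (s j')); rewrite ?pre//.
    by apply: contra jj => /eqP/si ->.
  apply/seteqP; split => b /=.
    move=> hb; have [i hi] := cnt_gt0P (trie_cnt hb).
    have [j e] := sv i (starts_cat hi).
    have hi' : starts (x i) (v ++ lf j) by rewrite e.
    have := starts_comparable hi hi'; rewrite !prefix_cat2l => /orP[|/prefixP[c ec]].
      exact: leaf_prefix_node.
    move: hb; rewrite /fringe/= ec catA => /external_cat; rewrite cl => /(_ (leqnn _)) ->.
    by rewrite cats0; apply: leaf_prefix_node (prefix_refl _).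
  move=> [hb|/(externalP hlf)[j ->]]; first by left; exact: int.
  right; split; first exact: cl.
  right; case/lastP e: (lf j) (lf0 j) => [|u c] // _.
  exists (v ++ u), c; rewrite rcons_cat; split => //; apply: int.
  rewrite /internal -(leaf_lt hlf (i := j)) ?e ?size_rcons//.
  by have := starts_leaf hlf j; rewrite e starts_rcons => /andP[].
move=> e.
have eT b : trie x (v ++ b) <-> trie y b.
  by rewrite -[trie y b]/(trie y b) -e.
have leafx j : external x (v ++ lf j).
  have h : external y (lf j) by apply/(externalP hlf); exists j.
  have hy : trie y (lf j) by right.
  apply/trie_leaf; first exact/eT.
  by move=> a; rewrite rcons_cat => /eT; exact: (trie_leaf hy).2 h a.
have /choice[s hs] : forall j, exists i, starts (x i) (v ++ lf j).
  by move=> j; apply: cnt_gt0P; case: (leafx j) => ->.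
have si : injective s.
  move=> j j' ej; have hj' : starts (x (s j)) (v ++ lf j') by rewrite ej.
  have := starts_comparable (hs j) hj'; rewrite !prefix_cat2l => /orP[] /(leaf_antichain hlf) //.
exists [ffun j => s j]; apply/andP; split.
  by apply/injectiveP => j j'; rewrite !ffunE => /si.
apply/andP; split; first by apply/forallP => j; rewrite ffunE.
apply/forallP => i; apply/implyP => hi; apply: contra hi => hi.
(* A further string through [v] is followed downwards until it leaves [trie y]. Its last node there
   is a leaf [lf j], and [v ++ lf j] already belongs to the string [s j]. *)
pose z l := x i (size v + l)%N.
have zS l : starts (x i) (v ++ mkseq z l).
  have -> : v ++ mkseq z l = mkseq (x i) (size v + l).
    rewrite [RHS]/mkseq iotaD map_cat -/(mkseq _ _) (eqP hi); congr (_ ++ _).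
    have -> : (0 + size v = size v + 0)%N by rewrite addnC.
    by rewrite iotaDl -map_comp.
  exact: starts_mkseq.
have T0 : trie y (mkseq z 0).
  by left; rewrite /internal cnt_nil.
pose D := \max_j size (lf j).
have hD t : size t = D -> (prefix_count y t <= 1)%N.
  move=> es; rewrite leqNgt; apply/negP => h; have [j hj] := cnt_gt0P (ltnW h).
  by move: h; rewrite -(leaf_lt hlf hj) es ltnNge leq_bigmax.
have TD : ~ trie y (mkseq z D.+1).
  move=> [/(internal_size hD)|/(externalP hlf)[j ej]].
    by rewrite size_mkseq ltnNge leqnSn.
  have := leq_bigmax (F := fun j => size (lf j)) j.
  by rewrite -/D -ej size_mkseq ltnn.
have ex : exists l, `[< ~ trie y (mkseq z l) >] by exists D.+1; apply/asboolP.
case: (ex_minnP ex) => -[/asboolP//|l] /asboolP hl hmin.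
have Tl : trie y (mkseq z l).
  apply: contrapT => h; have := hmin l (introT (asboolP _) h).
  by rewrite ltnn.
have Sl : trie x (v ++ mkseq z l) by apply/eT.
have El : external x (v ++ mkseq z l).
  case: (Sl) => // hI; case: hl; apply/eT.
  have -> : v ++ mkseq z l.+1 = rcons (v ++ mkseq z l) (x i (size (v ++ mkseq z l))).
    by rewrite mkseqS -rcons_cat size_cat size_mkseq.
  exact: trie_child.
have : external y (mkseq z l).
  apply/(trie_leaf Tl) => a /eT; rewrite -rcons_cat.
  exact: (trie_leaf Sl).2 El a.
move=> /(externalP hlf)[j ej]; apply/codomP; exists j; rewrite ffunE.
apply: (@cnt_le1_inj _ _ x (v ++ lf j)); rewrite ?hs//.
  by case: (leafx j) => ->.
by rewrite -ej.
Qed.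

End Ramification.

(** * Random strings *)

Section FiniteStrings.
Variables (R : realType) (A : finType) (p : A -> R) (a0 : A).
Hypothesis hA : (2 <= #|A|)%N.
Hypothesis hp : forall a, 0 < p a.
Hypothesis hp1 : \sum_(a : A) p a = 1.

(** Letters beyond the block are filled with [a0]; only events decided by the first [L] letters are
    evaluated on such strings. *)
Definition extend (L : nat) (g : {ffun 'I_L -> A}) (l : nat) : A :=
  if insub l is Some j then g j else a0.

Lemma extendE L (g : {ffun 'I_L -> A}) (j : 'I_L) : extend g j = g j.
Proof. by rewrite /extend valK. Qed.

Definition block_weight (L : nat) (g : {ffun 'I_L -> A}) : R := \prod_j p (g j).

Lemma block_weight_ge0 L (g : {ffun 'I_L -> A}) : 0 <= block_weight g.
Proof. by apply: prodr_ge0 => j _; exact: ltW. Qed.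

Lemma block_weight_sum L : \sum_(g : {ffun 'I_L -> A}) block_weight g = 1.
Proof.
by rewrite /block_weight -(bigA_distr_bigA (fun _ a => p a)) big1.
Qed.

Lemma pr_starts L v : (size v <= L)%N ->
  pr (@block_weight L) (fun g => starts (extend g) v) = wt p v.
Proof.
move=> vL; pose h (j : 'I_L) (a : A) : R := ((j < size v)%N ==> (a == nth a0 v j))%:R.
have -> : pr (@block_weight L) (fun g => starts (extend g) v) =
    Ex p (fun g : {ffun 'I_L -> A} => \prod_j h j (g j)).
  apply: eq_bigr => g _; congr (_ * _).
  case: (boolP (starts _ _)) => [/(startsP a0) hs|hn].
    rewrite big1// => j _; rewrite /h; case: ltnP => //= jv.
    by rewrite -hs// extendE eqxx.
  have [j hj] : exists j : 'I_L, ~~ ((j < size v)%N ==> (g j == nth a0 v j)).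
    apply/existsP; rewrite -negb_forall; apply: contra hn => /forallP hf.
    apply/(startsP a0) => i iv; have iL : (i < L)%N := leq_trans iv vL.
    by have := hf (Ordinal iL); rewrite /= iv /= -extendE => /eqP.
  by rewrite (bigD1 j)//= /h (negbTE hj) mul0r.
rewrite Ex_prod /wt (big_nth a0) big_mkord.
rewrite (big_ord_widen _ (fun i => p (nth a0 v i)) vL) [RHS]big_mkcond/=.
apply: eq_bigr => j _; rewrite /h; case: ltnP => /= jv.
  by rewrite (bigD1 (nth a0 v j))//= eqxx mulr1 big1 ?addr0// => a /negbTE ->; rewrite mulr0.
by under eq_bigr do rewrite mulr1.
Qed.

End FiniteStrings.

(** * Transfer to finite product spaces *)

Section Law.
Variables (R : realType) (A : finType) (p : A -> R) (a0 : A).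
Hypothesis hp : forall a, 0 < p a.
Hypothesis hp1 : \sum_(a : A) p a = 1.
Variables (d : measure_display) (Omega : measurableType d).
Variable P : probability Omega R.
Variable Xi : nat -> nat -> Omega -> A.
Hypothesis hXi : iid_strings p P Xi.

Definition strings n (w : Omega) : 'I_n -> nat -> A := fun i j => Xi i j w.

Definition local_pred n L (E : ('I_n -> nat -> A) -> Prop) :=
  forall x x', (forall i l, (l < L)%N -> x i l = x' i l) -> E x -> E x'.

Definition blocks n L (g : {ffun 'I_n -> {ffun 'I_L -> A}}) : 'I_n -> nat -> A :=
  fun i => extend a0 (g i).

Let cyl n L (g : {ffun 'I_n -> {ffun 'I_L -> A}}) : set Omega :=
  [set w | forall (i : 'I_n) (l : 'I_L), Xi i l w = g i l].

Let idx n L : seq (nat * nat) := [seq (val u.1, val u.2) | u : 'I_n * 'I_L].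

Let letter n L (g : {ffun 'I_n -> {ffun 'I_L -> A}}) (q : nat * nat) : A :=
  if insub q.1 is Some i then extend a0 (g i) q.2 else a0.

Lemma cylE n L (g : {ffun 'I_n -> {ffun 'I_L -> A}}) :
  cyl g = \bigcap_(q in [set` [fset q in idx n L]%fset])
     (Xi q.1 q.2 @^-1` [set letter g q]).
Proof.
apply/seteqP; split => w /= h.
  move=> q; rewrite /= in_fset => /mapP[[i l] _ ->] /=.
  by rewrite h /letter/= valK extendE.
move=> i l; have := h (val i, val l); rewrite /= in_fset.
rewrite (map_f (fun u : 'I_n * 'I_L => (val u.1, val u.2)) (x := (i, l))) ?mem_enum//.
by move=> /(_ isT); rewrite /letter/= valK extendE.
Qed.

Lemma measurable_cyl n L (g : {ffun 'I_n -> {ffun 'I_L -> A}}) : measurable (cyl g).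
Proof.
rewrite cylE; apply: fin_bigcap_measurable; first exact: finite_fset.
by move=> q _; case: hXi => h _ _; exact: h.
Qed.

Lemma P_cyl n L (g : {ffun 'I_n -> {ffun 'I_L -> A}}) :
  P (cyl g) = (\prod_i block_weight p (g i))%:E.
Proof.
have [hm hP hind] := hXi.
rewrite cylE (hind [fset q in idx n L]%fset (fun q => [set letter g q])).
have uidx : uniq (idx n L).
  rewrite map_inj_uniq ?enum_uniq// => -[i l] [i' l'] /= [e1 e2].
  by congr pair; apply: val_inj.
rewrite (perm_big (idx n L)) /=; last first.
  by apply: uniq_perm; [exact: fset_uniq|exact: uidx|move=> q; rewrite in_fset].
rewrite big_map big_enum/=.
under eq_bigr do rewrite hP.
rewrite prodEFin; congr EFin; rewrite /block_weight pair_bigA/=.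
by apply: eq_bigr => -[i l] _ /=; rewrite /letter/= valK extendE.
Qed.

Lemma law_cover n L (E : ('I_n -> nat -> A) -> Prop) : local_pred L E ->
  [set w | E (strings w)] =
  \bigcup_(g in [set g : {ffun 'I_n -> {ffun 'I_L -> A}} | E (blocks g)]) cyl g.
Proof.
move=> hE; apply/seteqP; split => w /=.
  move=> h; exists [ffun i => [ffun l : 'I_L => Xi (val i) (val l) w]].
    rewrite /=; apply: hE h => i l lL.
    by rewrite /blocks -[l]/(val (Ordinal lL)) extendE !ffunE.
  by move=> i l; rewrite !ffunE.
move=> [g /= hg hc]; apply: hE hg => i l lL.
by rewrite /blocks -[l]/(val (Ordinal lL)) extendE /strings hc.
Qed.

Lemma finite_ffun n L (D : set {ffun 'I_n -> {ffun 'I_L -> A}}) : finite_set D.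
Proof. exact: finite_finset. Qed.

Lemma measurable_local n L (E : ('I_n -> nat -> A) -> Prop) : local_pred L E ->
  measurable [set w | E (strings w)].
Proof.
move=> hE; rewrite (law_cover hE); apply: fin_bigcup_measurable.
  exact: finite_ffun.
by move=> g _; exact: measurable_cyl.
Qed.

(** A local event is a finite disjoint union of cylinders, whose probabilities are given by
    independence. *)
Lemma P_local n L (E : ('I_n -> nat -> A) -> Prop)
    (e : pred {ffun 'I_n -> {ffun 'I_L -> A}}) : local_pred L E ->
  (forall g, reflect (E (blocks g)) (e g)) ->
  P [set w | E (strings w)] = (Pr (@block_weight _ _ p L) e)%:E.
Proof.
move=> hE he; rewrite (law_cover hE) measure_fin_bigcup//; first last.
- by move=> g _; exact: measurable_cyl.
- apply/trivIsetP => g g' _ _; apply: contraNeq => /set0P[w [h h']].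
  apply/eqP/ffunP => i; apply/ffunP => l; by rewrite -h -h'.
- exact: finite_ffun.
rewrite (@fsbigE _ _ _ _ _ [seq g <- index_enum _ | e g]); first last.
- move=> g /= hg; rewrite mem_filter mem_index_enum andbT.
  by move/he: hg => ->.
- by move=> g /=; rewrite mem_filter => /andP[/he].
- by rewrite filter_uniq ?index_enum_uniq.
rewrite big_filter_cond /Pr /Ex big_mkcond/= -sumEFin; apply: eq_bigr => g _.
have -> : (g \in [set g | E (blocks g)]) = e g.
  by apply/idP/idP => [|/he h]; [rewrite inE => /he|exact: mem_set].
by rewrite andbb P_cyl; case: (e g); rewrite ?mulr1 ?mulr0.
Qed.

End Law.

Lemma leq_ffact2 n k l : (n ^_ (k + l) <= n ^_ k * n ^_ l)%N.
Proof.
elim: l => [|l IH]; first by rewrite addn0 ffactn0 muln1.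
rewrite addnS !ffactnSr mulnA; apply: leq_mul => //.
by rewrite subnDA leq_sub2r// leq_subr.
Qed.

(** * Probabilities of events at words *)

Section SampleEstimates.
Variables (R : realType) (A : finType) (p : A -> R) (a0 : A).
Hypothesis hA : (2 <= #|A|)%N.
Hypothesis hp : forall a, 0 < p a.
Hypothesis hp1 : \sum_(a : A) p a = 1.
Local Notation rho := (coincidence p).

Lemma wt_sqr_le v : wt p v ^+ 2 <= rho ^+ size v.
Proof.
elim: v => [|a v IH]; first by rewrite wt_nil expr1n expr0.
rewrite wt_cons exprMn [leRHS]exprS; apply: ler_pM; rewrite ?sqr_ge0//.
rewrite /coincidence (bigD1 a)//= lerDl; apply: sumr_ge0 => b _; exact: sqr_ge0.
Qed.

Lemma wt_small e : 0 < e -> exists M, forall v, (M <= size v)%N -> wt p v <= e.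
Proof.
move=> e0; have r01 := coincidence01 hA hp hp1; have /andP[r0 r1] := r01.
have e2 : 0 < e ^+ 2 by rewrite exprn_gt0.
pose c := (1 - rho)^-1; pose M := Num.truncn (c / e ^+ 2).
exists M => v Mv; rewrite -(ler_pXn2r (n := 2)) ?nnegrE ?(ltW e0) ?(ltW (wt_gt0 hp v))//.
apply: (le_trans (wt_sqr_le v)); apply: (@le_trans _ _ (rho ^+ M)).
  by apply: ler_wiXn2l; rewrite ?r0 ?(ltW r1).
have := geom_decay M r01; rewrite -/c => h.
have hM : c / e ^+ 2 <= M.+1%:R by apply: ltW; exact: truncnS_gt.
rewrite ler_pdivrMr// in hM.
rewrite -(ler_pM2l (ltr0Sn R M)); exact: le_trans h hM.
Qed.

(** Bernoulli's inequality, applied to both powers, leaves exactly the square. *)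
Lemma bin_many_le_sqr n (q : R) : 0 <= q <= 1 -> bin_many n q <= (n%:R * q) ^+ 2.
Proof.
move=> /andP[q0 q1].
have q01 : 0 <= 1 - q <= 1 by lra.
have bern k : 1 - k%:R * q <= (1 - q) ^+ k.
  have := @exprB_le R (1 - q) 1 k q01; rewrite ler01 lexx expr1n => /(_ isT).
  have -> : `|1 - q - 1| = q by rewrite addrAC subrr add0r normrN ger0_norm.
  by rewrite ler_norml => /andP[h _]; lra.
have b1 := bern n; have b2 := bern n.-1.
have nq0 : 0 <= n%:R * q by rewrite mulr_ge0.
have h : n.-1%:R * q <= n%:R * q by rewrite ler_wpM2r// ler_nat leq_pred.
have : n%:R * q * (1 - n%:R * q) <= n%:R * q * (1 - q) ^+ n.-1.
  by rewrite ler_wpM2l//; lra.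
by rewrite /bin_many; lra.
Qed.

Variables (n L : nat).
Local Notation w := (@block_weight R A p L).
Local Notation S := {ffun 'I_n -> {ffun 'I_L -> A}}.

Let w0 := @block_weight_ge0 R A p hp L.
Let w1 := @block_weight_sum R A p hp1 L.

Definition sample_many (v : seq A) (g : S) : bool := (2 <= prefix_count (blocks a0 g) v)%N.

Lemma sample_manyE v : sample_many v =1 many_hits (fun b : {ffun 'I_L -> A} => starts (extend a0 b) v).
Proof. by move=> g; rewrite /sample_many prefix_countE. Qed.

Lemma Pr_sample_many v : (size v <= L)%N -> Pr w (sample_many v) = bin_many n (wt p v).
Proof.
by move=> vL; rewrite (eq_Pr w (sample_manyE v)) (Pr_many_hits n w1) (pr_starts a0 hp1).
Qed.

Lemma sample_many2 u v : (size u <= L)%N -> (size v <= L)%N ->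
  ~~ prefix u v -> ~~ prefix v u ->
  Pr w (fun g => sample_many u g && sample_many v g) <=
  Pr w (sample_many u) * Pr w (sample_many v).
Proof.
move=> uL vL uv vu.
rewrite !(eq_Pr w (sample_manyE _)).
rewrite (eq_Pr w (f := fun g => many_hits (fun b : {ffun 'I_L -> A} => starts (extend a0 b) u) g &&
   many_hits (fun b : {ffun 'I_L -> A} => starts (extend a0 b) v) g)); last first.
  by move=> g; rewrite !sample_manyE.
apply: (Pr_many_hits2 n w0 w1) => b; apply/negP => /andP[hu hv].
by have := starts_comparable hu hv; rewrite (negbTE uv) (negbTE vu).
Qed.

Variables (m : nat) (lf : 'I_m -> seq A).
Hypothesis m2 : (2 <= m)%N.
Hypothesis lf_anti : forall i j, prefix (lf i) (lf j) -> i = j.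

Definition sample_fringe (v : seq A) (g : S) : bool := ramified lf (blocks a0 g) v.

Definition leaf_weight : R := \prod_j wt p (lf j).

Local Notation pat v := (fun (j : 'I_m) (b : {ffun 'I_L -> A}) => starts (extend a0 b) (v ++ lf j)).
Local Notation avoid v := (fun b : {ffun 'I_L -> A} => ~~ starts (extend a0 b) v).

Lemma sample_fringeE v : sample_fringe v =1 occ (pat v) (avoid v).
Proof. by []. Qed.

Lemma prod_pat v : (forall j, size v + size (lf j) <= L)%N ->
  \prod_j pr w (pat v j) = wt p v ^+ m * leaf_weight.
Proof.
move=> vL; rewrite /leaf_weight -[in wt p v ^+ m](card_ord m) -prodr_const -big_split/=.
apply: eq_bigr => j _; rewrite (pr_starts a0 hp1) ?size_cat//.
by rewrite wt_cat.
Qed.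

Lemma Pr_sample_fringe v : (forall j, size v + size (lf j) <= L)%N -> (size v <= L)%N ->
  Pr w (sample_fringe v) = bin_exact leaf_weight m n (wt p v).
Proof.
move=> vfL vL; rewrite (eq_Pr w (sample_fringeE v)) Pr_occ; first last.
- move=> j j' b h h'; have := starts_comparable h h'; rewrite !prefix_cat2l.
  by move=> /orP[/lf_anti|/lf_anti ->].
- by move=> j b /starts_cat ->.
rewrite prod_pat// card_ord (pr_predC w1) (pr_starts a0 hp1)// /bin_exact.
ring.
Qed.

(** Exactly [m >= 2] strings pass through such a word; this transfers the quadratic bound to fringe
    events. *)
Lemma Pr_sample_fringe_le v : Pr w (sample_fringe v) <= Pr w (sample_many v).
Proof.
apply: (Pr_sub w0) => g hg.
have sub (j : 'I_m) (b : {ffun 'I_L -> A}) : pat v j b -> starts (extend a0 b) v.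
  exact: starts_cat.
have hg' : occ (pat v) (predC (fun b : {ffun 'I_L -> A} => starts (extend a0 b) v)) g.
  exact: hg.
by rewrite sample_manyE /many_hits (occ_hits sub hg') card_ord.
Qed.

(** The union bound for the joint pattern is compared with the exact product. As [1 - a - b <= q]
    for [q = (1 - a) * (1 - b)], the only loss is a factor [q ^+ m] from the exponents, and for
    light words it is absorbed by [1 + kap]. *)
Lemma sample_fringe2 kap e u v : 0 <= e < 1 -> 1 <= (1 + kap) * (1 - e) ^+ (2 * m) ->
  wt p u <= e -> wt p v <= e -> 0 <= kap ->
  (forall j, size u + size (lf j) <= L)%N -> (forall j, size v + size (lf j) <= L)%N ->
  (size u <= L)%N -> (size v <= L)%N -> ~~ prefix u v -> ~~ prefix v u ->
  Pr w (fun g => sample_fringe u g && sample_fringe v g) <=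
  (1 + kap) * (Pr w (sample_fringe u) * Pr w (sample_fringe v)).
Proof.
move=> /andP[e0 e1] hk ue ve k0 uf vf uL vL uv vu.
have dis (b : {ffun 'I_L -> A}) : ~~ (starts (extend a0 b) u && starts (extend a0 b) v).
  apply/negP => /andP[hu hv].
  by have := starts_comparable hu hv; rewrite (negbTE uv) (negbTE vu).
pose h (t : 'I_m + 'I_m) := match t with inl j => pat u j | inr j => pat v j end.
apply: (@le_trans _ _ (Pr w (occ h (fun b => avoid u b && avoid v b)))).
  apply: (Pr_sub w0) => g /andP[hu hv]; apply: occ_sum hu hv => j j' b.
  by apply: contra (dis b) => /andP[/starts_cat -> /starts_cat ->].
apply: (le_trans (Pr_occ_le n w0 _ _)).
rewrite (prU w1 dis) !(pr_starts a0 hp1)// big_sumType/= !prod_pat// card_sum card_ord.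
rewrite !Pr_sample_fringe// /bin_exact.
set a := wt p u in ue *; set b := wt p v in ve *; set f := leaf_weight.
have a0' : 0 < a by exact: wt_gt0.
have b0' : 0 < b by exact: wt_gt0.
have f0 : 0 <= f by apply: prodr_ge0 => j _; exact/ltW/wt_gt0.
have [nm|mn] := ltnP n (m + m).
  rewrite (ffact_small nm) !mul0r; apply: mulr_ge0; first by rewrite addr_ge0.
  by apply: mulr_ge0; rewrite !mulr_ge0 ?exprn_ge0 ?subr_ge0 ?(ltW a0') ?(ltW b0') ?(wt_le1 hA hp hp1).
have c0 : 0 <= 1 - a - b.
  rewrite /a /b -(pr_starts a0 hp1 uL) -(pr_starts a0 hp1 vL) -(prU w1 dis).
  exact: pr_ge0.
set q := (1 - a) * (1 - b).
have cq : 1 - a - b <= q.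
  have : 0 <= a * b by rewrite mulr_ge0 ?(ltW a0') ?(ltW b0').
  by rewrite /q; lra.
have qe : (1 - e) ^+ 2 <= q.
  by rewrite /q expr2; apply: ler_pM; rewrite ?subr_ge0 ?(ltW e1)// lerD2l lerN2.
have q0 : 0 <= q by apply: le_trans qe; rewrite sqr_ge0.
have kq : 1 <= (1 + kap) * q ^+ m.
  apply: (le_trans hk); rewrite ler_wpM2l ?addr_ge0// exprM lerXn2r ?nnegrE ?sqr_ge0//.
have nm : (m <= n)%N by apply: leq_trans mn; rewrite leq_addr.
apply: (@le_trans _ _ ((n ^_ m * n ^_ m)%:R * (a ^+ m * f * (b ^+ m * f)) * q ^+ (n - (m + m)))).
  have p1 : 0 <= a ^+ m * f * (b ^+ m * f).
    by rewrite !mulr_ge0// exprn_ge0// ltW.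
  apply: ler_pM.
  - by rewrite mulr_ge0.
  - by rewrite exprn_ge0.
  - by rewrite ler_wpM2r// ler_nat leq_ffact2.
  - by rewrite lerXn2r ?nnegrE.
have -> : (1 + kap) * (f * (n ^_ m)%:R * a ^+ m * (1 - a) ^+ (n - m) *
    (f * (n ^_ m)%:R * b ^+ m * (1 - b) ^+ (n - m))) =
  ((n ^_ m * n ^_ m)%:R * (a ^+ m * f * (b ^+ m * f)) * q ^+ (n - (m + m))) * ((1 + kap) * q ^+ m).
  have e2 : (n - m = (n - (m + m)) + m)%N by rewrite subnDA subnK// leq_subRL.
  have -> : (1 - a) ^+ (n - m) = (1 - a) ^+ (n - (m + m)) * (1 - a) ^+ m by rewrite -exprD -e2.
  have -> : (1 - b) ^+ (n - m) = (1 - b) ^+ (n - (m + m)) * (1 - b) ^+ m by rewrite -exprD -e2.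
  by rewrite /q !exprMn natrM; ring.
apply: ler_peMr => //.
apply: mulr_ge0; last by rewrite exprn_ge0.
apply: mulr_ge0; first by [].
by rewrite !mulr_ge0// exprn_ge0// ltW.
Qed.

(** Only words of length exactly [D] are tested, since [words A D.+1] contains no longer ones. *)
Definition deep (D : nat) (g : S) : bool :=
  has (fun s => (D <= size s)%N && sample_many s g) (words A D.+1).

Lemma Pr_deep D : (D <= L)%N -> Pr w (deep D) <= n%:R ^+ 2 * (rho ^+ D / (1 - rho)).
Proof.
move=> DL.
apply: (@le_trans _ _ (\sum_(s <- words A D.+1 | (D <= size s)%N) Pr w (sample_many s))).
  rewrite -Ex_sum; apply: (ler_Ex w0) => g; rewrite /deep.
  elim: (words A D.+1) => [|s l IH] /=; first by rewrite big_nil.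
  rewrite big_cons; case: ifPn => //= _; case: (sample_many s g) => /=.
    by rewrite lerDl; apply: sumr_ge0.
  by rewrite add0r.
apply: (@le_trans _ _ (\sum_(s <- words A D.+1 | (D <= size s)%N) n%:R ^+ 2 * wt p s ^+ 2)).
  rewrite big_seq_cond [leRHS]big_seq_cond; apply: ler_sum => s /andP[].
  rewrite mem_words ltnS => sD _; rewrite Pr_sample_many; last exact: leq_trans sD DL.
  by rewrite -exprMn bin_many_le_sqr// (ltW (wt_gt0 hp s)) (wt_le1 hA hp hp1).
by rewrite -mulr_sumr ler_wpM2l ?sqr_ge0// (sum_wt2_ge hA hp hp1).
Qed.

End SampleEstimates.

Section SampleLimits.
Variables (R : realType) (A : finType) (p : A -> R) (a0 : A).
Hypothesis hA : (2 <= #|A|)%N.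
Hypothesis hp : forall a, 0 < p a.
Hypothesis hp1 : \sum_(a : A) p a = 1.
Local Notation rho := (coincidence p).
Local Notation wB := (@block_weight R A p).
Local Notation sample n L := {ffun 'I_n -> {ffun 'I_L -> A}}.

Lemma entropy_gt0 : 0 < entropy p.
Proof.
have /card_gt0P[a _] : (0 < #|A|)%N by exact: ltnW.
rewrite (entropyE p) (bigD1 a)//= ltr_wpDr//; last by rewrite mulr_gt0 ?(step_gt0 hA hp hp1).
by apply: sumr_ge0 => b _; rewrite mulr_ge0// ltW// (step_gt0 hA hp hp1).
Qed.

(** The [h] additional letters leave room for events that look below the word, such as those about
    its fringe tree. *)
Lemma concentration_psi (h : nat) F f G l
  (Y : forall n L, seq A -> pred (sample n L)) :
  admissible f G l -> poissonized F f ->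
  (forall x, 0 < x -> 0 <= f x <= 1) ->
  (forall n v, v \in words A (3 * n) -> Pr (@wB (3 * n + h)) (Y n (3 * n + h)%N v) = F n (wt p v)) ->
  (forall n v, v \in words A (3 * n) ->
     Pr (@wB (3 * n + h)) (Y n (3 * n + h)%N v) <= (n%:R * wt p v) ^+ 2) ->
  (forall kap, 0 < kap -> exists M, forall n u v,
     u \in words A (3 * n) -> v \in words A (3 * n) -> (M <= size u)%N -> (M <= size v)%N ->
     ~~ prefix u v -> ~~ prefix v u ->
     Pr (@wB (3 * n + h)) (fun g => Y n (3 * n + h)%N u g && Y n (3 * n + h)%N v g) <=
     (1 + kap) * (Pr (@wB (3 * n + h)) (Y n (3 * n + h)%N u) *
       Pr (@wB (3 * n + h)) (Y n (3 * n + h)%N v))) ->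
  forall e d, 0 < e -> 0 < d -> exists N, forall n, (N <= n)%N ->
    Pr (@wB (3 * n + h)) (fun g => e * n%:R <=
      `|entropy p * (\sum_(v <- words A (3 * n)) (Y n (3 * n + h)%N v g)%:R)
        - psi p f (ln n%:R) * n%:R|) <= d.
Proof.
move=> hadm hF f1 hPr hsq hpair e d e0 d0; have H0 := entropy_gt0.
have e2 : 0 < e / 2 by lra.
have eH : 0 < e / (2 * entropy p) by rewrite divr_gt0// mulr_gt0.
have [kap kap0 hk] := concentration hA hp hp1 eH d0.
have [M hM] := hpair _ kap0.
have [N1 h1] := hk M.
have F01 n v : v \in words A (3 * n) -> 0 <= F n (wt p v) <= 1.
  move=> vw; rewrite -hPr//.
  have w0 := @block_weight_ge0 R A p hp (3 * n + h); have w1 := block_weight_sum hp1 (3 * n + h).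
  by rewrite (Pr_ge0 w0 w1) (Pr_le1 w0 w1).
have [N2 h2] := mean_asymptotics hA hp hp1 hadm hF f1 F01 e2.
exists (maxn N1 N2) => n; rewrite geq_max => /andP[n1 n2].
have w0 := @block_weight_ge0 R A p hp (3 * n + h); have w1 := block_weight_sum hp1 (3 * n + h).
apply: le_trans (h1 n n1 _ _ w0 w1 (3 * n)%N (Y n (3 * n + h)%N) _ _); first last.
- by move=> u v uw vw Mu Mv uv vu; exact: hM.
- by move=> v vw; exact: hsq.
apply: (Pr_sub w0) => g.
rewrite -/(total R (3 * n) (Y n (3 * n + h)%N) g).
set t := total _ _ _ _ => hb.
have := h2 n n2.
have -> : \sum_(v <- words A (3 * n)) F n (wt p v) = mean (@wB (3 * n + h)) (3 * n) (Y n (3 * n + h)%N).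
  rewrite /mean big_seq [RHS]big_seq; apply: eq_bigr => v vw; by rewrite hPr.
set m := mean _ _ _ => hm.
have n0 : 0 <= n%:R :> R by [].
rewrite -(ler_pM2l H0).
have -> : entropy p * (e / (2 * entropy p) * n%:R) = e / 2 * n%:R.
  by field; rewrite gt_eqF.
rewrite -[X in X * `|_|](ger0_norm (ltW H0)) -normrM.
have -> : entropy p * (t - m) = (entropy p * t - psi p f (ln n%:R) * n%:R) -
  (entropy p * m - psi p f (ln n%:R) * n%:R) by ring.
have := ler_dist_dist (entropy p * t - psi p f (ln n%:R) * n%:R)
  (entropy p * m - psi p f (ln n%:R) * n%:R).
rewrite ler_norml => /andP[_ k].
set X := `|_ - _ - (_ - _)| in k *.
set b := psi p f (ln n%:R) in hb hm k *; lra.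
Qed.

Lemma many_range (x : R) : 0 < x -> 0 <= many x <= 1.
Proof.
move=> x0; have /andP[-> _] := many_bump x0; rewrite /many gerBl.
by rewrite mulr_ge0 ?expR_ge0// addr_ge0// ltW.
Qed.

Lemma sample_many_limit h e d : 0 < e -> 0 < d -> exists N, forall n, (N <= n)%N ->
    Pr (@wB (3 * n + h)) (fun g : sample n _ => e * n%:R <=
      `|entropy p * (\sum_(v <- words A (3 * n)) (sample_many a0 v g)%:R)
        - psi p (@many R) (ln n%:R) * n%:R|) <= d.
Proof.
have sL n v : v \in words A (3 * n) -> (size v <= 3 * n + h)%N.
  by rewrite mem_words => /ltnW/leq_trans; apply; rewrite leq_addr.
apply: (concentration_psi (Y := fun n L => @sample_many A a0 n L)
  (admissible_many R) (@bin_many_poisson R) many_range).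
- by move=> n v vw; rewrite Pr_sample_many// sL.
- move=> n v vw; rewrite Pr_sample_many ?sL//.
  by apply: bin_many_le_sqr; rewrite (ltW (wt_gt0 hp v)) (wt_le1 hA hp hp1).
- move=> kap kap0; exists 0%N => n u v uw vw _ _ uv vu.
  apply: (le_trans (sample_many2 a0 hp hp1 n (sL _ _ uw) (sL _ _ vw) uv vu)).
  have w0 := @block_weight_ge0 R A p hp (3 * n + h); have w1 := block_weight_sum hp1 (3 * n + h).
  by rewrite ler_peMl ?mulr_ge0 ?(Pr_ge0 w0 w1)// lerDl ltW.
Qed.

Lemma deep_limit h d : 0 < d -> exists N, forall n, (N <= n)%N ->
    Pr (@wB (3 * n + h)) (fun g : sample n _ => deep a0 (3 * n) g) <= d.
Proof.
move=> d0; have r01 := coincidence01 hA hp hp1; have /andP[r0 r1] := r01.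
pose c := (1 - rho)^-1; have c0 : 0 < c by rewrite invr_gt0 subr_gt0.
exists (Num.truncn (c ^+ 4 / d)) => n hn.
apply: (le_trans (Pr_deep a0 hA hp hp1 n (leq_addr h (3 * n)))).
have hd := geom_decay3 n r01; rewrite -/c in hd *.
have -> : n%:R ^+ 2 * (rho ^+ (3 * n) * c) = (n%:R ^+ 2 * rho ^+ (3 * n)) * c by ring.
apply: (@le_trans _ _ (c ^+ 3 / n.+1%:R * c)); first by rewrite ler_pM2r.
have -> : c ^+ 3 / n.+1%:R * c = c ^+ 4 / n.+1%:R by ring.
rewrite ler_pdivrMr// mulrC -ler_pdivrMr//; apply: (le_trans (ltW (truncnS_gt _))).
by rewrite ler_nat ltnS.
Qed.

Variables (m : nat) (lf : 'I_m -> seq A).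
Hypothesis m2 : (2 <= m)%N.
Hypothesis lf_anti : forall i j, prefix (lf i) (lf j) -> i = j.

Definition height : nat := \max_j size (lf j).

Local Notation lw := (leaf_weight p lf).

Lemma leaf_weight_ge0 : 0 <= lw.
Proof. by apply: prodr_ge0 => j _; exact/ltW/wt_gt0. Qed.

(** The left side is a probability: that of the fringe event at the root for [m] strings. *)
Lemma leaf_weight_fact : lw * m`!%:R <= 1.
Proof.
have w0 := @block_weight_ge0 R A p hp height; have w1 := block_weight_sum hp1 height.
have hj j : (size (lf j) <= height)%N by exact: (leq_bigmax (F := fun j => size (lf j))).
have := @Pr_le1 _ _ _ m w0 w1 (sample_fringe a0 lf [::]).
rewrite (Pr_sample_fringe a0 hp1 m lf_anti)//.
by rewrite /bin_exact wt_nil ffactnn subnn expr1n expr0 !mulr1.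
Qed.

Lemma leaf_gam_range (x : R) : 0 < x -> 0 <= lw * gam m x <= 1.
Proof.
move=> x0; have g0 : 0 <= gam m x by rewrite /gam mulr_ge0 ?exprn_ge0 ?expR_ge0// ltW.
rewrite mulr_ge0 ?leaf_weight_ge0//=; apply: le_trans leaf_weight_fact.
rewrite ler_wpM2l ?leaf_weight_ge0// /gam expRN ler_pdivrMr ?expR_gt0//.
exact: exp_bound.
Qed.

Lemma admissible_leaf : exists G,
  admissible (fun x => lw * gam m x) G (lw * (m - 2)`!%:R).
Proof.
exists (fun x => lw * gam_prim (m - 2) x).
case: m m2 lf lf_anti leaf_weight_ge0 => [//|[//|k]] _ lf' _ h0.
rewrite subSS subSS subn0.
by apply: admissible_scale => //; exact: admissible_gam.
Qed.

Lemma sample_fringe_limit e d : 0 < e -> 0 < d -> exists N, forall n, (N <= n)%N ->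
    Pr (@wB (3 * n + height)) (fun g : sample n _ => e * n%:R <=
      `|entropy p * (\sum_(v <- words A (3 * n)) (sample_fringe a0 lf v g)%:R)
        - psi p (fun x => lw * gam m x) (ln n%:R) * n%:R|) <= d.
Proof.
have sL n v : v \in words A (3 * n) -> (size v <= 3 * n + height)%N.
  by rewrite mem_words => /ltnW/leq_trans; apply; rewrite leq_addr.
have sLj n v : v \in words A (3 * n) ->
    forall j, (size v + size (lf j) <= 3 * n + height)%N.
  rewrite mem_words => /ltnW h j; apply: leq_add => //.
  exact: (leq_bigmax (F := fun j => size (lf j))).
have [G hadm] := admissible_leaf.
have pois : poissonized (bin_exact lw m) (fun x => lw * gam m x).
  move=> K e' K0 e'0; case: m m2 lf leaf_weight_ge0 => [//|[//|k]] _ lf' h0.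
  exact: bin_exact_poisson.
apply: (concentration_psi (Y := fun n L => @sample_fringe A a0 n L m lf) hadm pois leaf_gam_range).
- by move=> n v vw; rewrite (Pr_sample_fringe a0 hp1)// ?sL//; exact: sLj.
- move=> n v vw; apply: (le_trans (Pr_sample_fringe_le a0 hp n _ lf m2 v)).
  rewrite (Pr_sample_many a0 hp1) ?sL//.
  by apply: bin_many_le_sqr; rewrite (ltW (wt_gt0 hp v)) (wt_le1 hA hp hp1).
(* By Bernoulli's inequality [(1 - e') ^+ (2 * m)] is then at least
   [1 - kap / (1 + kap) = 1 / (1 + kap)]. *)
move=> kap kap0; pose e' := kap / (2 * m%:R * (1 + kap)).
have k1 : 0 < 1 + kap by rewrite addr_gt0.
have mR : 1 <= m%:R :> R by rewrite ler1n ltnW.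
have den : 0 < 2 * m%:R * (1 + kap) by rewrite !mulr_gt0//; lra.
have e'0 : 0 < e' by rewrite divr_gt0.
have e'1 : e' < 1 by rewrite /e' ltr_pdivrMr// mul1r; nra.
have hk : 1 <= (1 + kap) * (1 - e') ^+ (2 * m).
  have q01 : 0 <= 1 - e' <= 1 by lra.
  have := @exprB_le R (1 - e') 1 (2 * m) q01; rewrite ler01 lexx expr1n => /(_ isT).
  have -> : `|1 - e' - 1| = e' by rewrite addrAC subrr add0r normrN ger0_norm// ltW.
  rewrite ler_norml natrM => /andP[h _].
  have he : (1 + kap) * (2 * m%:R * e') = kap.
    by rewrite /e'; field; rewrite !gt_eqF//; lra.
  have : (1 + kap) * (1 - 2 * m%:R * e') <= (1 + kap) * (1 - e') ^+ (2 * m).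
    by rewrite ler_pM2l//; lra.
  by rewrite mulrBr he; lra.
have [M hM] := wt_small hA hp hp1 e'0.
exists M => n u v uw vw Mu Mv uv vu.
apply: (@sample_fringe2 _ _ _ a0 hA hp hp1 n _ m lf lf_anti kap e') => //.
- by rewrite (ltW e'0).
- exact: hM.
- exact: hM.
- exact: ltW.
- exact: sLj.
- exact: sLj.
- exact: sL.
- exact: sL.
Qed.

End SampleLimits.

(** * Dependence on finitely many letters *)

Section Locality.
Variables (A : finType) (n : nat) (x x' : 'I_n -> nat -> A) (L : nat).
Hypothesis xx : forall i l, (l < L)%N -> x i l = x' i l.

Lemma starts_local i s : (size s <= L)%N -> starts (x i) s = starts (x' i) s.
Proof.
move=> sL; rewrite /starts; congr (_ == _); apply: (@eq_from_nth _ (x i 0)).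
  by rewrite !size_mkseq.
by move=> l; rewrite size_mkseq => ls; rewrite !nth_mkseq// xx// (leq_trans ls).
Qed.

Lemma prefix_count_local s : (size s <= L)%N -> prefix_count x s = prefix_count x' s.
Proof.
move=> sL; rewrite !prefix_countE; apply: eq_card => i.
by rewrite !inE starts_local.
Qed.

Lemma trie_local s : (size s <= L)%N -> trie x s -> trie x' s.
Proof.
move=> sL [h|[h1 h2]]; first by left; rewrite /internal -prefix_count_local.
right; split; first by rewrite -prefix_count_local.
case: h2 => [->|[v [a [e h]]]]; [by left|right]; exists v, a; split => //.
rewrite /internal -prefix_count_local//; apply: leq_trans sL.
by rewrite e size_rcons.
Qed.

Lemma ramified_local m (lf : 'I_m -> seq A) v : (forall j, size v + size (lf j) <= L)%N ->
  (size v <= L)%N -> ramified lf x v = ramified lf x' v.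
Proof.
move=> vf vL; apply: eq_existsb => s; congr (_ && (_ && _)).
  by apply: eq_forallb => j; rewrite starts_local// size_cat.
by apply: eq_forallb => i; rewrite starts_local.
Qed.

End Locality.

Section TrieCounts.
Variables (A : finType) (n : nat) (x : 'I_n -> nat -> A).
Variables (m : nat) (y : 'I_m -> nat -> A) (lf : 'I_m -> seq A).
Hypothesis hlf : leaves y lf.
Hypothesis m2 : (2 <= m)%N.

Lemma ramified_internal v : ramified lf x v -> internal x v.
Proof.
move=> /existsP[s /andP[/injectiveP si /andP[/forallP hs _]]].
pose j0 := Ordinal (ltnW m2); pose j1 := Ordinal m2.
apply: (@cnt_ge2 _ _ _ _ (s j0) (s j1)); rewrite ?(starts_cat (hs _))//.
by apply/eqP => /si.
Qed.

(** As [m >= 2], copies of [trie y] sit at internal nodes, so words shorter than [D] find them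
    all. *)
Lemma fringe_count_trie D : (forall s, size s = D -> (prefix_count x s <= 1)%N) ->
  fringe_count (trie y) (trie x) = (\sum_(v <- words A D) ramified lf x v)%N.
Proof.
move=> hD; rewrite /fringe_count (@num_nodes_seq _ _ [seq v <- words A D | ramified lf x v]).
- rewrite size_filter -sum1_count big_mkcond/=.
  by apply: eq_bigr => v _; case: (ramified lf x v).
- by rewrite filter_uniq ?words_uniq.
- move=> v; rewrite mem_filter mem_words; split.
    move=> [_ /(ramifiedP hlf m2) h]; rewrite h/=.
    exact: internal_size hD _ (ramified_internal h).
  move=> /andP[h _]; split; last exact/(ramifiedP hlf m2).
  by left; exact: ramified_internal.
Qed.

End TrieCounts.

(** * Random tries *)

Section RandomTrie.
Variables (R : realType) (A : finType) (p : A -> R).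
Hypothesis hA : (2 <= #|A|)%N.
Hypothesis hp : forall a, 0 < p a.
Hypothesis hp1 : \sum_(a : A) p a = 1.
Variables (d : measure_display) (Omega : measurableType d).
Variable P : probability Omega R.
Variable Xi : nat -> nat -> Omega -> A.
Hypothesis hXi : iid_strings p P Xi.
Variable a0 : A.
Local Notation rho := (coincidence p).
Local Notation Tn := (random_trie Xi).

Lemma measurable_node n s : measurable [set w | Tn n w s].
Proof.
apply: (measurable_local (p := p) a0 hXi (n := n) (L := size s) (E := fun x => trie x s)).
by move=> x x' h; exact: (trie_local h (leqnn _)).
Qed.

(** An equality of node sets is a countable conjunction of conditions on single words, each of them
    local. *)
Lemma measurable_trie_eq n (t : set (seq A)) : measurable [set w | Tn n w = t].
Proof.
have -> : [set w | Tn n w = t] = ~` \bigcup_(s : seq A) [set w | ~ (Tn n w s <-> t s)].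
  apply/seteqP; split => w /=.
    by move=> <- [s _]; apply.
  move=> h; apply/seteqP; split => s.
    by move=> hs; apply: contrapT => hn; apply: h; exists s => //= -[/(_ hs)].
  by move=> hs; apply: contrapT => hn; apply: h; exists s => //= -[_ /(_ hs)].
apply: measurableC; apply: countable_bigcupT_measurable => // s.
have [ts|ts] := pselect (t s).
  rewrite (_ : [set w | _] = ~` [set w | Tn n w s]).
    by apply: measurableC; exact: measurable_node.
  by apply/seteqP; split => w /= h1 h2; apply: h1; [split|exact: (h2.2 ts)].
rewrite (_ : [set w | _] = [set w | Tn n w s]); first exact: measurable_node.
apply/seteqP; split => w /=; last by move=> h [/(_ h)].
by move=> h; apply: contrapT => h2; apply: h; split.
Qed.

Definition finite_trie n : set Omega := [set w | finite_set (Tn n w)].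

Lemma finite_trieE n :
  finite_trie n = \bigcup_(F : {fset seq A}) [set w | Tn n w = [set` F]].
Proof.
apply/seteqP; split => w /=; last by move=> [F _ /= h]; rewrite /finite_trie/= h.
by move=> h; exists (fset_set (Tn n w)) => //=; rewrite fset_setK.
Qed.

Lemma measurable_finite_trie n : measurable (finite_trie n).
Proof.
rewrite finite_trieE; apply: countable_bigcupT_measurable => // F.
exact: measurable_trie_eq.
Qed.

Definition deep_strings n D (x : 'I_n -> nat -> A) : bool :=
  has (fun s => (D <= size s)%N && (2 <= prefix_count x s)%N) (words A D.+1).

Lemma deep_stringsP n D (x : 'I_n -> nat -> A) : ~~ deep_strings D x ->
  forall s, size s = D -> (prefix_count x s <= 1)%N.
Proof.
move=> /hasPn h s es; have := h s; rewrite mem_words es ltnSn => /(_ isT).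
by rewrite leqnn /= -ltnNge ltnS.
Qed.

Lemma deep_local n D L : (D <= L)%N ->
  @local_pred A n L (fun x => deep_strings D x).
Proof.
move=> DL x x' h /hasP[s sw /andP[Ds hs]]; apply/hasP; exists s => //.
rewrite Ds -(prefix_count_local h)//; apply: leq_trans DL.
by move: sw; rewrite mem_words ltnS.
Qed.

Lemma P_deep n D L : (D <= L)%N ->
  P [set w | deep_strings D (strings Xi w : 'I_n -> nat -> A)] =
  (Pr (@block_weight _ _ p L) (fun g : {ffun 'I_n -> {ffun 'I_L -> A}} => deep a0 D g))%:E.
Proof.
move=> DL; apply: (P_local (p := p) (a0 := a0) hXi (E := fun x => deep_strings D x)).
  exact: deep_local.
by move=> g; exact: idP.
Qed.

(** For an infinite trie two strings agree on [D] letters for every [D], and the probability of this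
    tends to 0 as [D] grows. *)
Lemma infinite_trie_null n : P (~` finite_trie n) = 0%E.
Proof.
have r01 := coincidence01 hA hp hp1; have /andP[r0 r1] := r01.
pose c := (1 - rho)^-1; have c0 : 0 < c by rewrite invr_gt0 subr_gt0.
have mF := measurableC (measurable_finite_trie n).
have bound D : (P (~` finite_trie n) <= (n%:R ^+ 2 * c ^+ 2 / D.+1%:R)%:E)%E.
  apply: (@le_trans _ _ (P [set w | deep_strings D (strings Xi w : 'I_n -> nat -> A)])).
    apply: le_measure; rewrite ?inE//.
      exact: (measurable_local (p := p) a0 hXi (deep_local (leqnn D))).
    move=> w /= hw; apply: contrapT => /negP hd; apply: hw.
    have [lf hlf _] := separated_leaves (deep_stringsP hd).
    exact: (trie_finite hlf (deep_stringsP hd)).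
  rewrite (P_deep n (leqnn D)) lee_fin.
  apply: (le_trans (Pr_deep a0 hA hp hp1 n (leqnn D))).
  rewrite -mulrA ler_wpM2l ?sqr_ge0// -/c.
  have := geom_decay D r01; rewrite -/c => h.
  have -> : c ^+ 2 / D.+1%:R = c / D.+1%:R * c by ring.
  by rewrite ler_pM2r// ler_pdivlMr// mulrC.
have [r hr] : exists r : R, P (~` finite_trie n) = r%:E.
  by exists (fine (P (~` finite_trie n))); rewrite fineK// fin_num_measure.
have r00 : 0 <= r by rewrite -lee_fin -hr.
rewrite hr; congr EFin; apply/eqP; rewrite eq_le r00 andbT leNgt; apply/negP => rp.
set K := n%:R ^+ 2 * c ^+ 2 in bound.
have := bound (Num.truncn (K / r)); rewrite hr lee_fin ler_pdivlMr//.
by rewrite leNgt mulrC -ltr_pdivrMr// truncnS_gt.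
Qed.

Lemma P_trie_infinite n (t : set (seq A)) : infinite_set t ->
  P [set w | Tn n w = t] = 0%E.
Proof.
move=> ti; apply/eqP; rewrite eq_le measure_ge0 andbT -(infinite_trie_null n).
apply: le_measure; rewrite ?inE//; first exact: measurable_trie_eq.
  exact/measurableC/measurable_finite_trie.
by move=> w e hf; apply: ti; rewrite -(e : Tn n w = t).
Qed.

Section Conditioning.
Variables (n : nat) (V : Omega -> seq A) (hV : uniform_node P (Tn n) V).
Variables (T : set (seq A)) (T0 : T [::]).
Let E := [set w | fringe (Tn n w) (V w) = T].

Lemma P_fringe (t : set (seq A)) : finite_set t ->
  P (E `&` [set w | Tn n w = t]) =
  (P [set w | Tn n w = t] * ((fringe_count T t)%:R / (num_nodes t)%:R)%:E)%E.
Proof.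
move=> ft; have [hVm hVu] := hV.
pose D := [set v | t v /\ fringe t v = T].
have fD : finite_set D by apply: sub_finite_set ft => v [].
have -> : E `&` [set w | Tn n w = t] =
   \bigcup_(v in D) ([set w | Tn n w = t] `&` V @^-1` [set v]).
  apply/seteqP; split => w /=.
    move=> [h e]; exists (V w) => //; rewrite /D/= -e; split => //.
    (* [T] contains the root, so the equality of fringe trees forces the chosen word to be a node of
       [t]; [uniform_node] says nothing about other words. *)
    have : fringe (Tn n w) (V w) [::] by rewrite h.
    by rewrite /fringe/= cats0.
  by move=> [v [tv fv] [/= e ev]]; split => //; rewrite /E/= e ev.
rewrite measure_fin_bigcup//; last first.
- by move=> v _; apply: measurableI => //; exact: measurable_trie_eq.
- move=> v v' _ _ [w [[_ /= e] [_ /= e']]]; by rewrite -e -e'.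
have [r hr] : exists r : R, P [set w | Tn n w = t] = r%:E.
  exists (fine (P [set w | Tn n w = t])); rewrite fineK// fin_num_measure//.
  exact: measurable_trie_eq.
rewrite (eq_fsbigr (fun=> (r * ((num_nodes t)%:R^-1))%:E)); last first.
  by move=> v; rewrite inE => -[tv _]; rewrite EFinM -hr; exact: hVu.
rewrite fsbig_finite//= hr -EFinM sumEFin; congr EFin.
rewrite big_const_seq iter_addr addr0 count_predT -/(num_nodes D).
by rewrite -[LHS]mulr_natr -mulrA; congr (_ * _); rewrite mulrC.
Qed.

Lemma measurable_cond_prob e c :
  measurable [set w | e <= `|cond_prob P E (Tn n) w - c|].
Proof.
pose phi t := fine (P (E `&` [set w | Tn n w = t])) / fine (P [set w | Tn n w = t]).
have phiE w : cond_prob P E (Tn n) w = phi (Tn n w) by [].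
have -> : [set w | e <= `|cond_prob P E (Tn n) w - c|] =
   (\bigcup_(F : {fset seq A}) (if e <= `|phi [set` F] - c| then [set w | Tn n w = [set` F]] else set0))
   `|` (if e <= `|c| then ~` finite_trie n else set0).
  apply/seteqP; split => w /=; rewrite phiE.
    move=> h; have [fw|fw] := pselect (finite_set (Tn n w)).
      left; exists (fset_set (Tn n w)) => //; rewrite fset_setK//.
      by rewrite h.
    (* On infinite tries the quotient has denominator 0 and hence value 0, so only the comparison of
       [e] with the norm of [c] remains. *)
    by right; move: h; rewrite /phi P_trie_infinite//= invr0 mulr0 sub0r normrN => ->.
  move=> [[F _]|]; case: ifPn => //; first by move=> h /= ->.
  move=> h fw; rewrite /phi P_trie_infinite//= invr0 mulr0 sub0r normrN; exact: h.
apply: measurableU.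
  apply: countable_bigcupT_measurable => // F; case: ifP => _ //.
  exact: measurable_trie_eq.
by case: ifP => _ //; exact/measurableC/measurable_finite_trie.
Qed.

Lemma cond_prob_ae : {ae P, forall w, cond_prob P E (Tn n) w =
  (fringe_count T (Tn n w))%:R / (num_nodes (Tn n w))%:R}.
Proof.
pose Z (F : {fset seq A}) := if P [set w | Tn n w = [set` F]] == 0%E
  then [set w | Tn n w = [set` F]] else set0.
have mZ F : measurable (Z F).
  by rewrite /Z; case: ifP => _ //; exact: measurable_trie_eq.
have Z0 F : P (Z F) = 0%E by rewrite /Z; case: ifP => [/eqP//|_]; rewrite measure0.
(* The quotient is wrong only where the trie is infinite or takes one of the countably many finite
   values of probability 0. *)
pose B := (\bigcup_F Z F) `|` ~` finite_trie n.
exists B; split.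
- apply: measurableU; first exact: countable_bigcupT_measurable.
  exact/measurableC/measurable_finite_trie.
- apply: measure_negligible; last first.
    apply: negligibleU; last first.
      exists (~` finite_trie n); split => //; last exact: infinite_trie_null.
      exact/measurableC/measurable_finite_trie.
    pose Z' (k : nat) := if (choice.unpickle k : option {fset seq A}) is Some F then Z F else set0.
    rewrite (_ : \bigcup_F Z F = \bigcup_k Z' k).
      apply: negligible_bigcup => k; rewrite /Z'.
      case: (choice.unpickle k : option {fset seq A}) => [F|]; last exact: negligible_set0.
      by exists (Z F); split; [exact: mZ|exact: Z0|].
    apply/seteqP; split => w /=.
      by move=> [F _ h]; exists (choice.pickle F) => //; rewrite /Z' choice.pickleK.
    move=> [k _]; rewrite /Z'.
    by case: (choice.unpickle k : option {fset seq A}) => // F h; exists F.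
  apply: measurableU; first exact: countable_bigcupT_measurable.
  exact/measurableC/measurable_finite_trie.
move=> w /= hw; apply: contrapT => hB; apply: hw.
have fw : finite_set (Tn n w) by apply: contrapT => h; apply: hB; right.
rewrite /cond_prob/= P_fringe//.
have mt := measurable_trie_eq n (Tn n w).
have fin : P [set w0 | Tn n w0 = Tn n w] \is a fin_num by exact: fin_num_measure.
have nz : P [set w0 | Tn n w0 = Tn n w] != 0%E.
  apply/eqP => h; apply: hB; left; exists (fset_set (Tn n w)) => //.
  by rewrite /Z fset_setK// h eqxx.
rewrite fineM//= mulrAC divff ?mul1r//.
by rewrite fine_eq0.
Qed.

End Conditioning.

End RandomTrie.

(** Here [N] is about [D n / H] and [a] about [b n / H], so [n] and [H] cancel in the quotient. The
    inequality [n <= N] keeps [D] above [H / 2]. *)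
Lemma ratio_close (R : realType) (H n N a b D e M : R) :
  0 < H -> 0 < n -> n <= N -> e <= H / 2 -> `|b| <= M ->
  `|H * N - D * n| <= e * n -> `|H * a - b * n| <= e * n ->
  `|a / N - b / D| <= e * (H^-1 + 2 * M / H ^+ 2).
Proof.
move=> H0 n0 nN eH bM h1 h2; have N0 : 0 < N by exact: lt_le_trans nN.
have e0 : 0 <= e by rewrite -(pmulr_lge0 _ n0); exact: le_trans h2.
have DH : H / 2 <= D.
  have hn : H * n <= H * N by rewrite ler_pM2l.
  have en : e * n <= H / 2 * n by rewrite ler_pM2r.
  by rewrite -(ler_pM2r n0); move: h1; rewrite ler_norml => /andP[_ h]; lra.
have D0 : 0 < D by apply: lt_le_trans DH; rewrite divr_gt0.
have M0 : 0 <= M by exact: le_trans bM.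
have -> : a / N - b / D =
    (D * (H * a - b * n) - b * (H * N - D * n)) / (H * N * D).
  by field; rewrite !gt_eqF.
have HND : 0 < H * N * D by rewrite !mulr_gt0.
rewrite normrM normfV (gtr0_norm HND) ler_pdivrMr//.
apply: (le_trans (ler_normB _ _)); rewrite !normrM (gtr0_norm D0).
have t1 : D * `|H * a - b * n| <= D * (e * N).
  by rewrite ler_pM2l//; apply: (le_trans h2); rewrite ler_wpM2l.
have t2 : `|b| * `|H * N - D * n| <= M * (e * N).
  by apply: ler_pM => //; apply: (le_trans h1); rewrite ler_wpM2l.
apply: (le_trans (lerD t1 t2)).
have -> : e * (H^-1 + 2 * M / H ^+ 2) * (H * N * D) =
    D * (e * N) + (M * (e * N)) * (2 * D / H).
  by field; rewrite gt_eqF.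
rewrite lerD2l ler_peMr//; first by rewrite !mulr_ge0// ltW.
by rewrite ler_pdivlMr// mul1r; lra.
Qed.

(** * Closed formulas for the Poisson model *)

Section Poisson.
Variables (R : realType) (A : finType) (p : A -> R).
Hypothesis hp : forall a, 0 < p a.
Hypothesis hp1 : \sum_(a : A) p a = 1.
Variables (d : measure_display) (Omega : measurableType d).
Variable P : probability Omega R.
Variable Xi : nat -> nat -> Omega -> A.
Hypothesis hXi : iid_strings p P Xi.
Variable a0 : A.

Lemma poisson_prob1 (x : R) k : 0 < x ->
  poisson_prob x 0 [set k] = (x ^+ k / k`!%:R * expR (- x))%:E.
Proof.
move=> x0; rewrite /poisson_prob x0 esum_set1 /poisson_pmf x0// lee_fin.
by rewrite !mulr_ge0 ?expR_ge0 ?invr_ge0 ?exprn_ge0 ?(ltW x0).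
Qed.

Lemma f_Ei_many (x : R) : 0 < x -> f_Ei x = many x.
Proof.
move=> x0; rewrite /f_Ei (_ : [set n | (2 <= n)%N] = ~` ([set 0%N] `|` [set 1%N])).
  rewrite probability_setC//= measureU//=; last first.
    by apply/seteqP; split => // k /= [-> ].
  rewrite !poisson_prob1//= /many (_ : 1`! = 1%N)// fact0 expr0 expr1 !divr1.
  by rewrite mul1r; ring.
apply/seteqP; split => -[|[|k]] //=; first by move=> _ [].
- by move=> h; exfalso; apply: h; left.
- by move=> h; exfalso; apply: h; right.
Qed.

Variables (m : nat) (y : 'I_m -> nat -> A) (lf : 'I_m -> seq A).
Hypothesis hlf : leaves y lf.
Hypothesis m2 : (2 <= m)%N.
Local Notation lw := (leaf_weight p lf).

(** The fringe event at the root, where [q = 1]: the falling factorial vanishes for [n < m] and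
    [0 ^+ (n - m)] for [n > m]. *)
Lemma P_trie n : P [set w | random_trie Xi n w = trie y] =
  (if n == m then lw * m`!%:R else 0)%:E.
Proof.
have -> : [set w | random_trie Xi n w = trie y] =
    [set w | ramified lf (strings Xi w : 'I_n -> nat -> A) [::]].
  apply/seteqP; split => w /=.
    by move=> h; apply/(ramifiedP hlf m2); rewrite -h.
  by move=> /(ramifiedP hlf m2) <-.
have hj j : (size (lf j) <= height lf)%N by exact: leq_bigmax.
rewrite (P_local (p := p) (a0 := a0) hXi (E := fun x => ramified lf x [::])
  (e := sample_fringe a0 lf [::] : pred {ffun 'I_n -> {ffun 'I_(height lf) -> A}})).
- rewrite (Pr_sample_fringe a0 hp1)//; last exact: (leaf_antichain hlf).
  rewrite /bin_exact wt_nil expr1n mulr1 subrr expr0n subn_eq0.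
  congr EFin; case: (ltngtP n m) => [h|h|->].
  + by rewrite ffact_small// mulr0 mul0r.
  + by rewrite mulr0.
  + by rewrite ffactnn mulr1.
- by move=> x x' h; rewrite (ramified_local h).
- by move=> g; exact: idP.
Qed.

Lemma trie_prob_leaves : trie_prob P Xi (trie y) = lw * m`!%:R.
Proof. by rewrite /trie_prob (num_leaves_trie hlf) P_trie eqxx. Qed.

Lemma f_ET_gam (x : R) : 0 < x -> f_ET P Xi (trie y) x = lw * gam m x.
Proof.
move=> x0; rewrite /f_ET /product_measure1/=.
under eq_integral => k _.
  rewrite (_ : P _ = ((lw * m`!%:R)%:E * (\1_[set m] k)%:E)%E).
    over.
  rewrite (_ : xsection _ _ = [set w | random_trie Xi k w = trie y]); last first.
    by apply/seteqP; split => w; rewrite /xsection/= in_setE.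
  rewrite P_trie indicE; have [->|km] := eqVneq k m.
    by rewrite mem_set//= mule1.
  by rewrite memNset ?mule0//=; exact/eqP.
rewrite ge0_integralZl//=; last first.
  by rewrite lee_fin; apply: mulr_ge0 => //; exact: leaf_weight_ge0.
rewrite integral_indic//= setIT poisson_prob1//= /gam.
by field; rewrite pnatr_eq0 -lt0n fact_gt0.
Qed.

End Poisson.

(** * Convergence in probability *)

Section Convergence.
Variables (R : realType) (A : finType) (p : A -> R).
Hypothesis hA : (2 <= #|A|)%N.
Hypothesis hp : forall a, 0 < p a.
Hypothesis hp1 : \sum_(a : A) p a = 1.
Variables (d : measure_display) (Omega : measurableType d).
Variable P : probability Omega R.
Variable Xi : nat -> nat -> Omega -> A.
Hypothesis hXi : iid_strings p P Xi.
Variable a0 : A.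
Local Notation Tn := (random_trie Xi).

(** The measurable exceptional set makes it unnecessary to show that [X n] is measurable. *)
Definition concentrated (X : nat -> Omega -> R) (c : nat -> R) : Prop :=
  forall e dl : R, 0 < e -> 0 < dl -> exists N : nat, forall n, (N <= n)%N ->
  exists B : set Omega, [/\ measurable B, (P B <= dl%:E)%E &
    forall w, ~ B w -> `|X n w - c n * n%:R| <= e * n%:R].

Lemma deep_null n h dl : Pr (@block_weight _ _ p (3 * n + h))
    (fun g : {ffun 'I_n -> {ffun 'I_(3 * n + h) -> A}} => deep a0 (3 * n) g) <= dl ->
  (P [set w | deep_strings (3 * n) (strings Xi w : 'I_n -> nat -> A)] <= dl%:E)%E.
Proof. by move=> h1; rewrite (P_deep hXi a0 _ (leq_addr h _)) lee_fin. Qed.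

(* The trie depends on infinitely many letters, but off the event [deep_strings]
   a node statistic [s] equals a statistic [q] of finitely many letters, whose
   law is that of a finite product space. *)
Lemma concentrated_local (h : nat) (c : nat -> R) (H : R)
    (s : forall n, ('I_n -> nat -> A) -> nat)
    (q : forall n, ('I_n -> nat -> A) -> nat) :
  (forall n (x x' : 'I_n -> nat -> A),
    (forall i l, (l < 3 * n + h)%N -> x i l = x' i l) -> q n x = q n x') ->
  (forall n (x : 'I_n -> nat -> A), ~~ deep_strings (3 * n) x -> s n x = q n x) ->
  (forall e dl : R, 0 < e -> 0 < dl -> exists N, forall n, (N <= n)%N ->
    Pr (@block_weight _ _ p (3 * n + h))
     (fun g : {ffun 'I_n -> {ffun 'I_(3 * n + h) -> A}} =>
      e * n%:R <= `|H * (q n (blocks a0 g))%:R - c n * n%:R|) <= dl) ->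
  concentrated (fun n w => H * (s n (strings Xi w))%:R) c.
Proof.
move=> ql sq lim e dl e0 dl0.
have dl2 : 0 < dl / 2 by rewrite divr_gt0.
have [N1 h1] := lim _ _ e0 dl2; have [N2 h2] := deep_limit a0 hA hp hp1 h dl2.
exists (maxn N1 N2) => n; rewrite geq_max => /andP[/h1{}h1 /h2{}h2].
pose B1 := [set w | deep_strings (3 * n) (strings Xi w : 'I_n -> nat -> A)].
pose E2 (x : 'I_n -> nat -> A) : Prop := e * n%:R <= `|H * (q n x)%:R - c n * n%:R|.
have l2 : local_pred (3 * n + h) E2.
  by move=> x x' xx; rewrite /E2 (ql _ _ _ xx).
pose B2 := [set w | E2 (strings Xi w)].
have m1 : measurable B1.
  exact: (measurable_local (p := p) a0 hXi (deep_local (leqnn (3 * n)))).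
have m2 : measurable B2 by exact: (measurable_local (p := p) a0 hXi l2).
exists (B1 `|` B2); split; first exact: measurableU.
  rewrite (splitr dl) EFinD; apply: (le_trans (measureU2 _ m1 m2)).
  apply: leeD; first exact: deep_null h2.
  suff : (P B2 <= (dl / 2)%:E)%E by [].
  have -> : P B2 = _ := P_local (p := p) (a0 := a0) hXi l2 (e := fun g =>
    e * n%:R <= `|H * (q n (blocks a0 g))%:R - c n * n%:R|) (fun g => idP).
  by rewrite lee_fin.
move=> w /not_orP[/negP hd hE]; rewrite (sq _ _ hd) leNgt; apply/negP => /ltW h3.
exact: hE.
Qed.

(** The internal nodes contribute [psi_Ei]; the summand [entropy p] comes from the [n] leaves. *)
Lemma concentrated_nodes : concentrated
  (fun n w => entropy p * (num_nodes (Tn n w))%:R)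
  (fun n => psi_Ei p (ln n%:R) + entropy p).
Proof.
have psiE t : psi_Ei p t = psi p (@many R) t.
  by apply: psi_ext => x x0; exact: f_Ei_many.
pose s n (x : 'I_n -> nat -> A) := (num_nodes (trie x)).
pose q n (x : 'I_n -> nat -> A) :=
  (n + \sum_(v <- words A (3 * n)) (2 <= prefix_count x v)%N)%N.
apply: (@concentrated_local 0 _ _ s q) => //.
- move=> n x x' xx; rewrite /q; congr (_ + _)%N; rewrite !big_seq.
  apply: eq_bigr => v; rewrite mem_words => vs; rewrite (prefix_count_local xx)//.
  by rewrite addn0 ltnW.
- move=> n x hd; have hD := deep_stringsP hd.
  have [lf hlf _] := separated_leaves hD; exact: num_nodes_trie.
- move=> e dl e0 dl0; have [N h] := sample_many_limit a0 hA hp hp1 0 e0 dl0.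
  exists N => n /h; congr (_ <= _); apply: eq_Pr => g /=.
  congr (_ <= `|_|); rewrite psiE /q natrD natr_sum; ring.
Qed.

Lemma num_nodes_ge n (x : 'I_n -> nat -> A) D : ~~ deep_strings D x -> (n <= num_nodes (trie x))%N.
Proof.
move=> /deep_stringsP hD; have [lf hlf _] := separated_leaves hD.
by rewrite (num_nodes_trie hlf hD) leq_addr.
Qed.

(** Off the event [deep_strings] the count is exactly [n], which explains the special value [H] of
    [psi_ET] at the one-node trie. *)
Lemma concentrated_bullet : concentrated
  (fun n w => entropy p * (fringe_count (@bullet A) (Tn n w))%:R)
  (fun=> entropy p).
Proof.
pose s n (x : 'I_n -> nat -> A) := fringe_count (@bullet A) (trie x).
apply: (@concentrated_local 0 _ _ s (fun n _ => n)) => //.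
- move=> n x hd; have hD := deep_stringsP hd.
  have [lf hlf _] := separated_leaves hD; exact: fringe_count_bullet hlf.
- move=> e dl e0 dl0; exists 1%N => n n1; rewrite (le_trans _ (ltW dl0))//.
  rewrite le_eqVlt; apply/orP; left; apply/eqP; rewrite /Pr /Ex big1// => g _.
  by rewrite subrr normr0 leNgt mulr_gt0 ?ltr0n// mulr0.
Qed.

Lemma concentrated_fringe m (y : 'I_m -> nat -> A) lf : leaves y lf -> (2 <= m)%N ->
  concentrated (fun n w => entropy p * (fringe_count (trie y) (Tn n w))%:R)
    (fun n => psi p (f_ET P Xi (trie y)) (ln n%:R)).
Proof.
move=> hlf m2; have lf_anti := leaf_antichain hlf.
have psiE t : psi p (f_ET P Xi (trie y)) t = psi p (fun x => leaf_weight p lf * gam m x) t.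
  by apply: psi_ext => x x0; exact: (f_ET_gam hp hp1 hXi a0 hlf).
pose s n (x : 'I_n -> nat -> A) := fringe_count (trie y) (trie x).
pose q n (x : 'I_n -> nat -> A) := (\sum_(v <- words A (3 * n)) ramified lf x v)%N.
have hj j : (size (lf j) <= height lf)%N by exact: leq_bigmax.
apply: (@concentrated_local (height lf) _ _ s q) => //.
- move=> n x x' xx; rewrite /q !big_seq.
  apply: eq_bigr => v; rewrite mem_words => vs; rewrite (ramified_local xx)//.
    by move=> j; rewrite leq_add// ltnW.
  by rewrite (leq_trans (ltnW vs))// leq_addr.
- by move=> n x hd; have hD := deep_stringsP hd; exact: fringe_count_trie.
- move=> e dl e0 dl0; have [N h] := sample_fringe_limit a0 hA hp hp1 m2 lf_anti e0 dl0.
  exists N => n /h; congr (_ <= _); apply: eq_Pr => g /=.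
  by congr (_ <= `|_|); rewrite psiE /q natr_sum.
Qed.

Lemma cvg_cond_prob (T : set (seq A)) (T0 : T [::]) (b : R -> R) (M t0 : R)
    (V : nat -> Omega -> seq A) :
  (forall n, (1 <= n)%N -> uniform_node P (Tn n) (V n)) ->
  (forall t, t0 <= t -> `|b t| <= M) ->
  concentrated (fun n w => entropy p * (fringe_count T (Tn n w))%:R)
    (fun n => b (ln n%:R)) ->
  cvg_in_prob P (fun n => cond_prob P [set w | fringe (Tn n w) (V n w) = T] (Tn n))
    (fun n => b (ln n%:R) / (psi_Ei p (ln n%:R) + entropy p)).
Proof.
move=> hV bM conc eps eps0.
have H0 := entropy_gt0 hA hp hp1; set H := entropy p in H0 conc *.
have M0 : 0 <= M by apply: le_trans (bM t0 (lexx _)).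
pose K := H^-1 + 2 * M / H ^+ 2.
have K0 : 0 < K.
  by rewrite ltr_wpDr ?invr_gt0//; apply: divr_ge0; [exact: mulr_ge0|exact: sqr_ge0].
(* [ratio_close] requires [e <= H / 2] and yields the error [e * K], which has to be below [eps]. *)
pose e := Num.min (H / 2) (eps / (2 * K)).
have e0 : 0 < e by rewrite lt_min !divr_gt0// mulr_gt0.
have eH : e <= H / 2 by rewrite ge_min lexx.
have eK : e * K < eps.
  apply: (@le_lt_trans _ _ (eps / (2 * K) * K)).
    by rewrite ler_pM2r// ge_min lexx orbT.
  have -> : eps / (2 * K) * K = eps / 2 by field; rewrite gt_eqF.
  by lra.
apply/fine_cvgP; split.
  near=> n; rewrite fin_num_measure//.
  have n1 : (1 <= n)%N by near: n; exists 1%N.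
  exact: (measurable_cond_prob hA hp hp1 hXi a0 n (V n) T eps).
apply/cvgrPdist_le => /= dl dl0.
have dl3 : 0 < dl / 3 by rewrite divr_gt0.
have [N1 h1] := concentrated_nodes e0 dl3.
have [N2 h2] := conc _ _ e0 dl3.
have [N3 h3] := deep_limit a0 hA hp hp1 0 dl3.
(* The last threshold ensures [n >= 1] and [ln n >= t0], where [b] is bounded. *)
exists (maxn (maxn N1 N2) (maxn N3 (Num.truncn (expR t0)).+1)) => //= n /=.
rewrite !geq_max => /andP[/andP[/h1 [B1 [mB1 PB1 c1]] /h2 [B2 [mB2 PB2 c2]]]].
move=> /andP[/h3 /deep_null PB3 tn].
have n1 : (1 <= n)%N by exact: leq_ltn_trans tn.
set B3 := [set w | _] in PB3.
have mB3 : measurable B3.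
  exact: (measurable_local (p := p) a0 hXi (deep_local (leqnn (3 * n)))).
have nt : t0 <= ln n%:R.
  rewrite -[t0]expRK ler_ln ?posrE ?expR_gt0 ?ltr0n//.
  by apply: ltW; apply: (lt_le_trans (truncnS_gt _)); rewrite ler_nat.
have [B4 [mB4 PB4 c4]] := cond_prob_ae hA hp hp1 hXi a0 (hV n n1) T0.
pose Z := [set w | eps <= `|cond_prob P [set w | fringe (Tn n w) (V n w) = T] (Tn n) w -
  b (ln n%:R) / (psi_Ei p (ln n%:R) + H)|].
rewrite -/Z.
have mZ : measurable Z by exact: (measurable_cond_prob hA hp hp1 hXi a0 n (V n) T eps).
(* [B1] and [B2] are the deviations of the two counts, [B3] is the event that the trie may have
   fewer than [n] nodes, and the null set [B4] is where the conditional probability is not the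
   quotient of counts. *)
have sub : Z `<=` ((B1 `|` B2) `|` B3) `|` B4.
  move=> w hZ; apply: contrapT => /not_orP[/not_orP[/not_orP[n1' n2'] /negP n3'] n4'].
  have ce : cond_prob P [set w | fringe (Tn n w) (V n w) = T] (Tn n) w =
    (fringe_count T (Tn n w))%:R / (num_nodes (Tn n w))%:R.
    by apply: contrapT => h; apply: n4'; apply: c4.
  move: hZ; rewrite /Z/= ce leNgt => /negP; apply; apply: le_lt_trans eK.
  apply: (ratio_close H0 _ _ eH (bM _ nt) (c1 w n1') (c2 w n2')).
    by rewrite ltr0n.
  by rewrite ler_nat; exact: num_nodes_ge n3'.
rewrite sub0r normrN ger0_norm ?fine_ge0//.
have : (P Z <= (dl / 3 + dl / 3 + dl / 3)%:E)%E.
  have mB := measurableU _ _ mB1 mB2; have mBB := measurableU _ _ mB mB3.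
  apply: (@le_trans _ _ (P (((B1 `|` B2) `|` B3) `|` B4))).
    by apply: le_measure; rewrite ?inE//; exact: measurableU.
  have : (P (((B1 `|` B2) `|` B3) `|` B4) <= P ((B1 `|` B2) `|` B3) + P B4)%E.
    exact: measureU2.
  rewrite PB4 adde0 => /le_trans; apply.
  apply: (le_trans (measureU2 _ mB mB3)); rewrite EFinD; apply: leeD => //.
  by apply: (le_trans (measureU2 _ mB1 mB2)); rewrite EFinD; apply: leeD.
have fZ : P Z \is a fin_num by exact: fin_num_measure.
rewrite -(fineK fZ) lee_fin => h; apply: (le_trans h); lra.
Unshelve. all: by end_near.
Qed.

End Convergence.

Section TrieShape.
Variable A : finType.

Lemma num_nodes_bullet : num_nodes (@bullet A) = 1%N.
Proof. by rewrite (@num_nodes_seq _ _ [:: [::]])// => v; rewrite inE; split => /eqP. Qed.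

Lemma num_leaves_bullet : num_leaves (@bullet A) = 1%N.
Proof.
rewrite /num_leaves (@num_nodes_seq _ _ [:: [::]])// => v; rewrite inE; split.
  by case=> -> .
by move=> /eqP ->; split => // a.
Qed.

Variables (m : nat) (y : 'I_m -> nat -> A).

Lemma prefix_count_le s : (prefix_count y s <= m)%N.
Proof. by rewrite -[leqRHS](card_ord m) max_card. Qed.

Lemma trie_nil : (0 < m)%N -> trie y [::].
Proof.
rewrite leq_eqVlt => /orP[/eqP m1|m2]; last by left; rewrite /internal cnt_nil.
by right; split; [rewrite cnt_nil|left].
Qed.

Lemma trie_single : m = 1%N -> trie y = @bullet A.
Proof.
move=> m1; have no v : ~ internal y v.
  by rewrite /internal => /leq_trans /(_ (prefix_count_le v)); rewrite m1.
apply/seteqP; split => s; last by move=> ->; apply: trie_nil; rewrite m1.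
by move=> [/no//|[_ [//|[v [a [_ /no]]]]]].
Qed.

Lemma trie_nonempty_gt0 : trie y !=set0 -> (0 < m)%N.
Proof.
move=> [s h]; apply: leq_trans (prefix_count_le s).
by case: h => [/ltnW//|[->]].
Qed.

End TrieShape.

Lemma natr_fact2 (R : pzRingType) m : (2 <= m)%N ->
  m`!%:R = m%:R * (m%:R - 1) * (m - 2)`!%:R :> R.
Proof.
case: m => [|[|m]]// _; rewrite !factS subn2 /= -[m.+2%:R]natr1 addrK.
by rewrite natr1 !natrM mulrA.
Qed.

Theorem theorem4p10 (R : realType) (A : finType) (p : A -> R)
    (hA : (2 <= #|A|)%N) (hp : forall a, 0 < p a) (hp1 : \sum_(a : A) p a = 1)
    (d : measure_display) (Omega : measurableType d) (P : probability Omega R)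
    (Xi : nat -> nat -> Omega -> A) (hXi : iid_strings p P Xi)
    (V : nat -> Omega -> seq A)
    (hV : forall n, (1 <= n)%N -> uniform_node P (random_trie Xi n) (V n))
    (T : set (seq A)) (hT : is_trie T) (hT0 : T !=set0) :
  let k := num_leaves T in
  let H := entropy p in
  let Tn := random_trie Xi in
  let Tstar n w := fringe (Tn n w) (V n w) in
  let condP n := cond_prob P [set w | Tstar n w = T] (Tn n) in
  [/\ forall n, (1 <= n)%N ->
        {ae P, forall w,
          condP n w = (fringe_count T (Tn n w))%:R / (num_nodes (Tn n w))%:R},
      cvg_in_prob P condP
        (fun n => psi_ET p P Xi T (ln n%:R) / (psi_Ei p (ln n%:R) + H))
    & max_span p = 0 ->
        ((2 <= num_nodes T)%N ->
          cvg_in_prob P condP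
            (fun=> trie_prob P Xi T / ((1 + H) * (k%:R * (k%:R - 1))))) /\
        (T = @bullet A -> cvg_in_prob P condP (fun=> H / (1 + H)))].
Proof.
move=> k H Tn Tstar condP.
have [a0 _] : exists a0 : A, true.
  by have /card_gt0P[a _] := ltnW hA; exists a.
have [m [y [yi eT]]] := hT.
have m0 : (0 < m)%N by apply: (@trie_nonempty_gt0 _ _ y); rewrite -eT.
have T0 : T [::] by rewrite eT; exact: trie_nil.
have H0 : 0 < H by exact: entropy_gt0.
have [D hD] := injective_separated yi; have [lf hlf _] := separated_leaves hD.
have ek : k = m by rewrite /k eT (num_leaves_trie hlf).
have bullet_or : T = @bullet A \/ (2 <= m)%N /\ T <> @bullet A.
  move: m0; rewrite leq_eqVlt => /orP[/eqP m1|m2].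
    by left; rewrite eT trie_single.
  by right; split => // eb; move: m2; rewrite -ek /k eb num_leaves_bullet.
have psi_bullet t : T = @bullet A -> psi_ET p P Xi T t = H.
  by move=> h; rewrite /psi_ET asboolT.
have psi_large t : T <> @bullet A -> psi_ET p P Xi T t = psi p (f_ET P Xi T) t.
  by move=> h; rewrite /psi_ET asboolF.
have psi_leaf t : (2 <= m)%N -> T <> @bullet A ->
    psi_ET p P Xi T t = psi p (fun x => leaf_weight p lf * gam m x) t.
  move=> m2 h; rewrite psi_large// eT; apply: psi_ext => x x0.
  exact: (f_ET_gam hp hp1 hXi a0 hlf).
have part2 : cvg_in_prob P condP
    (fun n => psi_ET p P Xi T (ln n%:R) / (psi_Ei p (ln n%:R) + H)).
  have [eb|[m2 nb]] := bullet_or.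
    apply: (@cvg_cond_prob _ _ _ hA hp hp1 _ _ _ _ hXi a0 _ T0 _ `|H| 0) => //.
      by move=> t _; rewrite psi_bullet.
    move=> e dl e0 dl0.
    have [N h] := concentrated_bullet hA hp hp1 hXi a0 e0 dl0.
    by exists N => n /h; rewrite psi_bullet// eb.
  have [G adm] := admissible_leaf hp m2 (leaf_antichain hlf).
  have [M [t0 hM]] := psi_bounded hA hp hp1 adm.
  apply: (@cvg_cond_prob _ _ _ hA hp hp1 _ _ _ _ hXi a0 _ T0 _ M t0) => //.
    by move=> t /hM; rewrite psi_leaf.
  move=> e dl e0 dl0.
  have [N h] := concentrated_fringe hA hp hp1 hXi a0 hlf m2 e0 dl0.
  by exists N => n /h; rewrite psi_large// eT.
split => //; first by move=> n n1; exact: (cond_prob_ae hA hp hp1 hXi a0 (hV n n1) T0).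
move=> span0; have psiE f t : psi p f t = mellin f (-1).
  by rewrite /psi span0 eqxx.
have psi_EiE t : psi_Ei p t = 1.
  rewrite /psi_Ei (psi_ext p (g := @many R)); last by move=> x; exact: f_Ei_many.
  by rewrite psiE (admissible_mellin (admissible_many R)).
split => [T2|eb].
  have [eb|[m2 nb]] := bullet_or.
    by move: T2; rewrite eb num_nodes_bullet.
  have [G adm] := admissible_leaf hp m2 (leaf_antichain hlf).
  (* The numerator is the Mellin value [lw * (m - 2)!], and [lw * m!] is the probability of [T]; the
     quotient of the factorials gives [k (k - 1)]. *)
  move: part2; congr (cvg_in_prob _ _ _); apply/funext => n.
  rewrite psi_EiE psi_leaf// psiE (admissible_mellin adm) eT.
  rewrite (trie_prob_leaves hp1 hXi a0 hlf m2) ek.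
  rewrite (natr_fact2 _ m2); have m1 : m%:R - 1 != 0 :> R.
    by rewrite subr_eq0 pnatr_eq1; case: (m) m2 => [|[]].
  field; rewrite m1 pnatr_eq0 -lt0n m0 /=.
  exact: lt0r_neq0 (addr_gt0 ltr01 H0).
by move: part2; congr (cvg_in_prob _ _ _); apply/funext => n; rewrite psi_EiE psi_bullet// addrC.
Qed.
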